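(* Let $\mathbf{C}$ be a 2-category and $C,C'$ pseudo-categories in $\mathbf{C}$. The following data form a pseudo-category in $\mathrm{Cat}$: - objects: pseudo-functors from $C$ to $C'$; - morphisms: natural transformations between pseudo-functors from $C$ to $C'$; - pseudo-morphisms: pseudo-natural transformations between pseudo-functors from $C$ to $C'$; - cells: pseudo-modifications between such natural and pseudo-natural transformations. Explicitly: let $X_0$ be the category of pseudo-functors $C\to C'$ and natural transformations (composed vertically), and $X_1$ the category of pseudo-natural transformations and pseudo-modifications (composed by vertical composition of 2-cells in $\mathbf{C}$). Let $d,c:X_1\to X_0$ send $T:F\to G$ to $F$, respectively $G$, and a pseudo-modification with boundary $(\theta,\theta')$ to $\theta$, respectively $\theta'$; let $e:X_0\to X_1$ send $F$ to $id_F$ and $\theta$ to $id_\theta$; let $m:X_1\times_{X_0}X_1\to X_1$ be $(S,T)\mapsto S\otimes T$, $(\Psi,\Phi)\mapsto\Psi\otimes\Phi$; and let $\alpha,\lambda,\rho$ have components $\alpha_{U,T,S}=\alpha'\langle u,t,s\rangle$, $\lambda_T=\lambda'\circ t$, $\rho_T=\rho'\circ t$, for pseudo-natural transformations $U=(u,\upsilon)$, $T=(t,\tau)$, $S=(s,\sigma)$. Then $(X_0,X_1,d,c,e,m,\alpha,\lambda,\rho)$ is a pseudo-category in $\mathrm{Cat}$.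
   Context: Conventions. In a 2-category $\mathbf{C}$, $\circ$ (or juxtaposition) denotes composition of morphisms, horizontal composition of 2-cells and whiskering; $\cdot$ denotes vertical composition of 2-cells ($\beta\cdot\alpha$ means first $\alpha$, then $\beta$). All pullbacks mentioned are assumed to exist and are strict pullbacks in the 2-categorical sense (universal also for 2-cells), so that $\langle -,-\rangle$ denotes the induced morphism or 2-cell into a pullback (a morphism inside a pairing with a 2-cell stands for its identity 2-cell). For $d,c:C_1\to C_0$, the pullback $C_1\times_{C_0}C_1$ has projections $\pi_1,\pi_2$ with $d\pi_1=c\pi_2$; similarly for triple and quadruple pullbacks. We write $f\times g$ (with or without subscript) for $\langle f\pi_1,g\pi_2\rangle$, etc. $\mathrm{Cat}$ is the 2-category of small categories, functors and natural transformations. Pseudo-category. A pseudo-category in $\mathbf{C}$ is a system $C=(C_0,C_1,d,c,e,m,\alpha,\lambda,\rho)$ where $C_0,C_1$ are objects, $d,c:C_1\to C_0$, $e:C_0\to C_1$, $m:C_1\times_{C_0}C_1\to C_1$ are morphisms, and $\alpha:m(1_{C_1}\times_{C_0}m)\to m(m\times_{C_0}1_{C_1})$, $\lambda:m\langle ec,1_{C_1}\rangle\to 1_{C_1}$, $\rho:m\langle 1_{C_1},ed\rangle\to 1_{C_1}$ are invertible 2-cells, such that - $de=1_{C_0}=ce$; $dm=d\pi_2$, $cm=c\pi_1$; - $d\circ\lambda=1_d=d\circ\rho$, $c\circ\lambda=1_c=c\circ\rho$; $d\circ\alpha=1_{d\pi_3}$, $c\circ\alpha=1_{c\pi_1}$;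 $\lambda\circ e=\rho\circ e$; - (pentagon) $(\alpha\circ(m\times 1\times 1))\cdot(\alpha\circ(1\times 1\times m))=(m\circ(\alpha\times 1))\cdot(\alpha\circ(1\times m\times 1))\cdot(m\circ(1\times\alpha))$; - (triangle) $(m\circ(\rho\times 1))\cdot(\alpha\circ(1\times\langle ec,1\rangle))=m\circ(1\times\lambda)$. The structure of $C'$ is denoted by the same letters with primes. For a pseudo-category in $\mathrm{Cat}$, the objects and arrows of $C_0$ are called objects and morphisms, and the objects and arrows of $C_1$ are called pseudo-morphisms and cells. Pseudo-functor. A pseudo-functor $F:C\to C'$ is a system $F=(F_0,F_1,\mu_F,\varepsilon_F)$ with morphisms $F_0:C_0\to C_0'$, $F_1:C_1\to C_1'$ and invertible 2-cells $\mu=\mu_F:F_1m\to m'(F_1\times_{F_0}F_1)$, $\varepsilon=\varepsilon_F:F_1e\to e'F_0$ such that - $d'F_1=F_0d$, $c'F_1=F_0c$; $d'\circ\mu=1_{F_0d\pi_2}$, $c'\circ\mu=1_{F_0c\pi_1}$; $d'\circ\varepsilon=1_{F_0}=c'\circ\varepsilon$; - $(\alpha'\circ(F_1\times F_1\times F_1))\cdot(m'\circ(1_{F_1}\times\mu))\cdot(\mu\circ(1\times m))=(m'\circ(\mu\times 1_{F_1}))\cdot(\mu\circ(m\times 1))\cdot(F_1\circ\alpha)$; - $F_1\circ\rho=(\rho'\circ F_1)\cdot(m'\langle 1_{F_1},\varepsilon\circ d\rangle)\cdot(\mu\circ\langle 1,ed\rangle)$; - $F_1\circ\lambda=(\lambda'\circ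 F_1)\cdot(m'\langle\varepsilon\circ c,1_{F_1}\rangle)\cdot(\mu\circ\langle ec,1\rangle)$. Natural transformation. For pseudo-functors $F,G:C\to C'$, a natural transformation $\theta:F\to G$ is a pair $\theta=(\theta_0,\theta_1)$ of 2-cells $\theta_0:F_0\to G_0$, $\theta_1:F_1\to G_1$ with $d'\circ\theta_1=\theta_0\circ d$, $c'\circ\theta_1=\theta_0\circ c$, $\mu_G\cdot(\theta_1\circ m)=(m'\circ(\theta_1\times_{\theta_0}\theta_1))\cdot\mu_F$ and $\varepsilon_G\cdot(\theta_1\circ e)=(e'\circ\theta_0)\cdot\varepsilon_F$. Vertical composition is componentwise. Pseudo-natural transformation. For pseudo-functors $F,G:C\to C'$, a pseudo-natural transformation $T:F\to G$ is a pair $T=(t,\tau)$ with $t:C_0\to C_1'$ a morphism and $\tau:m'\langle G_1,td\rangle\to m'\langle tc,F_1\rangle$ an invertible 2-cell such that - $d't=F_0$, $c't=G_0$; $d'\circ\tau=1_{d'F_1}$, $c'\circ\tau=1_{c'G_1}$; - $(\alpha'\langle tc\pi_1,F_1\pi_1,F_1\pi_2\rangle)\cdot(m'\langle tc\pi_1,\mu_F\rangle)\cdot(\tau\circ m)\cdot(m'\langle\mu_G^{-1},td\pi_2\rangle)=(m'\langle\tau\pi_1,F_1\pi_2\rangle)\cdot(\alpha'\langle G_1\pi_1,tc\pi_2,F_1\pi_2\rangle)\cdot(m'\langle G_1\pi_1,\tau\pi_2\rangle)\cdot(\alpha'^{-1}\langle G_1\pi_1,G_1\pi_2,td\pi_2\rangle)$;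 - $(\lambda'\circ t)\cdot(m'\langle\varepsilon_G,1_t\rangle)=(\rho'\circ t)\cdot(m'\langle 1_t,\varepsilon_F\rangle)\cdot(\tau\circ e)$. Vertical composition. For $T=(t,\tau):F\to G$ and $S=(s,\sigma):G\to H$, $S\otimes T=(m'\langle s,t\rangle,\sigma\otimes\tau):F\to H$ with $\sigma\otimes\tau=(\alpha'\langle sc,tc,F_1\rangle)\cdot(m'\langle 1_{sc},\tau\rangle)\cdot(\alpha'^{-1}\langle sc,G_1,td\rangle)\cdot(m'\langle\sigma,1_{td}\rangle)\cdot(\alpha'\langle H_1,sd,td\rangle)$. The pseudo-identity of $F$ is $id_F=(e'F_0,(\lambda'^{-1}\cdot\rho')\circ F_1):F\to F$. Pseudo-modification. Let $T=(t,\tau):F\to G$ and $T'=(t',\tau'):H\to K$ be pseudo-natural transformations and $\theta:F\to H$, $\theta':G\to K$ natural transformations. A pseudo-modification from $T$ to $T'$ with boundary $(\theta,\theta')$ is a 2-cell $\Phi:t\to t'$ of $\mathbf{C}$ with $d'\circ\Phi=\theta_0$, $c'\circ\Phi=\theta'_0$ and $\tau'\cdot(m'\langle\theta'_1,\Phi\circ d\rangle)=(m'\langle\Phi\circ c,\theta_1\rangle)\cdot\tau$. For $\Phi$ with boundary $(\theta,\theta')$ and $\Psi$ with boundary $(\theta',\theta'')$, $\Psi\otimes\Phi=m'\langle\Psi,\Phi\rangle$. For a natural transformation $\theta:F\to G$, $id_\theta=e'\circ\theta_0$, a pseudo-modification from $id_F$ to $id_G$ with boundary $(\theta,\theta)$.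 *)

(* Defs.v *)
From Stdlib Require Import ProofIrrelevance FunctionalExtensionality.

Set Implicit Arguments.
Unset Strict Implicit.
Unset Printing Implicit Defensive.

Declare Scope cell_scope.
Delimit Scope cell_scope with cell.
Open Scope cell_scope.

Record Category := mkCategory {
  obj :> Type;
  hom : obj -> obj -> Type;
  idh : forall x, hom x x;
  comp : forall x y z, hom y z -> hom x y -> hom x z;
  comp_assoc : forall x y z w (h : hom z w) (g : hom y z) (f : hom x y),
    comp h (comp g f) = comp (comp h g) f;
  comp_idl : forall x y (f : hom x y), comp (idh y) f = f;
  comp_idr : forall x y (f : hom x y), comp f (idh x) = f }.

Arguments hom {_} _ _.
Arguments idh {_} _.
Arguments comp {_ _ _ _} _ _.

(** Equality of arrows whose end points need not be convertible. *)
Inductive heq (K : Category) (x y : K) (f : hom x y) :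
    forall x' y' : K, hom x' y' -> Prop :=
  heq_refl : heq f f.

Notation "f ≈ g" := (heq f g) (at level 70, no associativity) : cell_scope.

(** Composition across an equality of the middle objects. *)
Definition vcomp (K : Category) (x y y' z : K)
    (g : hom y' z) (f : hom x y) (p : y = y') : hom x z :=
  comp g (eq_rect y (fun w => hom x w) f y' p).

Record iso (K : Category) (x y : K) := mkIso {
  fwd :> hom x y;
  inv : hom y x;
  inv_fwd : comp inv fwd = idh x;
  fwd_inv : comp fwd inv = idh y }.

Lemma heq_eq (K : Category) (x y : K) (f g : hom x y) : f ≈ g -> f = g.
Proof.
intros H.
assert (E : existT (fun a => {b : K & hom a b}) x (existT _ y f)
          = existT (fun a => {b : K & hom a b}) x (existT _ y g)).
{ destruct H; reflexivity. }
exact (inj_pairT2 _ _ _ _ _ (inj_pairT2 _ _ _ _ _ E)).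
Qed.

Lemma eq_heq (K : Category) (x y : K) (f g : hom x y) : f = g -> f ≈ g.
Proof. intros ->; constructor. Qed.

Lemma heq_sym (K : Category) (x y x' y' : K) (f : hom x y) (g : hom x' y') :
  f ≈ g -> g ≈ f.
Proof. intros []; constructor. Qed.

Lemma heq_trans (K : Category) (x y x' y' x'' y'' : K)
    (f : hom x y) (g : hom x' y') (h : hom x'' y'') :
  f ≈ g -> g ≈ h -> f ≈ h.
Proof. intros [] []; constructor. Qed.

Lemma idh_heq (K : Category) (x y : K) : x = y -> idh x ≈ idh y.
Proof. intros ->; constructor. Qed.

Lemma vcomp_refl (K : Category) (x y z : K) (g : hom y z) (f : hom x y)
    (p : y = y) : vcomp g f p = comp g f.
Proof. rewrite (proof_irrelevance _ p eq_refl); reflexivity. Qed.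

Lemma vcomp_heq (K : Category) (x y y' z a b b' c : K)
    (g : hom y' z) (f : hom x y) (p : y = y')
    (g' : hom b' c) (f' : hom a b) (p' : b = b') :
  g ≈ g' -> f ≈ f' -> vcomp g f p ≈ vcomp g' f' p'.
Proof.
intros Hg Hf; destruct Hf, Hg; apply eq_heq.
rewrite (proof_irrelevance _ p p'); reflexivity.
Qed.

Lemma vcomp_assoc (K : Category) (x y y' z z' w : K)
    (h : hom z' w) (g : hom y' z) (f : hom x y) (p : y = y') (q : z = z') :
  vcomp h (vcomp g f p) q = vcomp (vcomp h g q) f p.
Proof. destruct p, q; apply comp_assoc. Qed.

Record Functor (K L : Category) := mkFunctor {
  fobj :> K -> L;
  fmap : forall x y, hom x y -> hom (fobj x) (fobj y);
  fmap_id : forall x, fmap (idh x) = idh (fobj x);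
  fmap_comp : forall x y z (g : hom y z) (f : hom x y),
    fmap (comp g f) = comp (fmap g) (fmap f) }.

Arguments fmap {K L} F {x y} _ : rename.

Record NatTrans (K L : Category) (F G : Functor K L) := mkNatTrans {
  component :> forall x, hom (F x) (G x);
  naturality : forall x y (f : hom x y),
    comp (component y) (fmap F f) = comp (fmap G f) (component x) }.

Record TwoCategory := mkTwoCategory {
  ob :> Type;
  Hom : ob -> ob -> Category;
  one : forall X, Hom X X;
  comp1 : forall X Y Z, Hom Y Z -> Hom X Y -> Hom X Z;
  comp2 : forall X Y Z (g g' : Hom Y Z) (f f' : Hom X Y),
    hom g g' -> hom f f' -> hom (comp1 g f) (comp1 g' f');
  comp2_id : forall X Y Z (g : Hom Y Z) (f : Hom X Y),
    comp2 (idh g) (idh f) = idh (comp1 g f);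
  comp2_comp : forall X Y Z (g g' g'' : Hom Y Z) (f f' f'' : Hom X Y)
      (b' : hom g' g'') (b : hom g g') (a' : hom f' f'') (a : hom f f'),
    comp2 (comp b' b) (comp a' a) = comp (comp2 b' a') (comp2 b a);
  comp1_assoc : forall X Y Z W (h : Hom Z W) (g : Hom Y Z) (f : Hom X Y),
    comp1 (comp1 h g) f = comp1 h (comp1 g f);
  comp1_onel : forall X Y (f : Hom X Y), comp1 (one Y) f = f;
  comp1_oner : forall X Y (f : Hom X Y), comp1 f (one X) = f;
  comp2_assoc : forall X Y Z W (h h' : Hom Z W) (g g' : Hom Y Z) (f f' : Hom X Y)
      (c : hom h h') (b : hom g g') (a : hom f f'),
    comp2 (comp2 c b) a ≈ comp2 c (comp2 b a);
  comp2_onel : forall X Y (f f' : Hom X Y) (a : hom f f'),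
    comp2 (idh (one Y)) a ≈ a;
  comp2_oner : forall X Y (f f' : Hom X Y) (a : hom f f'),
    comp2 a (idh (one X)) ≈ a }.

Arguments Hom {_} _ _.
Arguments one {_ _}.
Arguments comp1 {_ _ _ _} _ _.
Arguments comp2 {_ _ _ _ _ _ _ _} _ _.

Notation "g ∘ f" := (comp1 g f) (at level 37, right associativity) : cell_scope.
Notation "b ∗ a" := (comp2 b a) (at level 38, right associativity) : cell_scope.
Notation "g ◁ a" := (comp2 (idh g) a) (at level 41, right associativity) : cell_scope.
Notation "a ▷ f" := (comp2 a (idh f)) (at level 39, left associativity) : cell_scope.

Section TwoCategoryFacts.
Variable C : TwoCategory.

Lemma comp2_heq (X Y Z : C) (g g' h h' : Hom Y Z) (f f' k k' : Hom X Y)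
    (b : hom g g') (a : hom f f') (b' : hom h h') (a' : hom k k') :
  b ≈ b' -> a ≈ a' -> b ∗ a ≈ b' ∗ a'.
Proof. intros [] []; constructor. Qed.

Lemma whisker_id (X Y Z : C) (g : Hom Y Z) (f : Hom X Y) :
  g ◁ idh f ≈ idh (g ∘ f).
Proof. apply eq_heq, comp2_id. Qed.

Lemma whisker_right (X Y Z W : C) (h : Hom Z W) (g g' : Hom Y Z) (f : Hom X Y)
    (a : hom g g') (k k' : Hom Y W) (b : hom k k') :
  h ◁ a ≈ b -> h ◁ (a ▷ f) ≈ b ▷ f.
Proof.
intros H; eapply heq_trans; [apply heq_sym, comp2_assoc|].
apply comp2_heq; [exact H|constructor].
Qed.

Lemma whisker_whisker (X Y Z W : C) (g g' : Hom Z W) (k : Hom Y Z) (h : Hom X Y)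
    (b : hom g g') : (b ▷ k) ▷ h ≈ b ▷ (k ∘ h).
Proof.
eapply heq_trans; [apply comp2_assoc|].
apply comp2_heq; [constructor|apply whisker_id].
Qed.

Lemma whisker_comp (X Y Z : C) (g : Hom Y Z) (f f' f'' : Hom X Y)
    (b : hom f' f'') (a : hom f f') :
  g ◁ comp b a = comp (g ◁ b) (g ◁ a).
Proof. rewrite <- comp2_comp, comp_idl; reflexivity. Qed.

Lemma comp_whisker (X Y Z : C) (g g' g'' : Hom Y Z) (f : Hom X Y)
    (b : hom g' g'') (a : hom g g') :
  comp b a ▷ f = comp (b ▷ f) (a ▷ f).
Proof. rewrite <- comp2_comp, comp_idl; reflexivity. Qed.

Lemma whisker_inv (X Y Z : C) (g : Hom Y Z) (f f' : Hom X Y) (a : iso f f')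
    (u : Hom X Z) : g ◁ a ≈ idh u -> g ◁ inv a ≈ idh u.
Proof.
intros H.
assert (E : comp (g ◁ inv a) (g ◁ a) = idh _)
  by (rewrite <- whisker_comp, inv_fwd; apply comp2_id).
revert H E; generalize (g ◁ inv a); generalize (g ◁ a).
intros x y H; destruct (heq_sym H); rewrite comp_idr.
intros ->; constructor.
Qed.

Lemma comp1_congr (X Y Z : C) (g : Hom Y Z) (f f' : Hom X Y) :
  f = f' -> g ∘ f = g ∘ f'.
Proof. intros ->; reflexivity. Qed.

(** [g ∘ f] rewritten below a further composition on the right. *)
Lemma comp1_reduce (X Y Y' Z W : C) (g : Hom Y Z) (f : Hom X Y)
    (g' : Hom Y' Z) (f' : Hom X Y') (h : Hom W X) :
  g ∘ f = g' ∘ f' -> g ∘ f ∘ h = g' ∘ f' ∘ h.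
Proof. intros E; rewrite <- !comp1_assoc, E; reflexivity. Qed.

Lemma comp1_reduce1 (X Y Z W : C) (g : Hom Y Z) (f : Hom X Y) (k : Hom X Z)
    (h : Hom W X) : g ∘ f = k -> g ∘ f ∘ h = k ∘ h.
Proof. intros <-; rewrite comp1_assoc; reflexivity. Qed.

End TwoCategoryFacts.

(** Strict pullbacks, universal for morphisms and for 2-cells. *)
Record Pullback (C : TwoCategory) (X Y Z : C) (f : Hom X Z) (g : Hom Y Z) :=
    mkPullback {
  pb :> C;
  p1 : Hom pb X;
  p2 : Hom pb Y;
  pb_square : f ∘ p1 = g ∘ p2;
  pair : forall (W : C) (u : Hom W X) (v : Hom W Y), f ∘ u = g ∘ v -> Hom W pb;
  p1_pair : forall (W : C) (u : Hom W X) (v : Hom W Y) (q : f ∘ u = g ∘ v),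
    p1 ∘ pair q = u;
  p2_pair : forall (W : C) (u : Hom W X) (v : Hom W Y) (q : f ∘ u = g ∘ v),
    p2 ∘ pair q = v;
  pb_ext : forall (W : C) (h k : Hom W pb),
    p1 ∘ h = p1 ∘ k -> p2 ∘ h = p2 ∘ k -> h = k;
  pair2 : forall (W : C) (u u' : Hom W X) (v v' : Hom W Y)
      (q : f ∘ u = g ∘ v) (q' : f ∘ u' = g ∘ v') (a : hom u u') (b : hom v v'),
    f ◁ a ≈ g ◁ b -> hom (pair q) (pair q');
  p1_pair2 : forall (W : C) (u u' : Hom W X) (v v' : Hom W Y)
      (q : f ∘ u = g ∘ v) (q' : f ∘ u' = g ∘ v') (a : hom u u') (b : hom v v')
      (r : f ◁ a ≈ g ◁ b), p1 ◁ pair2 q q' r ≈ a;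
  p2_pair2 : forall (W : C) (u u' : Hom W X) (v v' : Hom W Y)
      (q : f ∘ u = g ∘ v) (q' : f ∘ u' = g ∘ v') (a : hom u u') (b : hom v v')
      (r : f ◁ a ≈ g ◁ b), p2 ◁ pair2 q q' r ≈ b;
  pb_ext2 : forall (W : C) (h k : Hom W pb) (x y : hom h k),
    p1 ◁ x = p1 ◁ y -> p2 ◁ x = p2 ◁ y -> x = y }.

Arguments p1 {_ _ _ _ _ _ _}.
Arguments p2 {_ _ _ _ _ _ _}.

(** A graph [d, c : C1 -> C0] with its strings of two, three and four
    composable arrows, as iterated pullbacks: [C1 ×_C0 (C1 ×_C0 (C1 ×_C0 C1))]. *)
Record Graph (C : TwoCategory) := mkGraph {
  C0 : C;
  C1 : C;
  d : Hom C1 C0;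
  c : Hom C1 C0;
  P2 : Pullback d c;
  P3 : Pullback d (c ∘ @p1 _ _ _ _ _ _ P2);
  P4 : Pullback d (c ∘ @p1 _ _ _ _ _ _ P3) }.

Arguments d {_ _}.
Arguments c {_ _}.

Section Strings.
Context {C : TwoCategory} {G : Graph C}.

Definition pi1_2 : Hom (P2 G) (C1 G) := p1.
Definition pi2_2 : Hom (P2 G) (C1 G) := p2.
Definition pi1_3 : Hom (P3 G) (C1 G) := p1.
Definition pi2_3 : Hom (P3 G) (C1 G) := pi1_2 ∘ p2.
Definition pi3_3 : Hom (P3 G) (C1 G) := pi2_2 ∘ p2.
Definition pi1_4 : Hom (P4 G) (C1 G) := p1.
Definition pi2_4 : Hom (P4 G) (C1 G) := pi1_3 ∘ p2.
Definition pi3_4 : Hom (P4 G) (C1 G) := pi2_3 ∘ p2.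
Definition pi4_4 : Hom (P4 G) (C1 G) := pi3_3 ∘ p2.

Definition pr2 (W : C) (u v : Hom W (C1 G)) (q : d ∘ u = c ∘ v) : Hom W (P2 G) :=
  pair (P2 G) q.

Lemma pr3_proof (W : C) (u v w : Hom W (C1 G)) (q : d ∘ u = c ∘ v)
    (r : d ∘ v = c ∘ w) : d ∘ u = (c ∘ @p1 _ _ _ _ _ _ (P2 G)) ∘ pr2 r.
Proof. unfold pr2; rewrite comp1_assoc, p1_pair; exact q. Qed.

Definition pr3 (W : C) (u v w : Hom W (C1 G)) (q : d ∘ u = c ∘ v)
    (r : d ∘ v = c ∘ w) : Hom W (P3 G) :=
  pair (P3 G) (pr3_proof q r).

Lemma pr4_proof (W : C) (u v w z : Hom W (C1 G)) (q : d ∘ u = c ∘ v)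
    (r : d ∘ v = c ∘ w) (s : d ∘ w = c ∘ z) :
  d ∘ u = (c ∘ @p1 _ _ _ _ _ _ (P3 G)) ∘ pr3 r s.
Proof. unfold pr3; rewrite comp1_assoc, p1_pair; exact q. Qed.

Definition pr4 (W : C) (u v w z : Hom W (C1 G)) (q : d ∘ u = c ∘ v)
    (r : d ∘ v = c ∘ w) (s : d ∘ w = c ∘ z) : Hom W (P4 G) :=
  pair (P4 G) (pr4_proof q r s).

Definition pc2 (W : C) (u u' v v' : Hom W (C1 G))
    (q : d ∘ u = c ∘ v) (q' : d ∘ u' = c ∘ v') (a : hom u u') (b : hom v v')
    (r : d ◁ a ≈ c ◁ b) : hom (pr2 q) (pr2 q') :=
  pair2 (P2 G) q q' r.

Lemma pi1_2_pr2 (W : C) (u v : Hom W (C1 G)) (q : d ∘ u = c ∘ v) :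
  pi1_2 ∘ pr2 q = u.
Proof. apply p1_pair. Qed.
Lemma pi2_2_pr2 (W : C) (u v : Hom W (C1 G)) (q : d ∘ u = c ∘ v) :
  pi2_2 ∘ pr2 q = v.
Proof. apply p2_pair. Qed.
Lemma pi1_3_pr3 (W : C) (u v w : Hom W (C1 G)) (q : d ∘ u = c ∘ v)
    (r : d ∘ v = c ∘ w) : pi1_3 ∘ pr3 q r = u.
Proof. apply p1_pair. Qed.
Lemma pi2_3_pr3 (W : C) (u v w : Hom W (C1 G)) (q : d ∘ u = c ∘ v)
    (r : d ∘ v = c ∘ w) : pi2_3 ∘ pr3 q r = v.
Proof. unfold pi2_3, pr3; rewrite comp1_assoc, p2_pair; apply p1_pair. Qed.
Lemma pi3_3_pr3 (W : C) (u v w : Hom W (C1 G)) (q : d ∘ u = c ∘ v)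
    (r : d ∘ v = c ∘ w) : pi3_3 ∘ pr3 q r = w.
Proof. unfold pi3_3, pr3; rewrite comp1_assoc, p2_pair; apply p2_pair. Qed.

Lemma d_pi1_2 : d ∘ pi1_2 = c ∘ pi2_2.
Proof. apply pb_square. Qed.
Lemma d_pi1_3 : d ∘ pi1_3 = c ∘ pi2_3.
Proof. unfold pi1_3, pi2_3; rewrite pb_square; apply comp1_assoc. Qed.
Lemma d_pi2_3 : d ∘ pi2_3 = c ∘ pi3_3.
Proof. unfold pi2_3, pi3_3; apply comp1_reduce, d_pi1_2. Qed.
Lemma d_pi1_4 : d ∘ pi1_4 = c ∘ pi2_4.
Proof. unfold pi1_4, pi2_4; rewrite pb_square; apply comp1_assoc. Qed.
Lemma d_pi2_4 : d ∘ pi2_4 = c ∘ pi3_4.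
Proof. unfold pi2_4, pi3_4; apply comp1_reduce, d_pi1_3. Qed.
Lemma d_pi3_4 : d ∘ pi3_4 = c ∘ pi4_4.
Proof. unfold pi3_4, pi4_4; apply comp1_reduce, d_pi2_3. Qed.

Lemma P2_ext (W : C) (h k : Hom W (P2 G)) :
  pi1_2 ∘ h = pi1_2 ∘ k -> pi2_2 ∘ h = pi2_2 ∘ k -> h = k.
Proof. apply pb_ext. Qed.

Lemma P3_ext (W : C) (h k : Hom W (P3 G)) :
  pi1_3 ∘ h = pi1_3 ∘ k -> pi2_3 ∘ h = pi2_3 ∘ k -> pi3_3 ∘ h = pi3_3 ∘ k -> h = k.
Proof.
unfold pi1_3, pi2_3, pi3_3; rewrite !comp1_assoc; intros H1 H2 H3.
apply pb_ext; [|apply P2_ext]; assumption.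
Qed.

Lemma pc2_heq (W : C) (u u' v v' x x' y y' : Hom W (C1 G)) q q' t t'
    (a : hom u u') (b : hom v v') (r : d ◁ a ≈ c ◁ b)
    (a' : hom x x') (b' : hom y y') (s : d ◁ a' ≈ c ◁ b') :
  a ≈ a' -> b ≈ b' -> pc2 q q' r ≈ pc2 t t' s.
Proof.
intros Ha Hb; destruct Ha, Hb.
rewrite (proof_irrelevance _ q t), (proof_irrelevance _ q' t'),
  (proof_irrelevance _ r s).
constructor.
Qed.

Lemma pc2_comp (W : C) (u u' u'' v v' v'' : Hom W (C1 G)) q q' q''
    (a' : hom u' u'') (a : hom u u') (b' : hom v' v'') (b : hom v v')
    (r : d ◁ a ≈ c ◁ b) (r' : d ◁ a' ≈ c ◁ b')
    (s : d ◁ comp a' a ≈ c ◁ comp b' b) :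
  pc2 q q'' s = comp (pc2 q' q'' r') (pc2 q q' r).
Proof.
apply pb_ext2; rewrite whisker_comp; apply heq_eq.
- eapply heq_trans; [apply p1_pair2|].
  rewrite <- (vcomp_refl a' a eq_refl), <- (vcomp_refl _ _ eq_refl).
  apply vcomp_heq; apply heq_sym, p1_pair2.
- eapply heq_trans; [apply p2_pair2|].
  rewrite <- (vcomp_refl b' b eq_refl), <- (vcomp_refl _ _ eq_refl).
  apply vcomp_heq; apply heq_sym, p2_pair2.
Qed.

Lemma pc2_id (W : C) (u v : Hom W (C1 G)) (q : d ∘ u = c ∘ v)
    (r : d ◁ idh u ≈ c ◁ idh v) : pc2 q q r = idh (pr2 q).
Proof.
apply pb_ext2; apply heq_eq.
- eapply heq_trans; [apply p1_pair2|].
  eapply heq_trans; [|apply heq_sym, whisker_id].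
  apply idh_heq; symmetry; apply pi1_2_pr2.
- eapply heq_trans; [apply p2_pair2|].
  eapply heq_trans; [|apply heq_sym, whisker_id].
  apply idh_heq; symmetry; apply pi2_2_pr2.
Qed.

End Strings.

(** In these notations, the proofs that a pairing is well formed, and that two
    2-cells are composable, are left to [Program]. *)
Notation "⟨ f , g ⟩" := (pr2 (u := f) (v := g) _)
  (at level 0, f at level 60, g at level 60) : cell_scope.
Notation "⟨ f , g , h ⟩" := (pr3 (u := f) (v := g) (w := h) _ _)
  (at level 0, f at level 60, g at level 60, h at level 60) : cell_scope.
Notation "⟨ f , g , h , k ⟩" := (pr4 (u := f) (v := g) (w := h) (z := k) _ _ _)
  (at level 0, f at level 60, g at level 60, h at level 60, k at level 60)
  : cell_scope.
Notation "⟪ a , b ⟫" := (pc2 (a := a) (b := b) _ _ _)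
  (at level 0, a at level 60, b at level 60) : cell_scope.
Notation "b ⋅ a" := (vcomp b a _) (at level 50, left associativity) : cell_scope.

(** [mor] proves equations between morphisms, by reducing both sides with
    [mor_rule]; [bd] proves [d ◁ a ≈ c ◁ b], by computing both sides with
    [bd_rule]. *)
#[local] Opaque pi1_2 pi2_2 pi1_3 pi2_3 pi3_3 pi1_4 pi2_4 pi3_4 pi4_4 pr2 pr3 pr4.

Ltac head_rule_with tac :=
  first [ tac
        | eapply comp1_reduce; tac
        | eapply comp1_reduce1; tac ].
Ltac mor_rule0 :=
  first [ eassumption
        | apply comp1_onel | apply comp1_oner
        | apply pi1_2_pr2 | apply pi2_2_pr2
        | apply pi1_3_pr3 | apply pi2_3_pr3 | apply pi3_3_pr3
        | apply d_pi1_2 | apply d_pi1_3 | apply d_pi2_3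
        | apply d_pi1_4 | apply d_pi2_4 | apply d_pi3_4 ].
Ltac mor_rule := mor_rule0.

Ltac mor_unfold := idtac.
Ltac nf :=
  lazymatch goal with
  | |- (_ ∘ _) ∘ _ = _ => eapply eq_trans; [apply comp1_assoc | nf]
  | |- one ∘ _ = _ => eapply eq_trans; [apply comp1_onel | nf]
  | |- _ ∘ _ = _ =>
      eapply eq_trans; [apply comp1_congr; nf | nf_head]
  | |- _ => reflexivity
  end
with nf_head :=
  first [ eapply eq_trans; [head_rule_with mor_rule | nf] | reflexivity ].

Ltac mor :=
  intros; mor_unfold;
  first
  [ reflexivity
  | assumption
  | eapply eq_trans; [nf | eapply eq_trans; [| symmetry; nf]]; mor_close ]
with mor_close :=
  first
  [ reflexivity
  | lazymatch goal with
    | |- pr2 _ = _ => apply P2_ext; mor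
    | |- _ = pr2 _ => apply P2_ext; mor
    | |- pr2 _ ∘ _ = _ => apply P2_ext; mor
    | |- _ = pr2 _ ∘ _ => apply P2_ext; mor
    | |- pr3 _ _ = _ => apply P3_ext; mor
    | |- _ = pr3 _ _ => apply P3_ext; mor
    | |- pr3 _ _ ∘ _ = _ => apply P3_ext; mor
    | |- _ = pr3 _ _ ∘ _ => apply P3_ext; mor
    | |- _ ∘ _ = _ ∘ _ => apply comp1_congr; mor_close
    end ].

Ltac bd_rule := eassumption.
Ltac bd_side :=
  lazymatch goal with
  | |- _ ◁ idh _ ≈ _ => apply whisker_id
  | |- _ ◁ (_ ▷ _) ≈ _ =>
      eapply heq_trans; [apply whisker_right; bd_side|];
      first [apply whisker_id | apply whisker_whisker | apply heq_refl]
  | |- _ => first [bd_rule | apply whisker_inv; bd_rule]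
  end.
Ltac bd_close :=
  first [ apply heq_refl
        | apply idh_heq; mor
        | apply comp2_heq; [apply heq_refl | apply idh_heq; mor] ].
Ltac bd :=
  eapply heq_trans; [bd_side |];
  apply heq_sym; eapply heq_trans; [bd_side |]; bd_close.

#[local] Obligation Tactic :=
  intros; lazymatch goal with |- heq _ _ => bd | |- _ => mor end.

Record Mult (C : TwoCategory) (G : Graph C) := mkMult {
  e0 : Hom (C0 G) (C1 G);
  m0 : Hom (P2 G) (C1 G);
  d_e0 : d ∘ e0 = one;
  c_e0 : c ∘ e0 = one;
  d_m0 : d ∘ m0 = d ∘ pi2_2;
  c_m0 : c ∘ m0 = c ∘ pi1_2 }.

Record Base (C : TwoCategory) := mkBase {
  graph :> Graph C;
  mult : Mult graph }.

Section BaseFacts.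
Context {C : TwoCategory} {M : Base C}.
Definition e : Hom (C0 M) (C1 M) := e0 (mult M).
Definition m : Hom (P2 M) (C1 M) := m0 (mult M).
Lemma d_e : d ∘ e = one. Proof. apply d_e0. Qed.
Lemma c_e : c ∘ e = one. Proof. apply c_e0. Qed.
Lemma d_m : d ∘ m = d ∘ pi2_2. Proof. apply d_m0. Qed.
Lemma c_m : c ∘ m = c ∘ pi1_2. Proof. apply c_m0. Qed.
End BaseFacts.

#[local] Opaque e m.

Ltac mor_rule1 :=
  first [ mor_rule0 | apply d_e | apply c_e | apply d_m | apply c_m ].
Ltac mor_rule ::= mor_rule1.

Program Definition assoc_dom (C : TwoCategory) (M : Base C) : Hom (P3 M) (C1 M) :=
  m ∘ ⟨ pi1_3, m ∘ ⟨ pi2_3, pi3_3 ⟩ ⟩.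
Program Definition assoc_cod (C : TwoCategory) (M : Base C) : Hom (P3 M) (C1 M) :=
  m ∘ ⟨ m ∘ ⟨ pi1_3, pi2_3 ⟩, pi3_3 ⟩.
Program Definition lunit_dom (C : TwoCategory) (M : Base C) : Hom (C1 M) (C1 M) :=
  m ∘ ⟨ e ∘ c, one ⟩.
Program Definition runit_dom (C : TwoCategory) (M : Base C) : Hom (C1 M) (C1 M) :=
  m ∘ ⟨ one, e ∘ d ⟩.

Ltac mor_unfold ::= unfold assoc_dom, assoc_cod, lunit_dom, runit_dom.

Program Definition pentagon_law (C : TwoCategory) (M : Base C)
    (alpha : iso (assoc_dom M) (assoc_cod M))
    (d_alpha : d ◁ alpha ≈ idh (d ∘ pi3_3))
    (c_alpha : c ◁ alpha ≈ idh (c ∘ pi1_3)) : Prop :=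
  (alpha ▷ ⟨ m ∘ ⟨ pi1_4, pi2_4 ⟩, pi3_4, pi4_4 ⟩)
    ⋅ (alpha ▷ ⟨ pi1_4, pi2_4, m ∘ ⟨ pi3_4, pi4_4 ⟩ ⟩)
  ≈ (m ◁ ⟪ alpha ▷ ⟨ pi1_4, pi2_4, pi3_4 ⟩, idh pi4_4 ⟫)
    ⋅ (alpha ▷ ⟨ pi1_4, m ∘ ⟨ pi2_4, pi3_4 ⟩, pi4_4 ⟩)
    ⋅ (m ◁ ⟪ idh pi1_4, alpha ▷ ⟨ pi2_4, pi3_4, pi4_4 ⟩ ⟫).

Program Definition triangle_law (C : TwoCategory) (M : Base C)
    (alpha : iso (assoc_dom M) (assoc_cod M)) (lam : iso (lunit_dom M) one)
    (rho : iso (runit_dom M) one)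
    (c_lam : c ◁ lam ≈ idh c) (d_rho : d ◁ rho ≈ idh d) : Prop :=
  (m ◁ ⟪ rho ▷ pi1_2, idh pi2_2 ⟫) ⋅ (alpha ▷ ⟨ pi1_2, e ∘ c ∘ pi2_2, pi2_2 ⟩)
  ≈ m ◁ ⟪ idh pi1_2, lam ▷ pi2_2 ⟫.

Record Coherence (C : TwoCategory) (M : Base C) := mkCoherence {
  alpha : iso (assoc_dom M) (assoc_cod M);
  lam : iso (lunit_dom M) one;
  rho : iso (runit_dom M) one;
  d_lam : d ◁ lam ≈ idh d;
  c_lam : c ◁ lam ≈ idh c;
  d_rho : d ◁ rho ≈ idh d;
  c_rho : c ◁ rho ≈ idh c;
  d_alpha : d ◁ alpha ≈ idh (d ∘ pi3_3);
  c_alpha : c ◁ alpha ≈ idh (c ∘ pi1_3);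
  lam_e : lam ▷ e ≈ rho ▷ e;
  pentagon : pentagon_law d_alpha c_alpha;
  triangle : triangle_law alpha c_lam d_rho }.

Record PseudoCategory (C : TwoCategory) := mkPseudoCategory {
  base :> Base C;
  coherence :> Coherence base }.

Section PseudoFunctor.
Context {C : TwoCategory} {A B : PseudoCategory C}.

Section Laws.
Variables (F0 : Hom (C0 A) (C0 B)) (F1 : Hom (C1 A) (C1 B)).
Hypotheses (d_F1 : d ∘ F1 = F0 ∘ d) (c_F1 : c ∘ F1 = F0 ∘ c).

Program Definition mu_cod : Hom (P2 A) (C1 B) :=
  m ∘ ⟨ F1 ∘ pi1_2, F1 ∘ pi2_2 ⟩.

Variables (mu : iso (F1 ∘ m) mu_cod) (eps : iso (F1 ∘ e) (e ∘ F0)).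
Hypotheses (d_mu : d ◁ mu ≈ idh (F0 ∘ d ∘ pi2_2))
  (c_mu : c ◁ mu ≈ idh (F0 ∘ c ∘ pi1_2))
  (d_eps : d ◁ eps ≈ idh F0) (c_eps : c ◁ eps ≈ idh F0).

Ltac mor_unfold ::=
  unfold mu_cod, assoc_dom, assoc_cod, lunit_dom, runit_dom in *.

Program Definition pf_assoc_law : Prop :=
  (alpha B ▷ ⟨ F1 ∘ pi1_3, F1 ∘ pi2_3, F1 ∘ pi3_3 ⟩)
    ⋅ (m ◁ ⟪ idh (F1 ∘ pi1_3), mu ▷ ⟨ pi2_3, pi3_3 ⟩ ⟫)
    ⋅ (mu ▷ ⟨ pi1_3, m ∘ ⟨ pi2_3, pi3_3 ⟩ ⟩)
  ≈ (m ◁ ⟪ mu ▷ ⟨ pi1_3, pi2_3 ⟩, idh (F1 ∘ pi3_3) ⟫)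
    ⋅ (mu ▷ ⟨ m ∘ ⟨ pi1_3, pi2_3 ⟩, pi3_3 ⟩)
    ⋅ (F1 ◁ alpha A).

Program Definition pf_runit_law : Prop :=
  F1 ◁ rho A
  ≈ (rho B ▷ F1) ⋅ (m ◁ ⟪ idh F1, eps ▷ d ⟫) ⋅ (mu ▷ ⟨ one, e ∘ d ⟩).

Program Definition pf_lunit_law : Prop :=
  F1 ◁ lam A
  ≈ (lam B ▷ F1) ⋅ (m ◁ ⟪ eps ▷ c, idh F1 ⟫) ⋅ (mu ▷ ⟨ e ∘ c, one ⟩).

End Laws.
End PseudoFunctor.

Record PseudoFunctor (C : TwoCategory) (A B : PseudoCategory C) := mkPseudoFunctor {
  F0 : Hom (C0 A) (C0 B);
  F1 : Hom (C1 A) (C1 B);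
  d_F1 : d ∘ F1 = F0 ∘ d;
  c_F1 : c ∘ F1 = F0 ∘ c;
  mu : iso (F1 ∘ m) (mu_cod d_F1 c_F1);
  eps : iso (F1 ∘ e) (e ∘ F0);
  d_mu : d ◁ mu ≈ idh (F0 ∘ d ∘ pi2_2);
  c_mu : c ◁ mu ≈ idh (F0 ∘ c ∘ pi1_2);
  d_eps : d ◁ eps ≈ idh F0;
  c_eps : c ◁ eps ≈ idh F0;
  pf_assoc : pf_assoc_law d_mu c_mu;
  pf_runit : pf_runit_law mu c_eps;
  pf_lunit : pf_lunit_law mu d_eps }.

Section Transformations.
Context {C : TwoCategory} {A B : PseudoCategory C}.
Implicit Types F G H K : PseudoFunctor A B.

Ltac mor_rule ::=
  first [ mor_rule1 | apply d_F1 | apply c_F1 ].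
Ltac bd_rule ::=
  first [ eassumption | apply d_mu | apply c_mu | apply d_eps | apply c_eps ].
Ltac mor_unfold ::=
  unfold mu_cod, assoc_dom, assoc_cod, lunit_dom, runit_dom in *.

Program Definition nt_mu_law F G (t0 : hom (F0 F) (F0 G)) (t1 : hom (F1 F) (F1 G))
    (d_t1 : d ◁ t1 ≈ t0 ▷ d) (c_t1 : c ◁ t1 ≈ t0 ▷ c) : Prop :=
  mu G ⋅ (t1 ▷ m) ≈ (m ◁ ⟪ t1 ▷ pi1_2, t1 ▷ pi2_2 ⟫) ⋅ mu F.

Program Definition nt_eps_law F G (t0 : hom (F0 F) (F0 G)) (t1 : hom (F1 F) (F1 G)) :
    Prop :=
  eps G ⋅ (t1 ▷ e) ≈ (e ◁ t0) ⋅ eps F.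

Record NT F G := mkNT {
  th0 : hom (F0 F) (F0 G);
  th1 : hom (F1 F) (F1 G);
  d_th1 : d ◁ th1 ≈ th0 ▷ d;
  c_th1 : c ◁ th1 ≈ th0 ▷ c;
  nt_mu : nt_mu_law d_th1 c_th1;
  nt_eps : nt_eps_law th0 th1 }.

Section PNLaws.
Variables (F G : PseudoFunctor A B) (t : Hom (C0 A) (C1 B)).
Hypotheses (d_t : d ∘ t = F0 F) (c_t : c ∘ t = F0 G).

Program Definition tau_dom : Hom (C1 A) (C1 B) := m ∘ ⟨ F1 G, t ∘ d ⟩.
Program Definition tau_cod : Hom (C1 A) (C1 B) := m ∘ ⟨ t ∘ c, F1 F ⟩.

Ltac mor_unfold ::=
  unfold tau_dom, tau_cod, mu_cod, assoc_dom, assoc_cod, lunit_dom, runit_dom in *.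

Variable tau : iso tau_dom tau_cod.
Hypotheses (d_tau : d ◁ tau ≈ idh (d ∘ F1 F)) (c_tau : c ◁ tau ≈ idh (c ∘ F1 G)).

Program Definition pn_mu_law : Prop :=
  (alpha B ▷ ⟨ t ∘ c ∘ pi1_2, F1 F ∘ pi1_2, F1 F ∘ pi2_2 ⟩)
    ⋅ (m ◁ ⟪ idh (t ∘ c ∘ pi1_2), mu F ⟫)
    ⋅ (tau ▷ m)
    ⋅ (m ◁ ⟪ inv (mu G), idh (t ∘ d ∘ pi2_2) ⟫)
  ≈ (m ◁ ⟪ tau ▷ pi1_2, idh (F1 F ∘ pi2_2) ⟫)
    ⋅ (alpha B ▷ ⟨ F1 G ∘ pi1_2, t ∘ c ∘ pi2_2, F1 F ∘ pi2_2 ⟩)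
    ⋅ (m ◁ ⟪ idh (F1 G ∘ pi1_2), tau ▷ pi2_2 ⟫)
    ⋅ (inv (alpha B) ▷ ⟨ F1 G ∘ pi1_2, F1 G ∘ pi2_2, t ∘ d ∘ pi2_2 ⟩).

Program Definition pn_eps_law : Prop :=
  (lam B ▷ t) ⋅ (m ◁ ⟪ eps G, idh t ⟫)
  ≈ (rho B ▷ t) ⋅ (m ◁ ⟪ idh t, eps F ⟫) ⋅ (tau ▷ e).

End PNLaws.

Record PN F G := mkPN {
  t_ : Hom (C0 A) (C1 B);
  d_t : d ∘ t_ = F0 F;
  c_t : c ∘ t_ = F0 G;
  tau : iso (tau_dom c_t) (tau_cod d_t);
  d_tau : d ◁ tau ≈ idh (d ∘ F1 F);
  c_tau : c ◁ tau ≈ idh (c ∘ F1 G);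
  pn_mu : pn_mu_law d_tau c_tau;
  pn_eps : pn_eps_law tau }.

Ltac mor_rule ::=
  first [ mor_rule1 | apply d_F1 | apply c_F1 | apply d_t | apply c_t ].
Ltac bd_rule ::=
  first [ eassumption | apply d_mu | apply c_mu | apply d_eps | apply c_eps
        | apply d_th1 | apply c_th1 | apply d_tau | apply c_tau ].
Ltac mor_unfold ::=
  unfold tau_dom, tau_cod, mu_cod, assoc_dom, assoc_cod, lunit_dom, runit_dom in *.

Program Definition vert_t F G H (S : PN G H) (T : PN F G) : Hom (C0 A) (C1 B) :=
  m ∘ ⟨ t_ S, t_ T ⟩.

Program Definition vert_tau F G H (S : PN G H) (T : PN F G) : hom _ _ :=
  (alpha B ▷ ⟨ t_ S ∘ c, t_ T ∘ c, F1 F ⟩)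
    ⋅ (m ◁ ⟪ idh (t_ S ∘ c), tau T ⟫)
    ⋅ (inv (alpha B) ▷ ⟨ t_ S ∘ c, F1 G, t_ T ∘ d ⟩)
    ⋅ (m ◁ ⟪ tau S, idh (t_ T ∘ d) ⟫)
    ⋅ (alpha B ▷ ⟨ F1 H, t_ S ∘ d, t_ T ∘ d ⟩).

Program Definition id_tau F : hom _ _ := (inv (lam B) ⋅ rho B) ▷ F1 F.

Program Definition pm_law F G H K (T : PN F G) (T' : PN H K) (th : NT F H)
    (th' : NT G K) (Phi : hom (t_ T) (t_ T'))
    (d_Phi : d ◁ Phi ≈ th0 th) (c_Phi : c ◁ Phi ≈ th0 th') : Prop :=
  tau T' ⋅ (m ◁ ⟪ th1 th', Phi ▷ d ⟫) ≈ (m ◁ ⟪ Phi ▷ c, th1 th ⟫) ⋅ tau T.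

Record PM F G H K (T : PN F G) (T' : PN H K) (th : NT F H) (th' : NT G K) := mkPM {
  Phi : hom (t_ T) (t_ T');
  d_Phi : d ◁ Phi ≈ th0 th;
  c_Phi : c ◁ Phi ≈ th0 th';
  pm_tau : pm_law d_Phi c_Phi }.

Ltac bd_rule ::=
  first [ apply d_Phi | apply c_Phi ].

Program Definition vert_Phi F G H F' G' H' (S : PN G H) (T : PN F G)
    (S' : PN G' H') (T' : PN F' G') (th : NT F F') (th' : NT G G') (th'' : NT H H')
    (Q : PM S S' th' th'') (P : PM T T' th th') : hom (vert_t S T) (vert_t S' T') :=
  m ◁ ⟪ Phi Q, Phi P ⟫.

Program Definition assoc_Phi F G H K (U : PN H K) (T : PN G H) (S : PN F G) :
    hom _ _ :=
  alpha B ▷ ⟨ t_ U, t_ T, t_ S ⟩.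
End Transformations.

Section Paste.
Variable K : Category.

Lemma vcomp_paste (a a' b b' x x' v v' v'' w w' w'' : K)
    (s : hom a b) (s' : hom b b') (r' : hom x v') (r'' : hom x' v'')
    (r : hom a' v) (t : hom w w') (t' : hom w' w'')
    (o : a = a') (p : b = x) (p' : b' = x') (q : v = w) (q' : v' = w') (q'' : v'' = w'') :
  vcomp r' s p ≈ vcomp t r q -> vcomp r'' s' p' ≈ vcomp t' r' q' ->
  vcomp r'' (comp s' s) p' ≈ vcomp (comp t' t) r q.
Proof.
destruct o, p, p', q, q', q''; intros H1%heq_eq H2%heq_eq; apply eq_heq.
unfold vcomp in *; cbn in *.
rewrite comp_assoc, H2, <- !comp_assoc, H1; reflexivity.
Qed.

Lemma vcomp_id_id (a v w : K) (r : hom a v) (p : a = a) (q : v = w) :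
  vcomp r (idh a) p ≈ vcomp (idh w) r q.
Proof.
destruct q; rewrite !vcomp_refl, comp_idl, comp_idr; constructor.
Qed.
End Paste.

Section Compositions.
Context {C : TwoCategory} {A B : PseudoCategory C}.
Implicit Types F G H K : PseudoFunctor A B.

Lemma nt_muP F G (t0 : hom (F0 F) (F0 G)) (t1 : hom (F1 F) (F1 G)) d1 c1 :
  nt_mu_law (t0 := t0) (t1 := t1) d1 c1 <->
  forall q q' r p p',
  vcomp (mu G) (t1 ▷ m) p
  ≈ vcomp (m ◁ pc2 (a := t1 ▷ pi1_2) (b := t1 ▷ pi2_2) q q' r) (mu F) p'.
Proof.
unfold nt_mu_law; split; [intros E q q' r p p'|intros E; apply E].
eapply heq_trans; [|eapply heq_trans; [apply E|]];
  apply vcomp_heq; try apply heq_refl.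
apply comp2_heq; [constructor|apply pc2_heq; constructor].
Qed.

Ltac mor_rule ::=
  first [ mor_rule1 | apply d_F1 | apply c_F1 | apply d_t | apply c_t ].
Ltac bd_rule ::=
  first [ eassumption | apply d_mu | apply c_mu | apply d_eps | apply c_eps
        | apply d_th1 | apply c_th1 | apply d_tau | apply c_tau
        | apply d_Phi | apply c_Phi ].
Ltac mor_unfold ::=
  unfold tau_dom, tau_cod, mu_cod, assoc_dom, assoc_cod, lunit_dom, runit_dom in *.

Lemma boundary_comp (X Y Z Z' : C) (f f' f'' : Hom X Y) (g : Hom Y Z)
    (h : Hom X Z') (b : hom f' f'') (a : hom f f')
    (u v w : Hom Z' Z) (b' : hom v w) (a' : hom u v) :
  g ◁ b ≈ b' ▷ h -> g ◁ a ≈ a' ▷ h -> g ◁ comp b a ≈ comp b' a' ▷ h.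
Proof.
intros Hb Ha; rewrite whisker_comp, comp_whisker.
rewrite <- (vcomp_refl (g ◁ b) _ eq_refl), <- (vcomp_refl (b' ▷ h) _ eq_refl).
apply vcomp_heq; assumption.
Qed.

Lemma boundary_id (X Y Z Z' : C) (f : Hom X Y) (g : Hom Y Z) (h : Hom X Z')
    (u : Hom Z' Z) : g ∘ f = u ∘ h -> g ◁ idh f ≈ idh u ▷ h.
Proof. intros E; rewrite !comp2_id; apply idh_heq, E. Qed.

Lemma nt_id_mu F (d1 : d ◁ idh (F1 F) ≈ idh (F0 F) ▷ d)
    (c1 : c ◁ idh (F1 F) ≈ idh (F0 F) ▷ c) : nt_mu_law d1 c1.
Proof.
apply nt_muP; intros.
assert (E : forall u v, pc2 (a := idh (F1 F) ▷ pi1_2) (b := idh (F1 F) ▷ pi2_2) q q' r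
   ≈ pc2 (a := idh (F1 F ∘ pi1_2)) (b := idh (F1 F ∘ pi2_2)) u u v).
{ intros; apply pc2_heq; apply whisker_id. }
assert (v : d ◁ idh (F1 F ∘ pi1_2) ≈ c ◁ idh (F1 F ∘ pi2_2)) by bd.
specialize (E q v); rewrite pc2_id in E.
eapply heq_trans.
{ eapply vcomp_heq with (p' := eq_refl); [apply heq_refl|apply whisker_id]. }
eapply heq_trans; [apply vcomp_id_id with (q := p')|].
apply vcomp_heq; [|apply heq_refl].
apply heq_sym; eapply heq_trans.
{ apply comp2_heq; [apply heq_refl|exact E]. }
rewrite comp2_id; constructor.
Qed.

Lemma nt_id_eps F : nt_eps_law (idh (F0 F)) (idh (F1 F)).
Proof.
unfold nt_eps_law.
eapply heq_trans.
{ eapply vcomp_heq with (p' := eq_refl); [apply heq_refl|apply whisker_id]. }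
eapply heq_trans; [apply vcomp_id_id with (q := eq_refl)|].
apply vcomp_heq; [|apply heq_refl].
apply heq_sym, whisker_id.
Qed.

Definition nt_id F : NT F F :=
  mkNT (nt_id_mu (boundary_id (d_F1 F)) (boundary_id (c_F1 F))) (nt_id_eps F).

Lemma pc2_whisker_comp (W W' : C) (u u' u'' : Hom W' (C1 B)) (v v' v'' : Hom W' (C1 B))
    (b : hom u' u'') (a : hom u u') (b' : hom v' v'') (a' : hom v v')
    (h k : Hom W W') q q'' r (q' : d ∘ u' ∘ h = c ∘ v' ∘ k)
    (rb : d ◁ (b ▷ h) ≈ c ◁ (b' ▷ k)) (ra : d ◁ (a ▷ h) ≈ c ◁ (a' ▷ k)) :
  m ◁ pc2 (a := comp b a ▷ h) (b := comp b' a' ▷ k) q q'' r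
  = comp (m ◁ pc2 q' q'' rb) (m ◁ pc2 q q' ra).
Proof.
revert r; rewrite !comp_whisker; intros r.
rewrite <- whisker_comp, <- pc2_comp with (s := r); reflexivity.
Qed.

Lemma nt_comp_mu F G H (b : NT G H) (a : NT F G)
    (d1 : d ◁ comp (th1 b) (th1 a) ≈ comp (th0 b) (th0 a) ▷ d)
    (c1 : c ◁ comp (th1 b) (th1 a) ≈ comp (th0 b) (th0 a) ▷ c) : nt_mu_law d1 c1.
Proof.
apply nt_muP; intros.
assert (q0 : d ∘ F1 G ∘ pi1_2 = c ∘ F1 G ∘ pi2_2) by mor.
assert (ra : d ◁ (th1 a ▷ pi1_2) ≈ c ◁ (th1 a ▷ pi2_2)) by bd.
assert (rb : d ◁ (th1 b ▷ pi1_2) ≈ c ◁ (th1 b ▷ pi2_2)) by bd.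
rewrite (pc2_whisker_comp _ _ _ q0 rb ra), comp_whisker.
assert (E : mu_cod (d_F1 G) (c_F1 G) = m ∘ pr2 q0) by mor.
assert (E' : mu_cod (d_F1 H) (c_F1 H) = m ∘ pr2 q') by mor.
apply vcomp_paste with (r' := fwd (mu G)) (p := eq_refl) (q' := E); [exact eq_refl|exact E'|..].
- apply (proj1 (nt_muP _ _) (nt_mu a)).
- apply (proj1 (nt_muP _ _) (nt_mu b)).
Qed.

Lemma nt_comp_eps F G H (b : NT G H) (a : NT F G) :
  nt_eps_law (comp (th0 b) (th0 a)) (comp (th1 b) (th1 a)).
Proof.
unfold nt_eps_law; rewrite whisker_comp, comp_whisker.
apply vcomp_paste with (r' := fwd (eps G)) (p := eq_refl) (q' := eq_refl); [exact eq_refl|exact eq_refl|..].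
- eapply heq_trans; [|eapply heq_trans; [apply (nt_eps a)|]];
    apply vcomp_heq; apply heq_refl.
- eapply heq_trans; [|eapply heq_trans; [apply (nt_eps b)|]];
    apply vcomp_heq; apply heq_refl.
Qed.

Definition nt_comp F G H (b : NT G H) (a : NT F G) : NT F H :=
  mkNT (nt_comp_mu (boundary_comp (d_th1 b) (d_th1 a))
                   (boundary_comp (c_th1 b) (c_th1 a)))
       (nt_comp_eps b a).

Lemma nt_ext F G (a b : NT F G) : th0 a = th0 b -> th1 a = th1 b -> a = b.
Proof.
destruct a as [a0 a1 da ca ma ea], b as [b0 b1 db cb mb eb]; cbn; intros <- <-.
destruct (proof_irrelevance _ da db), (proof_irrelevance _ ca cb),
  (proof_irrelevance _ ma mb), (proof_irrelevance _ ea eb); reflexivity.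
Qed.

Definition PsFunctors : Category.
Proof.
refine (@mkCategory (PseudoFunctor A B) NT nt_id nt_comp _ _ _).
- abstract (intros; apply nt_ext; apply comp_assoc).
- abstract (intros; apply nt_ext; apply comp_idl).
- abstract (intros; apply nt_ext; apply comp_idr).
Defined.

Lemma pm_lawP F G H K (T : PN F G) (T' : PN H K) (th : NT F H) (th' : NT G K)
    (P : hom (t_ T) (t_ T')) (d1 : d ◁ P ≈ th0 th) (c1 : c ◁ P ≈ th0 th') :
  pm_law d1 c1 <->
  forall q q' r s s' r' p p',
  vcomp (tau T') (m ◁ pc2 (a := th1 th') (b := P ▷ d) q q' r) p
  ≈ vcomp (m ◁ pc2 (a := P ▷ c) (b := th1 th) s s' r') (tau T) p'.
Proof.
unfold pm_law; split; [intros E q q' r s s' r' p p'|intros E; apply E].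
eapply heq_trans; [|eapply heq_trans; [apply E|]];
  apply vcomp_heq; try apply heq_refl;
  (apply comp2_heq; [constructor|apply pc2_heq; constructor]).
Qed.

Lemma pm_id_tau F G (T : PN F G) (d1 : d ◁ idh (t_ T) ≈ idh (F0 F))
    (c1 : c ◁ idh (t_ T) ≈ idh (F0 G)) :
  pm_law (th := nt_id F) (th' := nt_id G) d1 c1.
Proof.
apply pm_lawP; cbn; intros.
assert (rd : d ◁ idh (F1 G) ≈ c ◁ idh (t_ T ∘ d)) by bd.
assert (rc : d ◁ idh (t_ T ∘ c) ≈ c ◁ idh (F1 F)) by bd.
assert (E : m ◁ pc2 (a := idh (F1 G)) (b := idh (t_ T) ▷ d) q q' r
            ≈ idh (m ∘ pr2 q)).
{ eapply heq_trans; [apply comp2_heq; [apply heq_refl|]|].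
  - apply pc2_heq with (t := q) (t' := q) (s := rd);
      [apply heq_refl|apply whisker_id].
  - rewrite pc2_id; apply whisker_id. }
assert (E' : m ◁ pc2 (a := idh (t_ T) ▷ c) (b := idh (F1 F)) s s' r'
            ≈ idh (m ∘ pr2 s)).
{ eapply heq_trans; [apply comp2_heq; [apply heq_refl|]|].
  - apply pc2_heq with (t := s) (t' := s) (s := rc);
      [apply whisker_id|apply heq_refl].
  - rewrite pc2_id; apply whisker_id. }
assert (e1 : tau_dom (c_t T) = m ∘ pr2 q) by mor.
assert (e2 : tau_cod (d_t T) = m ∘ pr2 s) by mor.
eapply heq_trans; [|eapply heq_trans; [apply vcomp_id_id with (q := e2)
                                         (r := fwd (tau T)) (p := eq_refl)|]].
- apply vcomp_heq; [apply heq_refl|eapply heq_trans; [exact E|]].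
  apply idh_heq, eq_sym, e1.
- apply vcomp_heq; [apply heq_sym, E'|apply heq_refl].
Qed.

Lemma pm_comp_tau F F' F'' G G' G'' (T : PN F G) (T' : PN F' G') (T'' : PN F'' G'')
    (th2 : NT F' F'') (th2' : NT G' G'') (th : NT F F') (th' : NT G G')
    (P2 : PM T' T'' th2 th2') (P : PM T T' th th')
    (d1 : d ◁ comp (Phi P2) (Phi P) ≈ th0 (nt_comp th2 th))
    (c1 : c ◁ comp (Phi P2) (Phi P) ≈ th0 (nt_comp th2' th')) :
  pm_law d1 c1.
Proof.
apply pm_lawP; cbn; intros.
assert (qd : d ∘ F1 G' = c ∘ t_ T' ∘ d) by mor.
assert (qc : d ∘ t_ T' ∘ c = c ∘ F1 F') by mor.
assert (ra : d ◁ th1 th' ≈ c ◁ (Phi P ▷ d)) by bd.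
assert (rb : d ◁ th1 th2' ≈ c ◁ (Phi P2 ▷ d)) by bd.
assert (ra' : d ◁ (Phi P ▷ c) ≈ c ◁ th1 th) by bd.
assert (rb' : d ◁ (Phi P2 ▷ c) ≈ c ◁ th1 th2) by bd.
revert r r'; rewrite !comp_whisker; intros r r'.
rewrite pc2_comp with (q' := qd) (r := ra) (r' := rb),
  pc2_comp with (q' := qc) (r := ra') (r' := rb'), !whisker_comp.
assert (e1 : m ∘ pr2 qd = tau_dom (c_t T')) by mor.
assert (e2 : tau_cod (d_t T') = m ∘ pr2 qc) by mor.
assert (e3 : tau_cod (d_t T'') = m ∘ pr2 s') by mor.
assert (e4 : m ∘ pr2 q = tau_dom (c_t T)) by mor.
apply vcomp_paste with (r' := fwd (tau T')) (p := e1) (q' := e2);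
  [exact e4|exact e3|..].
- apply (proj1 (pm_lawP _ _) (pm_tau P)).
- apply (proj1 (pm_lawP _ _) (pm_tau P2)).
Qed.

Lemma pm_ext F F' G G' (T : PN F G) (T' : PN F' G') th th' (P Q : PM T T' th th') :
  Phi P = Phi Q -> P = Q.
Proof.
destruct P as [P d1 c1 l1], Q as [Q d2 c2 l2]; cbn; intros <-.
destruct (proof_irrelevance _ d1 d2), (proof_irrelevance _ c1 c2),
  (proof_irrelevance _ l1 l2); reflexivity.
Qed.

Record PNObj := mkPNObj {
  src : PseudoFunctor A B;
  tgt : PseudoFunctor A B;
  pn :> PN src tgt }.

(** The boundary is part of a pseudo-modification: [th1] is not determined by the
    underlying 2-cell. *)
Record PNHom (T T' : PNObj) := mkPNHom {
  dom_ : NT (src T) (src T');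
  cod_ : NT (tgt T) (tgt T');
  pm :> PM T T' dom_ cod_ }.

Lemma pnhom_ext (T T' : PNObj) (P Q : PNHom T T') :
  dom_ P = dom_ Q -> cod_ P = cod_ Q -> Phi P = Phi Q -> P = Q.
Proof.
destruct P as [x y P], Q as [x' y' Q]; cbn; intros <- <- E.
f_equal; apply pm_ext, E.
Qed.

Lemma whisker_id_eq (X Y Z : C) (g : Hom Y Z) (f : Hom X Y) (k : Hom X Z) :
  g ∘ f = k -> g ◁ idh f ≈ idh k.
Proof. intros <-; apply whisker_id. Qed.

Lemma whisker_comp_heq (X Y Z : C) (g : Hom Y Z) (f f' f'' : Hom X Y)
    (u v w : Hom X Z) (b : hom f' f'') (a : hom f f') (b' : hom v w) (a' : hom u v) :
  g ◁ b ≈ b' -> g ◁ a ≈ a' -> g ◁ comp b a ≈ comp b' a'.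
Proof.
intros Hb Ha; rewrite whisker_comp.
rewrite <- (vcomp_refl (g ◁ b) _ eq_refl), <- (vcomp_refl b' _ eq_refl).
apply vcomp_heq; assumption.
Qed.

Definition pm_id (T : PNObj) : PNHom T T :=
  mkPNHom (mkPM (pm_id_tau (whisker_id_eq (d_t T)) (whisker_id_eq (c_t T)))).

Definition pm_comp (T T' T'' : PNObj) (Q : PNHom T' T'') (P : PNHom T T') :
    PNHom T T'' :=
  mkPNHom (mkPM (pm_comp_tau (P2 := Q) (P := P)
    (whisker_comp_heq (d_Phi Q) (d_Phi P)) (whisker_comp_heq (c_Phi Q) (c_Phi P)))).

Definition PsTransformations : Category.
Proof.
refine (@mkCategory PNObj PNHom pm_id pm_comp _ _ _).
- abstract (intros; apply pnhom_ext; [apply nt_ext..|]; apply comp_assoc).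
- abstract (intros; apply pnhom_ext; [apply nt_ext..|]; apply comp_idl).
- abstract (intros; apply pnhom_ext; [apply nt_ext..|]; apply comp_idr).
Defined.

Definition ps_d : Functor PsTransformations PsFunctors :=
  @mkFunctor PsTransformations PsFunctors src dom_
    (fun _ => eq_refl) (fun _ _ _ _ _ => eq_refl).

Definition ps_c : Functor PsTransformations PsFunctors :=
  @mkFunctor PsTransformations PsFunctors tgt cod_
    (fun _ => eq_refl) (fun _ _ _ _ _ => eq_refl).

End Compositions.

Definition functor_id (K : Category) : Functor K K :=
  @mkFunctor K K (fun x => x) (fun _ _ f => f)
    (fun _ => eq_refl) (fun _ _ _ _ _ => eq_refl).

Definition functor_comp (K L M : Category) (G : Functor L M) (F : Functor K L) :
  Functor K M.
Proof.
refine (@mkFunctor K M (fun x => G (F x)) (fun _ _ f => fmap G (fmap F f)) _ _).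
- abstract (intros; rewrite !fmap_id; reflexivity).
- abstract (intros; rewrite !fmap_comp; reflexivity).
Defined.

Lemma functor_ext (K L : Category) (F G : Functor K L) :
  (forall x, F x = G x) -> (forall x y (f : hom x y), fmap F f ≈ fmap G f) -> F = G.
Proof.
destruct F as [F0 F1 i1 j1], G as [G0 G1 i2 j2]; cbn; intros E0.
apply functional_extensionality in E0; destruct E0; intros E1.
assert (E : F1 = G1)
  by (do 3 (apply functional_extensionality_dep; intro); apply heq_eq, E1).
destruct E, (proof_irrelevance _ i1 i2), (proof_irrelevance _ j1 j2); reflexivity.
Qed.

Lemma nattrans_ext (K L : Category) (F G : Functor K L) (a b : NatTrans F G) :
  (forall x, a x = b x) -> a = b.
Proof.
destruct a as [a i], b as [b j]; cbn; intros E.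
apply functional_extensionality_dep in E; destruct E, (proof_irrelevance _ i j).
reflexivity.
Qed.

Definition nattrans_id (K L : Category) (F : Functor K L) : NatTrans F F.
Proof.
refine (@mkNatTrans K L F F (fun x => idh (F x)) _).
abstract (intros; rewrite comp_idl, comp_idr; reflexivity).
Defined.

Definition nattrans_comp (K L : Category) (F G H : Functor K L)
  (b : NatTrans G H) (a : NatTrans F G) : NatTrans F H.
Proof.
refine (@mkNatTrans K L F H (fun x => comp (b x) (a x)) _).
abstract (intros;
  rewrite <- comp_assoc, naturality, !comp_assoc, naturality; reflexivity).
Defined.

Definition FunctorCategory (K L : Category) : Category.
Proof.
refine (@mkCategory (Functor K L) (@NatTrans K L) (@nattrans_id K L)
  (@nattrans_comp K L) _ _ _).
- abstract (intros; apply nattrans_ext; intros; apply comp_assoc).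
- abstract (intros; apply nattrans_ext; intros; apply comp_idl).
- abstract (intros; apply nattrans_ext; intros; apply comp_idr).
Defined.

Lemma nattrans_heq (K L : Category) (F F' G G' : FunctorCategory K L)
    (a : hom F F') (b : hom G G') :
  F = G -> F' = G' ->
  (forall x, component a x ≈ component b x) -> a ≈ b.
Proof.
intros <- <- E; apply eq_heq, nattrans_ext; intros x; apply heq_eq, E.
Qed.

Lemma heq_component (K L : Category) (F F' G G' : FunctorCategory K L)
    (a : hom F F') (b : hom G G') :
  a ≈ b -> forall x, component a x ≈ component b x.
Proof. intros [] x; constructor. Qed.

Definition hcomp (K L M : Category) (G G' : Functor L M) (F F' : Functor K L)
  (b : NatTrans G G') (a : NatTrans F F') :
  NatTrans (functor_comp G F) (functor_comp G' F').
Proof.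
refine (@mkNatTrans K M (functor_comp G F) (functor_comp G' F')
  (fun x => comp (b (F' x)) (fmap G (a x))) _).
abstract (intros; cbn;
  rewrite <- comp_assoc, <- fmap_comp, (naturality a), fmap_comp, !comp_assoc,
    (naturality b); reflexivity).
Defined.

Definition Cat : TwoCategory.
Proof.
refine (@mkTwoCategory Category FunctorCategory functor_id functor_comp hcomp
  _ _ _ _ _ _ _ _).
- abstract (intros; apply nattrans_ext; intros; cbn;
    rewrite fmap_id; apply comp_idl).
- abstract (intros; apply nattrans_ext; intros; cbn;
    rewrite fmap_comp, !comp_assoc; f_equal;
    rewrite <- !comp_assoc; f_equal; apply naturality).
- abstract (intros; apply functor_ext; intros; constructor).
- abstract (intros; apply functor_ext; intros; constructor).
- abstract (intros; apply functor_ext; intros; constructor).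
- abstract (intros; apply nattrans_heq;
    [apply functor_ext; intros; constructor..|];
    intros; cbn; rewrite fmap_comp, comp_assoc; constructor).
- abstract (intros; apply nattrans_heq;
    [apply functor_ext; intros; constructor..|];
    intros; cbn; rewrite comp_idl; constructor).
- abstract (intros; apply nattrans_heq;
    [apply functor_ext; intros; constructor..|];
    intros; cbn; rewrite fmap_id, comp_idr; constructor).
Defined.

Section CatPullback.
Variables (K L Z : Category) (F : Functor K Z) (G : Functor L Z).

Record PbObj := mkPbObj {
  pb_fst : K;
  pb_snd : L;
  pb_eq : F pb_fst = G pb_snd }.

Record PbHom (x y : PbObj) := mkPbHom {
  pbh_fst : hom (pb_fst x) (pb_fst y);
  pbh_snd : hom (pb_snd x) (pb_snd y);
  pbh_eq : fmap F pbh_fst ≈ fmap G pbh_snd }.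

Lemma pbobj_ext (x y : PbObj) : pb_fst x = pb_fst y -> pb_snd x = pb_snd y -> x = y.
Proof.
destruct x as [x x' p], y as [y y' q]; cbn; intros <- <-.
destruct (proof_irrelevance _ p q); reflexivity.
Qed.

Lemma pbhom_ext (x y : PbObj) (f g : PbHom x y) :
  pbh_fst f = pbh_fst g -> pbh_snd f = pbh_snd g -> f = g.
Proof.
destruct f as [f f' p], g as [g g' q]; cbn; intros <- <-.
destruct (proof_irrelevance _ p q); reflexivity.
Qed.

Lemma pbh_id_eq (x : PbObj) : fmap F (idh (pb_fst x)) ≈ fmap G (idh (pb_snd x)).
Proof. rewrite !fmap_id; apply idh_heq, pb_eq. Qed.

Lemma pbh_comp_eq (x y z : PbObj) (g : PbHom y z) (f : PbHom x y) :
  fmap F (comp (pbh_fst g) (pbh_fst f)) ≈ fmap G (comp (pbh_snd g) (pbh_snd f)).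
Proof.
rewrite !fmap_comp, <- (vcomp_refl (fmap F _) _ eq_refl),
  <- (vcomp_refl (fmap G _) _ eq_refl).
apply vcomp_heq; apply pbh_eq.
Qed.

Definition PbCategory : Category.
Proof.
refine (@mkCategory PbObj PbHom
  (fun x => mkPbHom (pbh_id_eq x)) (fun _ _ _ g f => mkPbHom (pbh_comp_eq g f)) _ _ _).
- abstract (intros; apply pbhom_ext; apply comp_assoc).
- abstract (intros; apply pbhom_ext; apply comp_idl).
- abstract (intros; apply pbhom_ext; apply comp_idr).
Defined.

Definition pb_p1 : Functor PbCategory K :=
  @mkFunctor PbCategory K pb_fst pbh_fst (fun _ => eq_refl) (fun _ _ _ _ _ => eq_refl).
Definition pb_p2 : Functor PbCategory L :=
  @mkFunctor PbCategory L pb_snd pbh_snd (fun _ => eq_refl) (fun _ _ _ _ _ => eq_refl).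

Lemma pbhom_heq (x y x' y' : PbObj) (f : PbHom x y) (f' : PbHom x' y') :
  pbh_fst f ≈ pbh_fst f' -> pbh_snd f ≈ pbh_snd f' ->
  @heq PbCategory x y f x' y' f'.
Proof.
destruct x as [x1 x2 px], y as [y1 y2 py], x' as [x1' x2' px'], y' as [y1' y2' py'],
  f as [f1 f2 pf], f' as [f1' f2' pf']; cbn in *.
intros H1 H2; destruct H1, H2.
destruct (proof_irrelevance _ px px'), (proof_irrelevance _ py py'),
  (proof_irrelevance _ pf pf'); constructor.
Qed.

Lemma functor_eq_obj (W V : Category) (u v : Functor W V) : u = v -> forall x, u x = v x.
Proof. intros <- x; reflexivity. Qed.

Lemma functor_eq_hom (W V : Category) (u v : Functor W V) :
  u = v -> forall x y (f : hom x y), fmap u f ≈ fmap v f.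
Proof. intros <- x y f; constructor. Qed.

Section Pair.
Variables (W : Category) (u : Functor W K) (v : Functor W L).
Hypothesis q : functor_comp F u = functor_comp G v.

Definition cat_pair : Functor W PbCategory.
Proof.
refine (@mkFunctor W PbCategory (fun x => mkPbObj (functor_eq_obj q x))
  (fun x y f => @mkPbHom (mkPbObj (functor_eq_obj q x)) (mkPbObj (functor_eq_obj q y))
     (fmap u f) (fmap v f) (functor_eq_hom q f)) _ _).
- abstract (intros; apply pbhom_ext; apply fmap_id).
- abstract (intros; apply pbhom_ext; apply fmap_comp).
Defined.
End Pair.

Definition cat_pair2 (W : Category) (u u' : Functor W K) (v v' : Functor W L)
    (q : functor_comp F u = functor_comp G v)
    (q' : functor_comp F u' = functor_comp G v')
    (a : NatTrans u u') (b : NatTrans v v')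
    (r : @heq (FunctorCategory W Z) _ _ (hcomp (nattrans_id F) a)
           _ _ (hcomp (nattrans_id G) b)) :
  NatTrans (cat_pair q) (cat_pair q').
Proof.
unshelve refine (@mkNatTrans W PbCategory (cat_pair q) (cat_pair q')
  (fun x => @mkPbHom (cat_pair q x) (cat_pair q' x) (a x) (b x) _) _).
- abstract (pose proof (heq_component r x) as E; cbn in E;
    rewrite !comp_idl in E; exact E).
- abstract (intros; apply pbhom_ext; apply naturality).
Defined.

Definition CatPullback : @Pullback Cat K L Z F G.
Proof.
refine (@mkPullback Cat K L Z F G PbCategory pb_p1 pb_p2 _ cat_pair _ _ _ cat_pair2 _ _ _).
- abstract (apply functor_ext; cbn; [apply pb_eq|intros; apply pbh_eq]).
- abstract (intros; apply functor_ext; intros; constructor).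
- abstract (intros; apply functor_ext; intros; constructor).
- abstract (intros W h k E1 E2; apply functor_ext; intros;
    [ apply pbobj_ext; [apply (functor_eq_obj E1)|apply (functor_eq_obj E2)]
    | apply pbhom_heq; [apply (functor_eq_hom E1)|apply (functor_eq_hom E2)] ]).
- abstract (intros; apply nattrans_heq;
    [apply functor_ext; intros; constructor..|];
    intros; cbn; rewrite comp_idl; constructor).
- abstract (intros; apply nattrans_heq;
    [apply functor_ext; intros; constructor..|];
    intros; cbn; rewrite comp_idl; constructor).
- abstract (intros W h k x y E1 E2; apply nattrans_ext; intros w;
    apply pbhom_ext;
    [ pose proof (heq_component (eq_heq E1) w) as E
    | pose proof (heq_component (eq_heq E2) w) as E ];
    apply heq_eq in E; cbn in E; rewrite !comp_idl in E; exact E).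
Defined.
End CatPullback.

Section PsData.
Context {C : TwoCategory} (A B : PseudoCategory C).
Implicit Types F G H K : PseudoFunctor A B.

Notation X0 := (PsFunctors (A := A) (B := B)).
Notation X1 := (PsTransformations (A := A) (B := B)).

Definition PsStrings2 : Category := PbCategory (K := X1) (L := X1) (Z := X0) ps_d ps_c.
Definition PsStrings3 : Category :=
  PbCategory (K := X1) (L := PsStrings2) (Z := X0) ps_d (functor_comp ps_c (pb_p1 _ _)).

Definition PsGraph : Graph Cat :=
  let Q2 := @CatPullback X1 X1 X0 ps_d ps_c in
  let Q3 := @CatPullback X1 PsStrings2 X0 ps_d (functor_comp ps_c (pb_p1 _ _)) in
  let Q4 := @CatPullback X1 PsStrings3 X0 ps_d (functor_comp ps_c (pb_p1 _ _)) in
  @mkGraph Cat X0 X1 ps_d ps_c Q2 Q3 Q4.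

(** Up to the proofs they contain, all objects and arrows of the pullback
    categories have the following form. *)
Definition string2 F G H (S : PN G H) (T : PN F G) : PsStrings2 :=
  @mkPbObj X1 X1 X0 ps_d ps_c (mkPNObj S) (mkPNObj T) eq_refl.

Definition string2_hom F G H F' G' H' (S : PN G H) (T : PN F G)
    (S' : PN G' H') (T' : PN F' G') (th : NT F F') (th' : NT G G') (th'' : NT H H')
    (Q : PM S S' th' th'') (P : PM T T' th th') :
    hom (string2 S T) (string2 S' T') :=
  @mkPbHom X1 X1 X0 ps_d ps_c (string2 S T) (string2 S' T')
    (mkPNHom (T := mkPNObj S) (T' := mkPNObj S') Q)
    (mkPNHom (T := mkPNObj T) (T' := mkPNObj T') P) (@heq_refl X0 G G' th').

Definition string3 F G H K (U : PN H K) (T : PN G H) (S : PN F G) : PsStrings3 :=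
  @mkPbObj X1 PsStrings2 X0 ps_d (functor_comp ps_c (pb_p1 _ _))
    (mkPNObj U) (string2 T S) eq_refl.

(** [T] is the pseudo-natural transformation [(t, tau) : F -> G]. *)
Definition is_pn (T : X1) F G (t : Hom (C0 A) (C1 B)) (x y : Hom (C1 A) (C1 B))
    (ta : hom x y) : Prop :=
  src T = F /\ tgt T = G /\ t_ T = t /\ tau T ≈ ta.

(** [P] is the 2-cell [Ph], with boundary [(th, th')]. *)
Definition is_pm (T T' : X1) (P : hom T T') F F' (th : NT F F') G G' (th' : NT G G')
    (t t' : Hom (C0 A) (C1 B)) (Ph : hom t t') : Prop :=
  @heq X0 _ _ (dom_ P) F F' th /\ @heq X0 _ _ (cod_ P) G G' th' /\ Phi P ≈ Ph.

End PsData.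

(* Main.v *)
From Stdlib Require Import ProofIrrelevance Setoid.
Require Import Defs.

(** The proof looks at [A] and [B] through their generalised elements.  Fix an
    object [W] of [C].  The morphisms [W -> C1 B], with their domain and codomain
    in [Hom W (C0 B)], and the 2-cells between them whose boundary is an identity
    form an ordinary bicategory ([el_bicat]).  A pseudo-functor [F] sends elements
    of [A] to elements of [B], preserving composites and units up to [mu] and
    [eps]; a pseudo-natural transformation gives an arrow [t ∘ x] for every
    [x : W -> C0 A] and a cell at every element of [C1 A].  Whiskering turns an
    axiom into equations in all the bicategories of elements ([pn_mu_law_at],
    [pn_eps_law_at], [pm_law_at]), and conversely the axiom is the equation at
    the universal element, given by the projections from [P2 A] or by an identity
    morphism ([pn_mu_law_universal], [pn_eps_law_universal], [pm_law_intro]).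
    So what concerns 2-cells with identity boundary has only to be proved in an
    arbitrary bicategory.

    There the associators are removed as follows.  A cell
    [k : p ⊠ q -> r ⊠ t] is determined by its whiskerings [k ▹ w], since
    tensoring with a unit is isomorphic to the identity, and [k ▹ w] is conjugate
    to a cell [slide k w : p ⊠ (q ⊠ w) -> r ⊠ (t ⊠ w)], natural in [w].  In terms
    of slides the axioms of pseudo-natural transformations contain no associator
    ([mu_law_slide], [eps_law_slide], [mod_law_slide]), and the slide of a
    vertical composite is, up to associators at its two ends, the composite of
    the slides ([slide_vert]).  The axioms for composites and identities, and
    those saying that the associativity and unit constraints are
    pseudo-modifications, then follow from the naturality of slides.

    Cells with a nontrivial boundary are needed for the composites of
    pseudo-modifications, for the identity of a natural transformation, and for
    the naturality of the constraints.  There one pastes commutative squares in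
    the category [Hom W (C1 B)], with the naturality of [alpha], [lam] and [rho]
    for arbitrary 2-cells ([vert_square], [el_asc_nat], [el_lun_nat],
    [el_run_nat]).

    Finally, two pseudo-modifications are equal when their boundaries and their
    underlying 2-cells are.  All constraints have identity boundaries, so the
    axioms of the pseudo-category of pseudo-functors reduce to equations between
    2-cells, which are those of the bicategory of elements of [B] at [C0 A]. *)

Set Implicit Arguments.
Unset Strict Implicit.
Unset Printing Implicit Defensive.

(** * Bicategories *)

Record Bicategory := mkBicategory {
  pt :> Type;
  arr : pt -> pt -> Category;
  unit1 : forall x, arr x x;
  tens : forall x y z, arr x y -> arr y z -> arr x z;
  tens2 : forall x y z (u u' : arr x y) (v v' : arr y z),
    hom u u' -> hom v v' -> hom (tens u v) (tens u' v');
  tens2_id : forall x y z (u : arr x y) (v : arr y z),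
    tens2 (idh u) (idh v) = idh (tens u v);
  tens2_comp : forall x y z (u u' u'' : arr x y) (v v' v'' : arr y z)
      (a' : hom u' u'') (a : hom u u') (b' : hom v' v'') (b : hom v v'),
    tens2 (comp a' a) (comp b' b) = comp (tens2 a' b') (tens2 a b);
  asc : forall x y z w (u : arr x y) (v : arr y z) (r : arr z w),
    iso (tens u (tens v r)) (tens (tens u v) r);
  lun : forall x y (u : arr x y), iso (tens (unit1 x) u) u;
  run : forall x y (u : arr x y), iso (tens u (unit1 y)) u;
  asc_nat : forall x y z w (u u' : arr x y) (v v' : arr y z) (r r' : arr z w)
      (a : hom u u') (b : hom v v') (c : hom r r'),
    comp (asc u' v' r') (tens2 a (tens2 b c)) = comp (tens2 (tens2 a b) c) (asc u v r);
  lun_nat : forall x y (u u' : arr x y) (a : hom u u'),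
    comp (lun u') (tens2 (idh _) a) = comp a (lun u);
  run_nat : forall x y (u u' : arr x y) (a : hom u u'),
    comp (run u') (tens2 a (idh _)) = comp a (run u);
  asc_pentagon : forall x y z w s (u : arr x y) (v : arr y z) (r : arr z w) (q : arr w s),
    comp (asc (tens u v) r q) (asc u v (tens r q))
    = comp (tens2 (asc u v r) (idh q))
        (comp (asc u (tens v r) q) (tens2 (idh u) (asc v r q)));
  asc_triangle : forall x y z (u : arr x y) (v : arr y z),
    comp (tens2 (run u) (idh v)) (asc u (unit1 y) v) = tens2 (idh u) (lun v) }.

Arguments tens {_ _ _ _} _ _.
Arguments tens2 {_ _ _ _ _ _ _ _} _ _.
Arguments unit1 {_} _.
Arguments asc {_ _ _ _ _} _ _ _.
Arguments lun {_ _ _} _.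
Arguments run {_ _ _} _.

Notation "u ⊠ v" := (tens u v) (at level 40, left associativity) : cell_scope.
Notation "u ◃ b" := (tens2 (idh u) b) (at level 42, right associativity) : cell_scope.
Notation "a ▹ w" := (tens2 a (idh w)) (at level 43, left associativity) : cell_scope.
Notation "b • a" := (comp b a) (at level 45, right associativity) : cell_scope.

Section CategoryFacts.
Variable K : Category.

(** For rewriting inside a composite that is associated to the right. *)
Lemma comp_cut {x y z w : K} {b : hom y z} {a : hom x y} {c : hom x z}
    (E : b • a = c) (r : hom w x) : b • a • r = c • r.
Proof. rewrite comp_assoc, E; reflexivity. Qed.

Lemma iso_cancel_l {x y z : K} (i : iso y z) (a b : hom x y) : i • a = i • b -> a = b.
Proof.
intros E; rewrite <- (comp_idl a), <- (comp_idl b), <- (inv_fwd i), <- !comp_assoc, E.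
reflexivity.
Qed.

Lemma iso_cancel_r {x y z : K} (i : iso x y) (a b : hom y z) : a • i = b • i -> a = b.
Proof.
intros E; rewrite <- (comp_idr a), <- (comp_idr b), <- (fwd_inv i), !comp_assoc, E.
reflexivity.
Qed.

Lemma iso_flip {x y z w : K} (i : iso x y) (j : iso z w) (a : hom y w) (b : hom x z) :
  a • i = j • b -> inv j • a = b • inv i.
Proof.
intros E; apply (iso_cancel_r (i := i)); rewrite <- !comp_assoc, E, inv_fwd, comp_idr,
  comp_assoc, inv_fwd, comp_idl; reflexivity.
Qed.

Definition inverse {x y : K} (i : iso x y) : iso y x := mkIso (fwd_inv i) (inv_fwd i).

Definition iso_comp {x y z : K} (j : iso y z) (i : iso x y) : iso x z.
Proof.
refine (mkIso (fwd := j • i) (inv := inv i • inv j) _ _).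
- abstract (rewrite <- comp_assoc, (comp_cut (inv_fwd j)), comp_idl; apply inv_fwd).
- abstract (rewrite <- comp_assoc, (comp_cut (fwd_inv i)), comp_idl; apply fwd_inv).
Defined.
End CategoryFacts.

Ltac cat_nf := rewrite <- ?comp_assoc, ?comp_idl, ?comp_idr.
Tactic Notation "rw" uconstr(E) := (first [rewrite E | rewrite (comp_cut E)]); cat_nf.
Tactic Notation "rwb" uconstr(E) :=
  (first [rewrite <- E | rewrite (comp_cut (eq_sym E))]); cat_nf.

Section BicategoryFacts.
Context {K : Bicategory}.

Lemma whl_comp {x y z : K} {u : arr x y} {v v' v'' : arr y z}
  {b : hom v' v''} {a : hom v v'} : u ◃ (b • a) = (u ◃ b) • (u ◃ a).
Proof. rewrite <- tens2_comp, comp_idl; reflexivity. Qed.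

Lemma whr_comp {x y z : K} {u u' u'' : arr x y} {v : arr y z}
  {b : hom u' u''} {a : hom u u'} : (b • a) ▹ v = (b ▹ v) • (a ▹ v).
Proof. rewrite <- tens2_comp, comp_idl; reflexivity. Qed.

Lemma interchange {x y z : K} {u u' : arr x y} {v v' : arr y z}
  {a : hom u u'} {b : hom v v'} : (a ▹ v') • (u ◃ b) = (u' ◃ b) • (a ▹ v).
Proof. rewrite <- !tens2_comp, !comp_idl, !comp_idr; reflexivity. Qed.

Lemma asc_whl {x y z w : K} {u : arr x y} {v : arr y z} {r r' : arr z w} {c : hom r r'} :
  asc u v r' • (u ◃ (v ◃ c)) = (u ⊠ v ◃ c) • asc u v r.
Proof. rewrite asc_nat, tens2_id; reflexivity. Qed.

Lemma asc_whm {x y z w : K} {u : arr x y} {v v' : arr y z} {r : arr z w} {b : hom v v'} :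
  asc u v' r • (u ◃ (b ▹ r)) = ((u ◃ b) ▹ r) • asc u v r.
Proof. apply asc_nat. Qed.

Lemma asc_whr {x y z w : K} {u u' : arr x y} {v : arr y z} {r : arr z w} {a : hom u u'} :
  asc u' v r • (a ▹ (v ⊠ r)) = ((a ▹ v) ▹ r) • asc u v r.
Proof. rewrite <- tens2_id; apply asc_nat. Qed.

Definition iso_tens {x y z : K} {u u' : arr x y} {v v' : arr y z}
  (i : iso u u') (j : iso v v') : iso (u ⊠ v) (u' ⊠ v').
Proof.
refine (mkIso (fwd := tens2 i j) (inv := tens2 (inv i) (inv j)) _ _).
- abstract (rewrite <- tens2_comp, !inv_fwd; apply tens2_id).
- abstract (rewrite <- tens2_comp, !fwd_inv; apply tens2_id).
Defined.

Definition iso_id {L : Category} (x : L) : iso x x :=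
  mkIso (comp_idl (idh x)) (comp_idl (idh x)).

(** By [run], tensoring with [unit1] on the right is isomorphic to the identity. *)
Lemma whr_faithful {x y : K} {u u' : arr x y} (a b : hom u u') :
  (forall z (w : arr y z), a ▹ w = b ▹ w) -> a = b.
Proof.
intros E; apply (iso_cancel_r (i := run u)); rewrite <- !run_nat, E; reflexivity.
Qed.

Lemma whl_faithful {x y : K} {u u' : arr x y} (a b : hom u u') :
  unit1 x ◃ a = unit1 x ◃ b -> a = b.
Proof.
intros E; apply (iso_cancel_r (i := lun u)); rewrite <- !lun_nat, E; reflexivity.
Qed.

Lemma run_whr {x y z : K} {u : arr x y} {w : arr y z} :
  run u ▹ w = (u ◃ lun w) • inv (asc u (unit1 y) w).
Proof. rewrite <- asc_triangle; cat_nf; rewrite fwd_inv, comp_idr; reflexivity. Qed.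

(** Kelly: the left unit law for a composite follows from the pentagon and the
    triangle, after composing with [unit1] on the left. *)
Lemma lun_whr {x y z : K} {u : arr x y} {w : arr y z} :
  lun u ▹ w = lun (u ⊠ w) • inv (asc (unit1 x) u w).
Proof.
apply (iso_cancel_r (i := asc (unit1 x) u w)); cat_nf; rewrite inv_fwd, comp_idr.
apply whl_faithful; rewrite whl_comp.
apply (iso_cancel_l (i := asc (unit1 x) u w)).
rw (asc_whm (u := unit1 x)); rewrite <- (asc_triangle (unit1 x) u), whr_comp; cat_nf.
rewrite <- asc_pentagon, <- asc_triangle.
rw (asc_whr (a := run (unit1 x)) (v := u)); reflexivity.
Qed.

(** The pentagon, solved for the whiskered associator: this is the rule that
    eliminates the associators of an equation once it has been whiskered. *)
Lemma asc_whr_pentagon {x y z w s : K} {u : arr x y} {v : arr y z} {r : arr z w}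
    {q : arr w s} :
  asc u v r ▹ q
  = asc (u ⊠ v) r q • asc u v (r ⊠ q) • (u ◃ inv (asc v r q)) • inv (asc u (v ⊠ r) q).
Proof.
apply (iso_cancel_r (i := iso_comp (asc u (v ⊠ r) q) (iso_tens (iso_id u) (asc v r q)))).
cbn; cat_nf.
rw (inv_fwd (asc u (v ⊠ r) q)); rewrite <- whl_comp, inv_fwd, tens2_id; cat_nf.
symmetry; apply asc_pentagon.
Qed.

Lemma inv_asc_whr_pentagon {x y z w s : K} {u : arr x y} {v : arr y z} {r : arr z w}
    {q : arr w s} :
  inv (asc u v r) ▹ q
  = asc u (v ⊠ r) q • (u ◃ asc v r q) • inv (asc u v (r ⊠ q)) • inv (asc (u ⊠ v) r q).
Proof.
apply (iso_cancel_l (i := iso_tens (asc u v r) (iso_id q))); cbn.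
rewrite <- whr_comp, fwd_inv, tens2_id, asc_whr_pentagon; cat_nf.
rw (inv_fwd (asc u (v ⊠ r) q)); rw (eq_sym (whl_comp (u := u)(b := inv (asc v r q)))).
rewrite inv_fwd, tens2_id; cat_nf.
rw (fwd_inv (asc u v (r ⊠ q))); symmetry; apply fwd_inv.
Qed.

Lemma whl_whr {x y z w : K} {u : arr x y} {v v' : arr y z} {r : arr z w} {b : hom v v'} :
  (u ◃ b) ▹ r = asc u v' r • (u ◃ (b ▹ r)) • inv (asc u v r).
Proof. rw (asc_whm (u := u)); rewrite fwd_inv, comp_idr; reflexivity. Qed.

Lemma whr_whr {x y z w : K} {u u' : arr x y} {v : arr y z} {r : arr z w} {a : hom u u'} :
  (a ▹ v) ▹ r = asc u' v r • (a ▹ (v ⊠ r)) • inv (asc u v r).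
Proof. rw (asc_whr (a := a)); rewrite fwd_inv, comp_idr; reflexivity. Qed.

End BicategoryFacts.

(** * Cells without associators *)

Lemma iso_fwd_inv_cut {K : Category} {x y z : K} (i : iso x y) (r : hom z y) :
  i • inv i • r = r.
Proof. rewrite comp_assoc, fwd_inv; apply comp_idl. Qed.
Lemma iso_inv_fwd_cut {K : Category} {x y z : K} (i : iso x y) (r : hom z x) :
  inv i • i • r = r.
Proof. rewrite comp_assoc, inv_fwd; apply comp_idl. Qed.

Lemma whl_fwd_inv {K : Bicategory} {x y z : K} {u : arr x y} {v v' : arr y z} (i : iso v v') :
  (u ◃ i) • (u ◃ inv i) = idh _.
Proof. rewrite <- whl_comp, fwd_inv; apply tens2_id. Qed.
Lemma whl_inv_fwd {K : Bicategory} {x y z : K} {u : arr x y} {v v' : arr y z} (i : iso v v') :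
  (u ◃ inv i) • (u ◃ i) = idh _.
Proof. rewrite <- whl_comp, inv_fwd; apply tens2_id. Qed.

Ltac cancel := rewrite <- ?comp_assoc, ?comp_idl, ?comp_idr;
  repeat first
  [ rewrite fwd_inv | rewrite inv_fwd | rewrite iso_fwd_inv_cut | rewrite iso_inv_fwd_cut
  | rewrite whl_fwd_inv | rewrite whl_inv_fwd
  | rewrite (comp_cut (whl_fwd_inv _)) | rewrite (comp_cut (whl_inv_fwd _))
  | rewrite comp_idl | rewrite comp_idr ].

Section Slides.
Context {K : Bicategory}.

(** [k ▹ w] with all brackets moved to the right, for [k] between binary composites.
    [spread] and [absorb] play the same role for cells shaped like the constraints
    [mu] and [eps] of a pseudo-functor. *)
Definition slide {a b c b' s : K} {p : arr a b} {q : arr b c} {r : arr a b'} {t : arr b' c}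
  (k : hom (p ⊠ q) (r ⊠ t)) (w : arr c s) : hom (p ⊠ (q ⊠ w)) (r ⊠ (t ⊠ w)) :=
  inv (asc r t w) • (k ▹ w) • asc p q w.

Definition spread {a b c s : K} {p : arr a c} {r : arr a b} {t : arr b c}
  (k : hom p (r ⊠ t)) (w : arr c s) : hom (p ⊠ w) (r ⊠ (t ⊠ w)) :=
  inv (asc r t w) • (k ▹ w).

Definition absorb {a s : K} {p : arr a a} (k : hom p (unit1 a)) (w : arr a s) :
  hom (p ⊠ w) w :=
  lun w • (k ▹ w).

Lemma slide_nat {a b c b' s : K} {p : arr a b} {q : arr b c} {r : arr a b'} {t : arr b' c}
  {k : hom (p ⊠ q) (r ⊠ t)} {w w' : arr c s} {x : hom w w'} :
  slide k w' • (p ◃ (q ◃ x)) = (r ◃ (t ◃ x)) • slide k w.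
Proof.
unfold slide; cat_nf; rw (asc_whl (c := x)); rw (interchange (a := k)).
rewrite !comp_assoc; f_equal; f_equal; apply iso_flip; symmetry; apply asc_whl.
Qed.

Lemma spread_nat {a b c s : K} {p : arr a c} {r : arr a b} {t : arr b c}
  {k : hom p (r ⊠ t)} {w w' : arr c s} {x : hom w w'} :
  spread k w' • (p ◃ x) = (r ◃ (t ◃ x)) • spread k w.
Proof.
unfold spread; cat_nf; rw (interchange (a := k)).
rewrite !comp_assoc; f_equal; apply iso_flip; symmetry; apply asc_whl.
Qed.

Lemma absorb_nat {a s : K} {p : arr a a} {k : hom p (unit1 a)} {w w' : arr a s}
  {x : hom w w'} : absorb k w' • (p ◃ x) = x • absorb k w.
Proof.
unfold absorb; cat_nf; rw (interchange (a := k)); rw (lun_nat x); reflexivity.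
Qed.

Lemma whr_slide {a b c b' s : K} {p : arr a b} {q : arr b c} {r : arr a b'} {t : arr b' c}
  (k : hom (p ⊠ q) (r ⊠ t)) (w : arr c s) :
  k ▹ w = asc r t w • slide k w • inv (asc p q w).
Proof. unfold slide; cancel; reflexivity. Qed.

Lemma whr_spread {a b c s : K} {p : arr a c} {r : arr a b} {t : arr b c}
  (k : hom p (r ⊠ t)) (w : arr c s) : k ▹ w = asc r t w • spread k w.
Proof. unfold spread; cancel; reflexivity. Qed.

(** The two axioms of a pseudo-natural transformation [t : F -> G], at composable
    arrows and at an object: [ff], [fg], [ffg] stand for the values of [F] at [f],
    [g] and [f ⊠ g], and likewise for [G]. *)
Section MuLaw.
Context {a b c a' b' c' : K} (tx : arr a' a) (ty : arr b' b) (tz : arr c' c)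
  {ff : arr a b} {fg : arr b c} {ffg : arr a c} {gf : arr a' b'} {gg : arr b' c'}
  {gfg : arr a' c'} (muF : hom ffg (ff ⊠ fg)) (muG : iso gfg (gf ⊠ gg))
  (tf : hom (gf ⊠ ty) (tx ⊠ ff)) (tg : hom (gg ⊠ tz) (ty ⊠ fg))
  (tfg : hom (gfg ⊠ tz) (tx ⊠ ffg)).

Definition mu_law : Prop :=
  asc tx ff fg • (tx ◃ muF) • tfg • (inv muG ▹ tz)
  = (tf ▹ fg) • asc gf ty fg • (gf ◃ tg) • inv (asc gf gg tz).

Definition mu_slide_law : Prop := forall s (w : arr c s),
  (tx ◃ spread muF w) • slide tfg w
  = slide tf (fg ⊠ w) • (gf ◃ slide tg w) • spread muG (tz ⊠ w).

(** Whiskered with [w], the two sides of the axiom become the two sides of its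
    slide form, conjugated by the same associators. *)
Lemma mu_law_slide : mu_law <-> mu_slide_law.
Proof.
pose (P := asc tx ff fg • (tx ◃ muF) • tfg).
pose (Q := (tf ▹ fg) • asc gf ty fg • (gf ◃ tg) • inv (asc gf gg tz) • (muG ▹ tz)).
assert (E : mu_law <-> P = Q).
{ unfold mu_law, P, Q; split; intros E.
  - rewrite !comp_assoc in E; rewrite !comp_assoc, <- E; cat_nf.
    rewrite <- whr_comp, inv_fwd, tens2_id, comp_idr; reflexivity.
  - rewrite !comp_assoc in E; rewrite !comp_assoc, E; cat_nf.
    rewrite <- whr_comp, fwd_inv, tens2_id, comp_idr; reflexivity. }
assert (HP : forall s (w : arr c s),
  P ▹ w = asc (tx ⊠ ff) fg w • asc tx ff (fg ⊠ w)
    • ((tx ◃ spread muF w) • slide tfg w) • inv (asc gfg tz w)).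
{ intros; unfold P; rewrite !whr_comp, asc_whr_pentagon, whl_whr.
  rewrite whr_slide, whr_spread, !whl_comp; cancel; reflexivity. }
assert (HQ : forall s (w : arr c s),
  Q ▹ w = asc (tx ⊠ ff) fg w • asc tx ff (fg ⊠ w)
    • (slide tf (fg ⊠ w) • (gf ◃ slide tg w) • spread muG (tz ⊠ w)) • inv (asc gfg tz w)).
{ intros; unfold Q; rewrite !whr_comp, asc_whr_pentagon, inv_asc_whr_pentagon,
   whl_whr, !whr_whr.
  rewrite !whr_slide, whr_spread, !whl_comp; cancel; reflexivity. }
rewrite E; split.
- intros EPQ s w.
  assert (H : P ▹ w = Q ▹ w) by (rewrite EPQ; reflexivity).
  rewrite HP, HQ in H; do 2 apply iso_cancel_l in H.
  apply (iso_cancel_r (i := inverse (asc gfg tz w))) in H; exact H.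
- intros H; apply whr_faithful; intros s w; rewrite HP, HQ, H; reflexivity.
Qed.
End MuLaw.

Section EpsLaw.
Context {a a' : K} (t : arr a' a) {fe : arr a a} {ge : arr a' a'}
  (eF : hom fe (unit1 a)) (eG : hom ge (unit1 a')) (te : hom (ge ⊠ t) (t ⊠ fe)).

Definition eps_law : Prop := lun t • (eG ▹ t) = run t • (t ◃ eF) • te.

Definition eps_slide_law : Prop := forall s (w : arr a s),
  absorb eG (t ⊠ w) = (t ◃ absorb eF w) • slide te w.

Lemma eps_law_slide : eps_law <-> eps_slide_law.
Proof.
assert (HP : forall s (w : arr a s),
  (lun t • (eG ▹ t)) ▹ w = absorb eG (t ⊠ w) • inv (asc ge t w)).
{ intros; unfold absorb; rewrite whr_comp, lun_whr, whr_whr; cancel; reflexivity. }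
assert (HQ : forall s (w : arr a s),
  (run t • (t ◃ eF) • te) ▹ w = ((t ◃ absorb eF w) • slide te w) • inv (asc ge t w)).
{ intros; unfold absorb; rewrite !whr_comp, run_whr, whl_whr, whr_slide, !whl_comp.
  cancel; reflexivity. }
unfold eps_law; split.
- intros E s w; apply (iso_cancel_r (i := inverse (asc ge t w))); cbn.
  rewrite <- HP, <- HQ, E; reflexivity.
- intros E; apply whr_faithful; intros s w; rewrite HP, HQ, E; reflexivity.
Qed.
End EpsLaw.

Section ModLaw.
Context {a b a' b' : K} {tx tx' : arr a' a} {ty ty' : arr b' b} {ff : arr a b}
  {gf : arr a' b'} (tf : hom (gf ⊠ ty) (tx ⊠ ff)) (tf' : hom (gf ⊠ ty') (tx' ⊠ ff))
  (px : hom tx tx') (py : hom ty ty').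

(** The axiom of a pseudo-modification from [t] to [t'] whose boundary consists of
    identities, at an element [f] with domain [y] and codomain [x]. *)
Definition mod_law : Prop := tf' • (gf ◃ py) = (px ▹ ff) • tf.

Lemma mod_law_slide :
  (forall s (w : arr b s),
    slide tf' w • (gf ◃ (py ▹ w)) = (px ▹ (ff ⊠ w)) • slide tf w) -> mod_law.
Proof.
intros E; apply whr_faithful; intros s w.
rewrite !whr_comp, whl_whr, whr_whr, !whr_slide; cancel.
rw (E s w); reflexivity.
Qed.
End ModLaw.

(** The cell at [f] of the vertical composite of two pseudo-natural
    transformations. *)
Definition vert {a b a' b' a'' b'' : K} {sx : arr a'' a'} {sy : arr b'' b'}
    {tx : arr a' a} {ty : arr b' b} {ff : arr a b} {gf : arr a' b'} {hf : arr a'' b''}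
    (sf : iso (hf ⊠ sy) (sx ⊠ gf)) (tf : iso (gf ⊠ ty) (tx ⊠ ff)) :
    iso (hf ⊠ (sy ⊠ ty)) (sx ⊠ tx ⊠ ff) :=
  iso_comp (asc sx tx ff) (iso_comp (iso_tens (iso_id sx) tf)
    (iso_comp (inverse (asc sx gf ty)) (iso_comp (iso_tens sf (iso_id ty)) (asc hf sy ty)))).

Lemma slide_vert {a b a' b' a'' b'' s : K} {sx : arr a'' a'} {sy : arr b'' b'}
    {tx : arr a' a} {ty : arr b' b} {ff : arr a b} {gf : arr a' b'} {hf : arr a'' b''}
    (sf : iso (hf ⊠ sy) (sx ⊠ gf)) (tf : iso (gf ⊠ ty) (tx ⊠ ff)) (w : arr b s) :
  slide (vert sf tf) w
  = asc sx tx (ff ⊠ w) • (sx ◃ slide tf w) • slide sf (ty ⊠ w) • (hf ◃ inv (asc sy ty w)).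
Proof.
unfold slide at 1, vert; cbn.
rewrite !whr_comp, !asc_whr_pentagon, inv_asc_whr_pentagon, whl_whr, whr_whr.
rewrite !whr_slide, !whl_comp; cancel; reflexivity.
Qed.

(** The cell at [f] of the identity of [F], where [ff] is the value of [F] at [f]. *)
Definition unitor_swap {a b : K} (ff : arr a b) : iso (ff ⊠ unit1 b) (unit1 a ⊠ ff) :=
  iso_comp (inverse (lun ff)) (run ff).

(** Kelly's unit law [lun_whr] and the triangle reduce the slide to left
    unitors, so that its naturality is that of [lun]. *)
Lemma slide_unitor_swap {a b s : K} (ff : arr a b) (w : arr b s) :
  slide (unitor_swap ff) w = inv (lun (ff ⊠ w)) • (ff ◃ lun w).
Proof.
apply (iso_cancel_l (i := lun (ff ⊠ w))); unfold slide, unitor_swap; cbn; cancel.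
assert (E : inv (lun ff) ▹ w = asc (unit1 a) ff w • inv (lun (ff ⊠ w))).
{ apply (iso_cancel_l (i := iso_tens (lun ff) (iso_id w))); cbn.
  rewrite <- whr_comp, fwd_inv, tens2_id, lun_whr; cancel; reflexivity. }
rewrite whr_comp, E, run_whr; cancel; reflexivity.
Qed.

Lemma inv_lun_nat {a b : K} {u u' : arr a b} {x : hom u u'} :
  inv (lun u') • x = (unit1 a ◃ x) • inv (lun u).
Proof. apply iso_flip; symmetry; apply lun_nat. Qed.

(** Apply the law of [t] under [sx], then the law of [s]; the cells of [s] at [f] and
    of [t] at [g], which are left in the wrong order, are exchanged by naturality of
    [slide sf]. *)
Lemma vert_mu_law {a b c a' b' c' a'' b'' c'' : K}
    {sx : arr a'' a'} {sy : arr b'' b'} {sz : arr c'' c'}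
    {tx : arr a' a} {ty : arr b' b} {tz : arr c' c}
    {ff : arr a b} {fg : arr b c} {ffg : arr a c}
    {gf : arr a' b'} {gg : arr b' c'} {gfg : arr a' c'}
    {hf : arr a'' b''} {hg : arr b'' c''} {hfg : arr a'' c''}
    (muF : iso ffg (ff ⊠ fg)) (muG : iso gfg (gf ⊠ gg)) (muH : iso hfg (hf ⊠ hg))
    (sf : iso (hf ⊠ sy) (sx ⊠ gf)) (sg : iso (hg ⊠ sz) (sy ⊠ gg))
    (sfg : iso (hfg ⊠ sz) (sx ⊠ gfg))
    (tf : iso (gf ⊠ ty) (tx ⊠ ff)) (tg : iso (gg ⊠ tz) (ty ⊠ fg))
    (tfg : iso (gfg ⊠ tz) (tx ⊠ ffg)) :
  mu_law muG muH sf sg sfg -> mu_law muF muG tf tg tfg ->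
  mu_law muF muH (vert sf tf) (vert sg tg) (vert sfg tfg).
Proof.
rewrite !mu_law_slide; intros ES ET s w.
rewrite !slide_vert; cat_nf; rewrite !whl_comp; cancel.
rwb (asc_whl (u := sx) (v := tx) (c := spread muF w)).
rewrite (comp_cut (eq_sym (whl_comp (u := sx)))), ET, !whl_comp; cat_nf.
rw (ES _ (tz ⊠ w)); rw (spread_nat (k := muH)); cancel.
rwb (slide_nat (k := sf)); reflexivity.
Qed.

Lemma vert_eps_law {a a' a'' : K} {s : arr a'' a'} {t : arr a' a}
    {fe : arr a a} {ge : arr a' a'} {he : arr a'' a''}
    (eF : hom fe (unit1 a)) (eG : hom ge (unit1 a')) (eH : hom he (unit1 a''))
    (se : iso (he ⊠ s) (s ⊠ ge)) (te : iso (ge ⊠ t) (t ⊠ fe)) :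
  eps_law eG eH se -> eps_law eF eG te -> eps_law eF eH (vert se te).
Proof.
rewrite !eps_law_slide; intros ES ET x w.
rewrite slide_vert; cat_nf.
rwb (asc_whl (u := s) (v := t)).
rewrite (comp_cut (eq_sym (whl_comp (u := s)))), <- ET.
rewrite (comp_cut (eq_sym (ES _ (t ⊠ w)))), absorb_nat; cancel; reflexivity.
Qed.

Lemma unitor_swap_mu_law {a b c : K} {ff : arr a b} {fg : arr b c} {ffg : arr a c}
    (muF : iso ffg (ff ⊠ fg)) :
  mu_law muF muF (unitor_swap ff) (unitor_swap fg) (unitor_swap ffg).
Proof.
rewrite mu_law_slide; intros s w; rewrite !slide_unitor_swap, whl_comp; cancel.
rewrite (comp_cut (eq_sym inv_lun_nat)); cat_nf; rewrite spread_nat; cat_nf; reflexivity.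
Qed.

Lemma unitor_swap_eps_law {a : K} {fe : arr a a} (eF : hom fe (unit1 a)) :
  eps_law eF eF (unitor_swap fe).
Proof.
rewrite eps_law_slide; intros s w; rewrite slide_unitor_swap.
rewrite (comp_cut (eq_sym inv_lun_nat)); cat_nf; rewrite absorb_nat; cancel; reflexivity.
Qed.

Lemma asc_mod_law {a b a' b' a'' b'' a3 b3 : K}
    {ux : arr a3 a''} {uy : arr b3 b''} {sx : arr a'' a'} {sy : arr b'' b'}
    {tx : arr a' a} {ty : arr b' b}
    {ff : arr a b} {gf : arr a' b'} {hf : arr a'' b''} {kf : arr a3 b3}
    (uf : iso (kf ⊠ uy) (ux ⊠ hf)) (sf : iso (hf ⊠ sy) (sx ⊠ gf))
    (tf : iso (gf ⊠ ty) (tx ⊠ ff)) :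
  mod_law (vert uf (vert sf tf)) (vert (vert uf sf) tf) (asc ux sx tx) (asc uy sy ty).
Proof.
apply mod_law_slide; intros s w.
rewrite !slide_vert, !asc_whr_pentagon, !whl_comp; cancel.
rewrite (comp_cut (asc_whl (u := ux) (v := sx))).
rewrite (comp_cut (slide_nat (k := uf))); cat_nf; reflexivity.
Qed.

Lemma lun_mod_law {a b a' b' : K} {tx : arr a' a} {ty : arr b' b}
    {ff : arr a b} {gf : arr a' b'} (tf : iso (gf ⊠ ty) (tx ⊠ ff)) :
  mod_law (vert (unitor_swap gf) tf) tf (lun tx) (lun ty).
Proof.
apply mod_law_slide; intros s w.
rewrite slide_vert, slide_unitor_swap, !lun_whr, !whl_comp; cancel.
rewrite (comp_cut (lun_nat _)); cancel; reflexivity.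
Qed.

Lemma run_mod_law {a b a' b' : K} {tx : arr a' a} {ty : arr b' b}
    {ff : arr a b} {gf : arr a' b'} (tf : iso (gf ⊠ ty) (tx ⊠ ff)) :
  mod_law (vert tf (unitor_swap ff)) tf (run tx) (run ty).
Proof.
apply mod_law_slide; intros s w.
rewrite slide_vert, slide_unitor_swap, !run_whr, !whl_comp; cancel.
rewrite (comp_cut slide_nat); cat_nf; reflexivity.
Qed.

(** The next lemmas transport the axioms along equalities of arrows: the components
    [t ∘ x] of a composite or an identity equal the expected tensor product or unit,
    but not by conversion. *)
Lemma mu_law_heq {a b c a' b' c' : K}
    {tx tx1 : arr a' a} {ty ty1 : arr b' b} {tz tz1 : arr c' c}
    {ff : arr a b} {fg : arr b c} {ffg : arr a c} {gf : arr a' b'} {gg : arr b' c'}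
    {gfg : arr a' c'} {muF : hom ffg (ff ⊠ fg)} {muG : iso gfg (gf ⊠ gg)}
    {tf : hom (gf ⊠ ty) (tx ⊠ ff)} {tg : hom (gg ⊠ tz) (ty ⊠ fg)}
    {tfg : hom (gfg ⊠ tz) (tx ⊠ ffg)}
    {tf1 : hom (gf ⊠ ty1) (tx1 ⊠ ff)} {tg1 : hom (gg ⊠ tz1) (ty1 ⊠ fg)}
    {tfg1 : hom (gfg ⊠ tz1) (tx1 ⊠ ffg)} :
  tx = tx1 -> ty = ty1 -> tz = tz1 -> tf ≈ tf1 -> tg ≈ tg1 -> tfg ≈ tfg1 ->
  mu_law muF muG tf1 tg1 tfg1 -> mu_law muF muG tf tg tfg.
Proof. intros <- <- <- <-%heq_eq <-%heq_eq <-%heq_eq; exact (fun E => E). Qed.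

Lemma eps_law_heq {a a' : K} {t t1 : arr a' a} {fe : arr a a} {ge : arr a' a'}
    {eF : hom fe (unit1 a)} {eG : hom ge (unit1 a')} {te : hom (ge ⊠ t) (t ⊠ fe)}
    {te1 : hom (ge ⊠ t1) (t1 ⊠ fe)} :
  t = t1 -> te ≈ te1 -> eps_law eF eG te1 -> eps_law eF eG te.
Proof. intros <- <-%heq_eq; exact (fun E => E). Qed.

Lemma mod_law_heq {a b a' b' : K} {tx tx' sx sx' : arr a' a}
    {ty ty' sy sy' : arr b' b} {ff : arr a b} {gf : arr a' b'}
    {tf : hom (gf ⊠ ty) (tx ⊠ ff)} {tf' : hom (gf ⊠ ty') (tx' ⊠ ff)}
    {px : hom tx tx'} {py : hom ty ty'}
    {sf : hom (gf ⊠ sy) (sx ⊠ ff)} {sf' : hom (gf ⊠ sy') (sx' ⊠ ff)}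
    {qx : hom sx sx'} {qy : hom sy sy'} :
  tx = sx -> tx' = sx' -> ty = sy -> ty' = sy' ->
  tf ≈ sf -> tf' ≈ sf' -> px ≈ qx -> py ≈ qy ->
  mod_law sf sf' qx qy -> mod_law tf tf' px py.
Proof.
intros <- <- <- <- <-%heq_eq <-%heq_eq <-%heq_eq <-%heq_eq; exact (fun E => E).
Qed.

Lemma mod_law_inv {a b a' b' : K} {tx tx' : arr a' a}
    {ty ty' : arr b' b} {ff : arr a b} {gf : arr a' b'}
    {tf : hom (gf ⊠ ty) (tx ⊠ ff)} {tf' : hom (gf ⊠ ty') (tx' ⊠ ff)}
    (px : iso tx tx') (py : iso ty ty') :
  mod_law tf tf' px py -> mod_law tf' tf (inv px) (inv py).
Proof.
unfold mod_law; intros E; symmetry.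
exact (iso_flip (i := iso_tens (iso_id gf) py) (j := iso_tens px (iso_id ff)) E).
Qed.

Lemma vert_heq {a b a' b' a'' b'' : K} {sx sx1 : arr a'' a'}
    {sy sy1 : arr b'' b'} {tx tx1 : arr a' a} {ty ty1 : arr b' b} {ff : arr a b}
    {gf : arr a' b'} {hf : arr a'' b''}
    {sf : iso (hf ⊠ sy) (sx ⊠ gf)} {tf : iso (gf ⊠ ty) (tx ⊠ ff)}
    {sf1 : iso (hf ⊠ sy1) (sx1 ⊠ gf)} {tf1 : iso (gf ⊠ ty1) (tx1 ⊠ ff)} :
  sx = sx1 -> sy = sy1 -> tx = tx1 -> ty = ty1 -> fwd sf ≈ fwd sf1 -> fwd tf ≈ fwd tf1 ->
  fwd (vert sf tf) ≈ fwd (vert sf1 tf1).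
Proof.
intros <- <- <- <- E1%heq_eq E2%heq_eq; apply eq_heq; unfold vert; cbn.
rewrite E1, E2; reflexivity.
Qed.

End Slides.

(** * Heterogeneous equality and whiskering *)

(** Composites such as [(g ∘ f) ∘ h] and [g ∘ (f ∘ h)] are equal without being
    convertible.  Isomorphisms are moved along such equalities by [iso_cast], and
    compared by [≈]. *)
Definition iso_cast {K : Category} {x y x' y' : K} (p : x = x') (q : y = y') (i : iso x y) :
  iso x' y' := eq_rect x (fun z => iso z y') (eq_rect y (iso x) i y' q) x' p.

Lemma iso_cast_fwd {K : Category} {x y x' y' : K} (p : x = x') (q : y = y') (i : iso x y) :
  fwd (iso_cast p q i) ≈ fwd i.
Proof. destruct p, q; constructor. Qed.

Lemma iso_cast_inv {K : Category} {x y x' y' : K} (p : x = x') (q : y = y') (i : iso x y) :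
  inv (iso_cast p q i) ≈ inv i.
Proof. destruct p, q; constructor. Qed.

Lemma comp_heq {K : Category} {x y z x' y' z' : K} {g : hom y z} {f : hom x y}
  {g' : hom y' z'} {f' : hom x' y'} : g ≈ g' -> f ≈ f' -> g • f ≈ g' • f'.
Proof.
intros Hg Hf; rewrite <- (vcomp_refl g f eq_refl), <- (vcomp_refl g' f' eq_refl).
apply vcomp_heq; assumption.
Qed.

Lemma vcomp_comp {K : Category} {x y y' z a b c : K}
    {g : hom y' z} {f : hom x y} {p : y = y'} {g' : hom b c} {f' : hom a b} :
  g ≈ g' -> f ≈ f' -> vcomp g f p ≈ g' • f'.
Proof. intros Hg Hf; destruct p; apply comp_heq; assumption. Qed.

Section Whiskering.
Context {C : TwoCategory}.

Definition iso_whr {X Y Z : C} {g g' : Hom Y Z} (i : iso g g') (h : Hom X Y) :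
  iso (g ∘ h) (g' ∘ h).
Proof.
refine (mkIso (fwd := i ▷ h) (inv := inv i ▷ h) _ _).
- abstract (rewrite <- comp_whisker, inv_fwd; apply comp2_id).
- abstract (rewrite <- comp_whisker, fwd_inv; apply comp2_id).
Defined.

Lemma whisker_comp1 {X Y Z V : C} (g : Hom Y Z) (f : Hom X Y) {h h' : Hom V X}
  (a : hom h h') : (g ∘ f) ◁ a ≈ g ◁ (f ◁ a).
Proof.
rewrite <- (comp2_id g f); apply comp2_assoc.
Qed.

Lemma whisker_comp1_eq {X Y Y' Z V : C} (g : Hom Y Z) (f : Hom X Y) (g' : Hom Y' Z)
    (f' : Hom X Y') {h h' : Hom V X} (a : hom h h') :
  g ∘ f = g' ∘ f' -> g ◁ (f ◁ a) ≈ g' ◁ (f' ◁ a).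
Proof.
intros E; eapply heq_trans; [apply heq_sym, whisker_comp1|].
eapply heq_trans; [|apply whisker_comp1]; rewrite E; constructor.
Qed.

Lemma comp_whisker_heq {X Y Z : C} {g g' g'' : Hom Y Z} {f : Hom X Y}
    {b : hom g' g''} {a : hom g g'} {x y z : Hom X Z} {b' : hom y z} {a' : hom x y} :
  b ▷ f ≈ b' -> a ▷ f ≈ a' -> (b • a) ▷ f ≈ b' • a'.
Proof. intros H1 H2; rewrite comp_whisker; apply comp_heq; assumption. Qed.

Lemma vcomp_whisker_heq {X Y Z : C} {g k g' g'' : Hom Y Z} {f : Hom X Y} {p : k = g'}
    {b : hom g' g''} {a : hom g k} {x y z : Hom X Z} {b' : hom y z} {a' : hom x y} :
  b ▷ f ≈ b' -> a ▷ f ≈ a' -> vcomp b a p ▷ f ≈ b' • a'.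
Proof. destruct p; apply comp_whisker_heq. Qed.

Lemma whisker_id_whisker {X Y Z : C} {u : Hom Y Z} {f : Hom X Y} {v : Hom X Z} :
  u ∘ f = v -> idh u ▷ f ≈ idh v.
Proof. intros <-; apply whisker_id. Qed.

Lemma whisker_assoc_heq {X Y Z V : C} {g g' : Hom Z V} {k : Hom Y Z} {h : Hom X Y}
    {b : hom g g'} {l : Hom X Z} : k ∘ h = l -> (b ▷ k) ▷ h ≈ b ▷ l.
Proof. intros <-; apply whisker_whisker. Qed.

Lemma whisker_right_assoc {X Y Z V : C} {g : Hom Z V} {k k' : Hom Y Z} {h : Hom X Y}
    {a : hom k k'} : (g ◁ a) ▷ h ≈ g ◁ (a ▷ h).
Proof. apply comp2_assoc. Qed.

Lemma whisker_one {X Y : C} {f g : Hom X Y} (a : hom f g) : a ▷ one ≈ a.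
Proof. apply comp2_oner. Qed.

Lemma whisker_is_one {X Y : C} {f g : Hom X Y} {h : Hom X X} (a : hom f g) :
  h = one -> a ▷ h ≈ a.
Proof. intros ->; apply comp2_oner. Qed.

Lemma whisker_eq {X Y Z : C} {g g' : Hom Y Z} {a : hom g g'} {h k : Hom X Y} :
  h = k -> a ▷ h ≈ a ▷ k.
Proof. intros <-; constructor. Qed.

(** Interchange.  Applied to [b := alpha], [lam] or [rho], it is the naturality of
    that constraint in its generalised elements. *)
Lemma exchange {X Y Z : C} {g g' : Hom Y Z} {f f' : Hom X Y} (b : hom g g') (a : hom f f') :
  (b ▷ f') • (g ◁ a) = (g' ◁ a) • (b ▷ f).
Proof. rewrite <- !comp2_comp, !comp_idl, !comp_idr; reflexivity. Qed.
End Whiskering.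

Section GraphFacts.
Context {C : TwoCategory} {G : Graph C}.

Lemma pi1_pc2 {W : C} {u u' v v' : Hom W (C1 G)} {q q'} {a : hom u u'} {b : hom v v'}
  {r : d ◁ a ≈ c ◁ b} : pi1_2 ◁ pc2 q q' r ≈ a.
Proof. apply p1_pair2. Qed.

Lemma pi2_pc2 {W : C} {u u' v v' : Hom W (C1 G)} {q q'} {a : hom u u'} {b : hom v v'}
  {r : d ◁ a ≈ c ◁ b} : pi2_2 ◁ pc2 q q' r ≈ b.
Proof. apply p2_pair2. Qed.

(** The 2-dimensional uniqueness of a pullback, for 2-cells whose end points are
    only propositionally equal. *)
Lemma P2_ext2 {W : C} {h k h' k' : Hom W (P2 G)} (x : hom h k) (y : hom h' k') :
  pi1_2 ◁ x ≈ pi1_2 ◁ y -> pi2_2 ◁ x ≈ pi2_2 ◁ y -> h = h' -> k = k' -> x ≈ y.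
Proof.
intros H1 H2 Eh Ek; destruct Eh, Ek; apply eq_heq, pb_ext2; apply heq_eq; assumption.
Qed.

Lemma pr2_whisker {V W : C} {f g : Hom V (C1 G)} {q : d ∘ f = c ∘ g} {h h' : Hom W V}
    {x : hom h h'} {u u' v v' : Hom W (C1 G)} {qq qq'} {a : hom u u'} {b : hom v v'}
    {r : d ◁ a ≈ c ◁ b} :
  f ∘ h = u -> f ∘ h' = u' -> g ∘ h = v -> g ∘ h' = v' ->
  f ◁ x ≈ a -> g ◁ x ≈ b -> pr2 q ◁ x ≈ pc2 qq qq' r.
Proof.
intros <- <- <- <- Ha Hb.
assert (E : forall k : Hom W V, pi1_2 ∘ pr2 q ∘ k = f ∘ k /\ pi2_2 ∘ pr2 q ∘ k = g ∘ k)
  by (split; mor).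
apply P2_ext2; [| |apply P2_ext; mor..].
- eapply heq_trans; [|apply heq_sym, pi1_pc2].
  eapply heq_trans; [apply heq_sym, whisker_comp1|]. rewrite pi1_2_pr2; exact Ha.
- eapply heq_trans; [|apply heq_sym, pi2_pc2].
  eapply heq_trans; [apply heq_sym, whisker_comp1|]. rewrite pi2_2_pr2; exact Hb.
Qed.

Lemma pc2_whisker {V W : C} {u u' v v' : Hom V (C1 G)} {q q'} {a : hom u u'} {b : hom v v'}
    {r : d ◁ a ≈ c ◁ b} {h : Hom W V}
    {x x' y y' : Hom W (C1 G)} {t t'} {a' : hom x x'} {b' : hom y y'} {s : d ◁ a' ≈ c ◁ b'} :
  u ∘ h = x -> u' ∘ h = x' -> v ∘ h = y -> v' ∘ h = y' ->
  a ▷ h ≈ a' -> b ▷ h ≈ b' -> pc2 q q' r ▷ h ≈ pc2 t t' s.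
Proof.
intros <- <- <- <- Ha Hb.
apply P2_ext2; [| |apply P2_ext; mor..].
- eapply heq_trans; [|apply heq_sym, pi1_pc2]; eapply heq_trans; [|exact Ha].
  apply whisker_right, pi1_pc2.
- eapply heq_trans; [|apply heq_sym, pi2_pc2]; eapply heq_trans; [|exact Hb].
  apply whisker_right, pi2_pc2.
Qed.

Section Triples.
Context {W : C} {u u' v v' w w' : Hom W (C1 G)} {q : d ∘ u = c ∘ v} {r : d ∘ v = c ∘ w}
  {q' : d ∘ u' = c ∘ v'} {r' : d ∘ v' = c ∘ w'}
  {a : hom u u'} {b : hom v v'} {s : hom w w'}
  (p : d ◁ a ≈ c ◁ b) (o : d ◁ b ≈ c ◁ s).

Lemma pc3_proof : d ◁ a ≈ (c ∘ @p1 _ _ _ _ _ _ (P2 G)) ◁ pc2 r r' o.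
Proof.
eapply heq_trans; [exact p|].
eapply heq_trans; [|apply heq_sym, whisker_comp1].
apply comp2_heq; [constructor|apply heq_sym, p1_pair2].
Qed.

Definition pc3 : hom (pr3 q r) (pr3 q' r') :=
  pair2 (P3 G) (pr3_proof q r) (pr3_proof q' r') pc3_proof.

Lemma pi1_pc3 : pi1_3 ◁ pc3 ≈ a.
Proof. apply p1_pair2. Qed.
Lemma pi2_pc3 : pi2_3 ◁ pc3 ≈ b.
Proof.
eapply heq_trans; [apply whisker_comp1|].
eapply heq_trans; [|exact (pi1_pc2 (q := r) (q' := r') (r := o))]; apply comp2_heq; [constructor|apply p2_pair2].
Qed.
Lemma pi3_pc3 : pi3_3 ◁ pc3 ≈ s.
Proof.
eapply heq_trans; [apply whisker_comp1|].
eapply heq_trans; [|exact (pi2_pc2 (q := r) (q' := r') (r := o))]; apply comp2_heq; [constructor|apply p2_pair2].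
Qed.
End Triples.

Lemma pi1_4_pr4 (W : C) (u v w z : Hom W (C1 G)) (q : d ∘ u = c ∘ v)
    (r : d ∘ v = c ∘ w) (s : d ∘ w = c ∘ z) : pi1_4 ∘ pr4 q r s = u.
Proof. apply p1_pair. Qed.
Lemma pi2_4_pr4 (W : C) (u v w z : Hom W (C1 G)) (q : d ∘ u = c ∘ v)
    (r : d ∘ v = c ∘ w) (s : d ∘ w = c ∘ z) : pi2_4 ∘ pr4 q r s = v.
Proof. unfold pi2_4, pr4; rewrite comp1_assoc, p2_pair; apply pi1_3_pr3. Qed.
Lemma pi3_4_pr4 (W : C) (u v w z : Hom W (C1 G)) (q : d ∘ u = c ∘ v)
    (r : d ∘ v = c ∘ w) (s : d ∘ w = c ∘ z) : pi3_4 ∘ pr4 q r s = w.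
Proof. unfold pi3_4, pr4; rewrite comp1_assoc, p2_pair; apply pi2_3_pr3. Qed.
Lemma pi4_4_pr4 (W : C) (u v w z : Hom W (C1 G)) (q : d ∘ u = c ∘ v)
    (r : d ∘ v = c ∘ w) (s : d ∘ w = c ∘ z) : pi4_4 ∘ pr4 q r s = z.
Proof. unfold pi4_4, pr4; rewrite comp1_assoc, p2_pair; apply pi3_3_pr3. Qed.

End GraphFacts.

#[local] Opaque pi1_2 pi2_2 pi1_3 pi2_3 pi3_3 pi1_4 pi2_4 pi3_4 pi4_4 pr2 pr3 pr4 e m.

(** * Generalised elements of a pseudo-category *)

Section Elements.
Context {C : TwoCategory} {B : PseudoCategory C} {W : C}.
Implicit Types x y z : Hom W (C0 B).

(** Indexing by the boundary makes [el_tens] a total operation. *)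
Record El x y := mkEl {
  el :> Hom W (C1 B);
  c_el : c ∘ el = x;
  d_el : d ∘ el = y }.

(** The 2-cells of the double category of elements; [f] is the codomain part of the
    boundary and [g] its domain part, in the order of composition of [B]. *)
Record DCell x x' y y' (f : hom x x') (g : hom y y') (u : El x y) (u' : El x' y') := mkDC {
  ce :> hom (el u) (el u');
  c_ce : c ◁ ce ≈ f;
  d_ce : d ◁ ce ≈ g }.

Lemma dc_ext {x x' y y'} {f : hom x x'} {g : hom y y'} {u : El x y} {u' : El x' y'}
  (a b : DCell f g u u') : ce a = ce b -> a = b.
Proof.
destruct a as [a p q], b as [b p' q']; cbn; intros <-.
destruct (proof_irrelevance _ p p'), (proof_irrelevance _ q q'); reflexivity.
Qed.

Definition dc_comp {x x' x'' y y' y''} {f' : hom x' x''} {g' : hom y' y''} {f : hom x x'}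
  {g : hom y y'} {u : El x y} {u' : El x' y'} {u'' : El x'' y''}
  (b : DCell f' g' u' u'') (a : DCell f g u u') : DCell (f' • f) (g' • g) u u'' :=
  mkDC (whisker_comp_heq (c_ce b) (c_ce a)) (whisker_comp_heq (d_ce b) (d_ce a)).

Lemma gl_comp_bd {f : Hom (C1 B) (C0 B)} {x} {u u' u'' : Hom W (C1 B)} {b : hom u' u''}
  {a : hom u u'} : f ◁ b ≈ idh x -> f ◁ a ≈ idh x -> f ◁ (b • a) ≈ idh x.
Proof. intros H1 H2; rewrite <- (comp_idl (idh x)); apply whisker_comp_heq; assumption. Qed.

(** The globular cells.  Their composition is not an instance of [dc_comp], whose
    result has boundary [idh x • idh x]. *)
Definition GlCategory x y : Category.
Proof.
refine (@mkCategory (El x y) (fun u v => DCell (idh x) (idh y) u v)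
  (fun u => mkDC (whisker_id_eq (c_el u)) (whisker_id_eq (d_el u)))
  (fun u v w b a => mkDC (gl_comp_bd (c_ce b) (c_ce a)) (gl_comp_bd (d_ce b) (d_ce a)))
  _ _ _).
- abstract (intros; apply dc_ext; apply comp_assoc).
- abstract (intros; apply dc_ext; apply comp_idl).
- abstract (intros; apply dc_ext; apply comp_idr).
Defined.

Lemma el_composable {x y z} (u : El x y) (v : El y z) : d ∘ el u = c ∘ el v.
Proof. rewrite d_el, c_el; reflexivity. Qed.

Lemma c_m_pr2 {V : C} {u v : Hom V (C1 B)} (q : d ∘ u = c ∘ v) : c ∘ m ∘ pr2 q = c ∘ u.
Proof. mor. Qed.
Lemma d_m_pr2 {V : C} {u v : Hom V (C1 B)} (q : d ∘ u = c ∘ v) : d ∘ m ∘ pr2 q = d ∘ v.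
Proof. mor. Qed.

Definition el_tens {x y z} (u : El x y) (v : El y z) : El x z :=
  mkEl (eq_trans (c_m_pr2 (el_composable u v)) (c_el u))
       (eq_trans (d_m_pr2 (el_composable u v)) (d_el v)).

Lemma c_m_pc2 {V : C} {u u' v v' : Hom V (C1 B)} {q q'} {a : hom u u'} {b : hom v v'}
  {r : d ◁ a ≈ c ◁ b} : c ◁ (m ◁ pc2 q q' r) ≈ c ◁ a.
Proof.
eapply heq_trans; [apply (whisker_comp1_eq _ (c_m (M := B)))|].
apply comp2_heq; [constructor|apply pi1_pc2].
Qed.
Lemma d_m_pc2 {V : C} {u u' v v' : Hom V (C1 B)} {q q'} {a : hom u u'} {b : hom v v'}
  {r : d ◁ a ≈ c ◁ b} : d ◁ (m ◁ pc2 q q' r) ≈ d ◁ b.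
Proof.
eapply heq_trans; [apply (whisker_comp1_eq _ (d_m (M := B)))|].
apply comp2_heq; [constructor|apply pi2_pc2].
Qed.

Section DTens.
Context {x y z x' y' z' : Hom W (C0 B)} {f : hom x x'} {g : hom y y'} {h : hom z z'}
  {u : El x y} {v : El y z} {u' : El x' y'} {v' : El y' z'}.

Lemma dc_composable (a : DCell f g u u') (b : DCell g h v v') : d ◁ a ≈ c ◁ b.
Proof. eapply heq_trans; [apply d_ce|apply heq_sym, c_ce]. Qed.

Definition dc_tens (a : DCell f g u u') (b : DCell g h v v') :
    DCell f h (el_tens u v) (el_tens u' v').
Proof.
refine (@mkDC _ _ _ _ f h (el_tens u v) (el_tens u' v')
  (m ◁ pc2 (el_composable u v) (el_composable u' v') (dc_composable a b)) _ _).
- abstract (eapply heq_trans; [apply c_m_pc2|apply c_ce]).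
- abstract (eapply heq_trans; [apply d_m_pc2|apply d_ce]).
Defined.
End DTens.

(** Boundaries that are equal but not convertible occur when composites of globular
    cells are compared with composites of arbitrary ones; the tensor product is
    determined by the underlying 2-cells. *)
Lemma dc_tens_ext {x y z x' y' z' : Hom W (C0 B)} {f f1 : hom x x'} {g g1 : hom y y'}
    {h h1 : hom z z'} {u : El x y} {v : El y z} {u' : El x' y'} {v' : El y' z'}
    {a : DCell f g u u'} {b : DCell g h v v'} {a1 : DCell f1 g1 u u'} {b1 : DCell g1 h1 v v'} :
  ce a = ce a1 -> ce b = ce b1 -> ce (dc_tens a b) = ce (dc_tens a1 b1).
Proof.
intros Ea Eb; apply heq_eq, comp2_heq; [constructor|].
apply pc2_heq; apply eq_heq; assumption.
Qed.

Lemma dc_tens_comp {x y z x' y' z' x'' y'' z'' : Hom W (C0 B)} {f : hom x x'} {g : hom y y'}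
    {h : hom z z'} {f' : hom x' x''} {g' : hom y' y''} {h' : hom z' z''}
    {u : El x y} {v : El y z} {u' : El x' y'} {v' : El y' z'} {u'' : El x'' y''}
    {v'' : El y'' z''} (a' : DCell f' g' u' u'') (b' : DCell g' h' v' v'')
    (a : DCell f g u u') (b : DCell g h v v') :
  ce (dc_tens (dc_comp a' a) (dc_comp b' b)) = ce (dc_tens a' b') • ce (dc_tens a b).
Proof.
cbn; rewrite <- whisker_comp; f_equal; apply pc2_comp.
Qed.

Lemma el_asc_dom {x y z w} (u : El x y) (v : El y z) (r : El z w) :
  assoc_dom B ∘ pr3 (el_composable u v) (el_composable v r) = el_tens u (el_tens v r).
Proof. cbn; mor. Qed.
Lemma el_asc_cod {x y z w} (u : El x y) (v : El y z) (r : El z w) :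
  assoc_cod B ∘ pr3 (el_composable u v) (el_composable v r) = el_tens (el_tens u v) r.
Proof. cbn; mor. Qed.

(** The constraints [alpha], [lam], [rho], and below [mu], [eps] and [tau], all follow
    this pattern: the whiskered 2-cell is moved to end points that are tensor products
    of elements, and the result is comparable with the original by [≈]. *)
Definition raw_asc {x y z w} (u : El x y) (v : El y z) (r : El z w) :
    iso (el (el_tens u (el_tens v r))) (el (el_tens (el_tens u v) r)) :=
  iso_cast (el_asc_dom u v r) (el_asc_cod u v r)
    (iso_whr (alpha B) (pr3 (el_composable u v) (el_composable v r))).

Lemma raw_asc_heq {x y z w} (u : El x y) (v : El y z) (r : El z w) q q' :
  fwd (raw_asc u v r) ≈ alpha B ▷ pr3 (u := el u) (v := el v) (w := el r) q q'.
Proof.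
eapply heq_trans; [apply iso_cast_fwd|].
rewrite (proof_irrelevance _ q (el_composable u v)),
  (proof_irrelevance _ q' (el_composable v r)); constructor.
Qed.

Lemma raw_asc_inv_heq {x y z w} (u : El x y) (v : El y z) (r : El z w) q q' :
  inv (raw_asc u v r) ≈ inv (alpha B) ▷ pr3 (u := el u) (v := el v) (w := el r) q q'.
Proof.
eapply heq_trans; [apply iso_cast_inv|].
rewrite (proof_irrelevance _ q (el_composable u v)),
  (proof_irrelevance _ q' (el_composable v r)); constructor.
Qed.

Lemma whisker_bd {V X : C} {f : Hom V X} {U : C} {k l : Hom U V} {a : hom k l} {b : Hom U X}
    {u : Hom W U} {v w : Hom W V} {i : hom v w} {x : Hom W X} :
  i ≈ a ▷ u -> f ◁ a ≈ idh b -> b ∘ u = x -> f ◁ i ≈ idh x.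
Proof.
intros Hi Ha <-; eapply heq_trans; [apply comp2_heq; [constructor|exact Hi]|].
eapply heq_trans; [apply whisker_right, Ha|apply whisker_id].
Qed.

Lemma c_raw_asc {x y z w} (u : El x y) (v : El y z) (r : El z w) :
  c ◁ raw_asc u v r ≈ idh x.
Proof.
apply (whisker_bd (raw_asc_heq (el_composable u v) (el_composable v r)) (c_alpha B)).
transitivity (c ∘ el u); [mor|apply c_el].
Qed.
Lemma d_raw_asc {x y z w} (u : El x y) (v : El y z) (r : El z w) :
  d ◁ raw_asc u v r ≈ idh w.
Proof.
apply (whisker_bd (raw_asc_heq (el_composable u v) (el_composable v r)) (d_alpha B)).
transitivity (d ∘ el r); [mor|apply d_el].
Qed.

Definition gl_iso {x y} {u v : El x y} (i : iso (el u) (el v))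
    (ci : c ◁ i ≈ idh x) (di : d ◁ i ≈ idh y) : @iso (GlCategory x y) u v.
Proof.
refine (@mkIso (GlCategory x y) u v (mkDC ci di)
  (mkDC (whisker_inv ci) (whisker_inv di)) _ _).
- abstract (apply dc_ext; apply inv_fwd).
- abstract (apply dc_ext; apply fwd_inv).
Defined.

Definition el_asc {x y z w} (u : El x y) (v : El y z) (r : El z w) :
    @iso (GlCategory x w) (el_tens u (el_tens v r)) (el_tens (el_tens u v) r) :=
  gl_iso (c_raw_asc u v r) (d_raw_asc u v r).

(** The triple [(a, b, s)] is a 2-cell between morphisms into [P3 B]; interchange it
    with [alpha]. *)
Lemma el_asc_nat {x y z w x' y' z' w'} {f : hom x x'} {g : hom y y'}
    {h : hom z z'} {k : hom w w'} {u : El x y} {v : El y z} {r : El z w}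
    {u' : El x' y'} {v' : El y' z'} {r' : El z' w'}
    (a : DCell f g u u') (b : DCell g h v v') (s : DCell h k r r') :
  ce (fwd (el_asc u' v' r')) • ce (dc_tens a (dc_tens b s))
  = ce (dc_tens (dc_tens a b) s) • ce (fwd (el_asc u v r)).
Proof.
apply heq_eq.
pose (P := pc3 (q := el_composable u v) (r := el_composable v r)
  (q' := el_composable u' v') (r' := el_composable v' r')
  (dc_composable a b) (dc_composable b s)).
pose proof (pi1_pc3 (dc_composable a b) (dc_composable b s) : pi1_3 ◁ P ≈ ce a) as P1.
pose proof (pi2_pc3 (dc_composable a b) (dc_composable b s) : pi2_3 ◁ P ≈ ce b) as P2.
pose proof (pi3_pc3 (dc_composable a b) (dc_composable b s) : pi3_3 ◁ P ≈ ce s) as P3.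
assert (Ed : assoc_dom B ◁ P ≈ ce (dc_tens a (dc_tens b s))).
{ eapply heq_trans; [apply whisker_comp1|apply comp2_heq; [constructor|]].
  apply pr2_whisker; [cbn; mor..|exact P1|].
  eapply heq_trans; [apply whisker_comp1|apply comp2_heq; [constructor|]].
  apply pr2_whisker; [cbn; mor..|exact P2|exact P3]. }
assert (Ec : assoc_cod B ◁ P ≈ ce (dc_tens (dc_tens a b) s)).
{ eapply heq_trans; [apply whisker_comp1|apply comp2_heq; [constructor|]].
  apply pr2_whisker; [cbn; mor..| |exact P3].
  eapply heq_trans; [apply whisker_comp1|apply comp2_heq; [constructor|]].
  apply pr2_whisker; [cbn; mor..|exact P1|exact P2]. }
eapply heq_trans.
{ eapply comp_heq; [apply raw_asc_heq|apply heq_sym, Ed]. }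
eapply heq_trans; [apply eq_heq, exchange|].
apply comp_heq; [exact Ec|apply heq_sym, raw_asc_heq].
Qed.

Lemma c_unit x : c ∘ e ∘ x = x.
Proof. mor. Qed.
Lemma d_unit x : d ∘ e ∘ x = x.
Proof. mor. Qed.

Definition el_unit x : El x x := mkEl (c_unit x) (d_unit x).

Lemma c_unit2 {x x'} (f : hom x x') : c ◁ (e ◁ f) ≈ f.
Proof.
eapply heq_trans; [apply heq_sym, whisker_comp1|].
rewrite c_e; apply comp2_onel.
Qed.
Lemma d_unit2 {x x'} (f : hom x x') : d ◁ (e ◁ f) ≈ f.
Proof.
eapply heq_trans; [apply heq_sym, whisker_comp1|].
rewrite d_e; apply comp2_onel.
Qed.

Definition dc_unit {x x'} (f : hom x x') : DCell f f (el_unit x) (el_unit x') :=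
  @mkDC _ _ _ _ f f (el_unit x) (el_unit x') (e ◁ f) (c_unit2 f) (d_unit2 f).

Lemma el_lun_dom {x y} (u : El x y) : lunit_dom B ∘ el u = el_tens (el_unit x) u.
Proof. cbn. pose proof (c_el u); mor. Qed.
Lemma el_run_dom {x y} (u : El x y) : runit_dom B ∘ el u = el_tens u (el_unit y).
Proof. cbn. pose proof (d_el u); mor. Qed.

Definition raw_lun {x y} (u : El x y) : iso (el (el_tens (el_unit x) u)) (el u) :=
  iso_cast (el_lun_dom u) (comp1_onel (el u)) (iso_whr (lam B) (el u)).
Definition raw_run {x y} (u : El x y) : iso (el (el_tens u (el_unit y))) (el u) :=
  iso_cast (el_run_dom u) (comp1_onel (el u)) (iso_whr (rho B) (el u)).

Lemma raw_lun_heq {x y} (u : El x y) : fwd (raw_lun u) ≈ lam B ▷ el u.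
Proof. apply iso_cast_fwd. Qed.
Lemma raw_lun_inv_heq {x y} (u : El x y) : inv (raw_lun u) ≈ inv (lam B) ▷ el u.
Proof. apply iso_cast_inv. Qed.
Lemma raw_run_heq {x y} (u : El x y) : fwd (raw_run u) ≈ rho B ▷ el u.
Proof. apply iso_cast_fwd. Qed.

Definition el_lun {x y} (u : El x y) : @iso (GlCategory x y) (el_tens (el_unit x) u) u :=
  gl_iso (u := el_tens (el_unit x) u) (i := raw_lun u)
    (whisker_bd (raw_lun_heq u) (c_lam B) (c_el u))
    (whisker_bd (raw_lun_heq u) (d_lam B) (d_el u)).
Definition el_run {x y} (u : El x y) : @iso (GlCategory x y) (el_tens u (el_unit y)) u :=
  gl_iso (u := el_tens u (el_unit y)) (i := raw_run u)
    (whisker_bd (raw_run_heq u) (c_rho B) (c_el u))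
    (whisker_bd (raw_run_heq u) (d_rho B) (d_el u)).

Lemma el_lun_nat {x y x' y'} {f : hom x x'} {g : hom y y'} {u : El x y} {u' : El x' y'}
    (a : DCell f g u u') :
  ce (fwd (el_lun u')) • ce (dc_tens (dc_unit f) a) = ce a • ce (fwd (el_lun u)).
Proof.
apply heq_eq.
assert (Ed : lunit_dom B ◁ ce a ≈ ce (dc_tens (dc_unit f) a)).
{ eapply heq_trans; [apply whisker_comp1|apply comp2_heq; [constructor|]].
  pose proof (c_el u); pose proof (c_el u').
  apply pr2_whisker; [cbn; mor..| |apply comp2_onel].
  eapply heq_trans; [apply whisker_comp1|apply comp2_heq; [constructor|apply c_ce]]. }
eapply heq_trans; [eapply comp_heq; [apply raw_lun_heq|apply heq_sym, Ed]|].
eapply heq_trans; [apply eq_heq, exchange|].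
apply comp_heq; [apply comp2_onel|apply heq_sym, raw_lun_heq].
Qed.

Lemma el_run_nat {x y x' y'} {f : hom x x'} {g : hom y y'} {u : El x y} {u' : El x' y'}
    (a : DCell f g u u') :
  ce (fwd (el_run u')) • ce (dc_tens a (dc_unit g)) = ce a • ce (fwd (el_run u)).
Proof.
apply heq_eq.
assert (Ed : runit_dom B ◁ ce a ≈ ce (dc_tens a (dc_unit g))).
{ eapply heq_trans; [apply whisker_comp1|apply comp2_heq; [constructor|]].
  pose proof (d_el u); pose proof (d_el u').
  apply pr2_whisker; [cbn; mor..|apply comp2_onel|].
  eapply heq_trans; [apply whisker_comp1|apply comp2_heq; [constructor|apply d_ce]]. }
eapply heq_trans; [eapply comp_heq; [apply raw_run_heq|apply heq_sym, Ed]|].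
eapply heq_trans; [apply eq_heq, exchange|].
apply comp_heq; [apply comp2_onel|apply heq_sym, raw_run_heq].
Qed.

End Elements.

(** The reduction rules of [mor], with those for strings of four arrows and for
    generalised elements.  The rule is selected by the heads of the two factors. *)
Ltac fast_rule :=
  lazymatch goal with
  | |- pi1_2 ∘ pr2 _ = _ => apply pi1_2_pr2
  | |- pi2_2 ∘ pr2 _ = _ => apply pi2_2_pr2
  | |- pi1_3 ∘ pr3 _ _ = _ => apply pi1_3_pr3
  | |- pi2_3 ∘ pr3 _ _ = _ => apply pi2_3_pr3
  | |- pi3_3 ∘ pr3 _ _ = _ => apply pi3_3_pr3
  | |- pi1_4 ∘ pr4 _ _ _ = _ => apply pi1_4_pr4
  | |- pi2_4 ∘ pr4 _ _ _ = _ => apply pi2_4_pr4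
  | |- pi3_4 ∘ pr4 _ _ _ = _ => apply pi3_4_pr4
  | |- pi4_4 ∘ pr4 _ _ _ = _ => apply pi4_4_pr4
  | |- d ∘ pi1_2 = _ => apply d_pi1_2
  | |- d ∘ pi1_3 = _ => apply d_pi1_3
  | |- d ∘ pi2_3 = _ => apply d_pi2_3
  | |- d ∘ e = _ => apply d_e
  | |- c ∘ e = _ => apply c_e
  | |- d ∘ m = _ => apply d_m
  | |- c ∘ m = _ => apply c_m
  | |- d ∘ F1 _ = _ => apply d_F1
  | |- c ∘ F1 _ = _ => apply c_F1
  | |- d ∘ t_ _ = _ => apply d_t
  | |- c ∘ t_ _ = _ => apply c_t
  | |- d ∘ el _ = _ => apply d_el
  | |- c ∘ el _ = _ => apply c_el
  | |- one ∘ _ = _ => apply comp1_onel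
  | |- _ ∘ one = _ => apply comp1_oner
  | |- _ => eassumption
  end.
(* [idtac] delays the [lazymatch] until the tactic runs: [mor] passes it as an argument. *)
Ltac mor_rule ::= idtac; fast_rule.
Ltac mor_unfold ::=
  unfold tau_dom, tau_cod, mu_cod, assoc_dom, assoc_cod, lunit_dom, runit_dom.

(** The end points of both sides of the axioms of a pseudo-category, in a form
    that does not depend on the proofs of composability. *)
Section BaseBoundaries.
Context {D : TwoCategory} (M : Base D).

Lemma d_lunit_dom : d ∘ lunit_dom M = d.
Proof. mor. Qed.
Lemma c_lunit_dom : c ∘ lunit_dom M = c.
Proof. mor. Qed.
Lemma d_runit_dom : d ∘ runit_dom M = d.
Proof. mor. Qed.
Lemma c_runit_dom : c ∘ runit_dom M = c.
Proof. mor. Qed.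
Lemma d_assoc_dom : d ∘ assoc_dom M = d ∘ pi3_3.
Proof. mor. Qed.
Lemma c_assoc_dom : c ∘ assoc_dom M = c ∘ pi1_3.
Proof. mor. Qed.
Lemma d_assoc_cod : d ∘ assoc_cod M = d ∘ pi3_3.
Proof. mor. Qed.
Lemma c_assoc_cod : c ∘ assoc_cod M = c ∘ pi1_3.
Proof. mor. Qed.
Lemma units_e : lunit_dom M ∘ e = runit_dom M ∘ e.
Proof. mor. Qed.
Lemma pentagon_source q1 q2 q3 q4 q5 q6 :
  assoc_dom M ∘ pr3 (u := pi1_4) (v := pi2_4) (w := m ∘ pr2 (u := pi3_4) (v := pi4_4) q1) q2 q3
  = m ∘ pr2 (u := pi1_4) (v := assoc_dom M ∘ pr3 (u := pi2_4) (v := pi3_4) (w := pi4_4) q4 q5) q6.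
Proof. mor. Qed.
Lemma pentagon_target q1 q2 q3 q4 q5 q6 :
  assoc_cod M ∘ pr3 (u := m ∘ pr2 (u := pi1_4) (v := pi2_4) q1) (v := pi3_4) (w := pi4_4) q2 q3
  = m ∘ pr2 (u := assoc_cod M ∘ pr3 (u := pi1_4) (v := pi2_4) (w := pi3_4) q4 q5) (v := pi4_4) q6.
Proof. mor. Qed.
Lemma triangle_source q1 q2 q3 :
  assoc_dom M ∘ pr3 (u := pi1_2) (v := e ∘ c ∘ pi2_2) (w := pi2_2) q1 q2
  = m ∘ pr2 (u := pi1_2) (v := lunit_dom M ∘ pi2_2) q3.
Proof. mor. Qed.
Lemma triangle_target q1 q2 :
  m ∘ pr2 (u := one ∘ pi1_2 (G := M)) (v := pi2_2) q1
  = m ∘ pr2 (u := pi1_2) (v := one ∘ pi2_2) q2.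
Proof. mor. Qed.
End BaseBoundaries.

(** * Generalised elements of pseudo-functors and transformations *)

Section FunctorElements.
Context {C : TwoCategory} {A B : PseudoCategory C} {W : C} (F : PseudoFunctor A B).
Implicit Types x y z : Hom W (C0 A).

Lemma c_el_map {x y} (f : El x y) : c ∘ F1 F ∘ f = F0 F ∘ x.
Proof. mor. Qed.
Lemma d_el_map {x y} (f : El x y) : d ∘ F1 F ∘ f = F0 F ∘ y.
Proof. mor. Qed.
Definition el_map {x y} (f : El x y) : El (F0 F ∘ x) (F0 F ∘ y) :=
  mkEl (c_el_map f) (d_el_map f).

Lemma el_mu_dom {x y z} (f : El x y) (g : El y z) :
  (F1 F ∘ m) ∘ pr2 (el_composable f g) = el_map (el_tens f g).
Proof. cbn; mor. Qed.
Lemma el_mu_cod {x y z} (f : El x y) (g : El y z) :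
  mu_cod (d_F1 F) (c_F1 F) ∘ pr2 (el_composable f g) = el_tens (el_map f) (el_map g).
Proof. cbn; mor. Qed.

Definition raw_mu {x y z} (f : El x y) (g : El y z) :
    iso (el (el_map (el_tens f g))) (el (el_tens (el_map f) (el_map g))) :=
  iso_cast (el_mu_dom f g) (el_mu_cod f g) (iso_whr (mu F) (pr2 (el_composable f g))).

Lemma raw_mu_heq {x y z} (f : El x y) (g : El y z) :
  fwd (raw_mu f g) ≈ mu F ▷ pr2 (el_composable f g).
Proof. apply iso_cast_fwd. Qed.
Lemma raw_mu_inv_heq {x y z} (f : El x y) (g : El y z) :
  inv (raw_mu f g) ≈ inv (mu F) ▷ pr2 (el_composable f g).
Proof. apply iso_cast_inv. Qed.

Lemma c_raw_mu {x y z} (f : El x y) (g : El y z) : c ◁ raw_mu f g ≈ idh (F0 F ∘ x).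
Proof. apply (whisker_bd (raw_mu_heq f g) (c_mu F)); mor. Qed.
Lemma d_raw_mu {x y z} (f : El x y) (g : El y z) : d ◁ raw_mu f g ≈ idh (F0 F ∘ z).
Proof. apply (whisker_bd (raw_mu_heq f g) (d_mu F)); mor. Qed.

Definition el_mu {x y z} (f : El x y) (g : El y z) :
    @iso (GlCategory _ _) (el_map (el_tens f g)) (el_tens (el_map f) (el_map g)) :=
  gl_iso (c_raw_mu f g) (d_raw_mu f g).

Lemma mu_whisker_heq {x y z} {f : El x y} {g : El y z} {h : Hom W (P2 A)} :
  pi1_2 ∘ h = f -> pi2_2 ∘ h = g -> mu F ▷ h ≈ ce (fwd (el_mu f g)).
Proof.
intros E1 E2; eapply heq_trans; [|apply heq_sym, raw_mu_heq].
apply whisker_eq, P2_ext; mor.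
Qed.
Lemma mu_inv_whisker_heq {x y z} {f : El x y} {g : El y z} {h : Hom W (P2 A)} :
  pi1_2 ∘ h = f -> pi2_2 ∘ h = g -> inv (mu F) ▷ h ≈ ce (inv (el_mu f g)).
Proof.
intros E1 E2; eapply heq_trans; [|apply heq_sym, raw_mu_inv_heq].
apply whisker_eq, P2_ext; mor.
Qed.

Lemma el_eps_dom x : (F1 F ∘ e) ∘ x = el_map (el_unit x).
Proof. cbn; mor. Qed.
Lemma el_eps_cod x : (e ∘ F0 F) ∘ x = el_unit (F0 F ∘ x).
Proof. cbn; mor. Qed.

Definition raw_eps x : iso (el (el_map (el_unit x))) (el (el_unit (F0 F ∘ x))) :=
  iso_cast (el_eps_dom x) (el_eps_cod x) (iso_whr (eps F) x).

Lemma raw_eps_heq x : fwd (raw_eps x) ≈ eps F ▷ x.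
Proof. apply iso_cast_fwd. Qed.

Definition el_eps x :
    @iso (GlCategory _ _) (el_map (el_unit x)) (el_unit (F0 F ∘ x)) :=
  gl_iso (u := el_map (el_unit x)) (v := el_unit (F0 F ∘ x))
    (whisker_bd (raw_eps_heq x) (c_eps F) eq_refl)
    (whisker_bd (raw_eps_heq x) (d_eps F) eq_refl).
End FunctorElements.

Section TransformationElements.
Context {C : TwoCategory} {A B : PseudoCategory C} {F G : PseudoFunctor A B}.
Context {t : Hom (C0 A) (C1 B)} (dt : d ∘ t = F0 F) (ct : c ∘ t = F0 G).
Context (ta : iso (tau_dom ct) (tau_cod dt))
  (d_ta : d ◁ ta ≈ idh (d ∘ F1 F)) (c_ta : c ◁ ta ≈ idh (c ∘ F1 G)).

Section At.
Context {W : C}.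
Implicit Types x y z : Hom W (C0 A).

Lemma c_el_at x : c ∘ t ∘ x = F0 G ∘ x.
Proof. rewrite <- comp1_assoc, ct; reflexivity. Qed.
Lemma d_el_at x : d ∘ t ∘ x = F0 F ∘ x.
Proof. rewrite <- comp1_assoc, dt; reflexivity. Qed.
Definition el_at x : El (F0 G ∘ x) (F0 F ∘ x) := mkEl (c_el_at x) (d_el_at x).

Lemma el_tau_dom {x y} (f : El x y) :
  tau_dom ct ∘ f = el_tens (el_map G f) (el_at y).
Proof. cbn; mor. Qed.
Lemma el_tau_cod {x y} (f : El x y) :
  tau_cod dt ∘ f = el_tens (el_at x) (el_map F f).
Proof. cbn; mor. Qed.

Definition raw_tau {x y} (f : El x y) :
    iso (el (el_tens (el_map G f) (el_at y))) (el (el_tens (el_at x) (el_map F f))) :=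
  iso_cast (el_tau_dom f) (el_tau_cod f) (iso_whr ta f).

Lemma raw_tau_heq {x y} (f : El x y) : fwd (raw_tau f) ≈ ta ▷ f.
Proof. apply iso_cast_fwd. Qed.

Lemma c_raw_tau {x y} (f : El x y) : c ◁ raw_tau f ≈ idh (F0 G ∘ x).
Proof. apply (whisker_bd (raw_tau_heq f) c_ta); mor. Qed.
Lemma d_raw_tau {x y} (f : El x y) : d ◁ raw_tau f ≈ idh (F0 F ∘ y).
Proof. apply (whisker_bd (raw_tau_heq f) d_ta); mor. Qed.

Definition el_tau {x y} (f : El x y) :
    @iso (GlCategory _ _) (el_tens (el_map G f) (el_at y)) (el_tens (el_at x) (el_map F f)) :=
  gl_iso (c_raw_tau f) (d_raw_tau f).

Lemma tau_whisker_heq {x y} {f : El x y} {V : C} {k : Hom V (C1 A)} {h : Hom W V} :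
  k ∘ h = f -> (ta ▷ k) ▷ h ≈ ce (fwd (el_tau f)).
Proof.
intros E; eapply heq_trans; [|apply heq_sym, raw_tau_heq]; apply whisker_assoc_heq, E.
Qed.
Lemma tau_whisker_heq1 {x y} {f : El x y} {h : Hom W (C1 A)} :
  h = f -> ta ▷ h ≈ ce (fwd (el_tau f)).
Proof.
intros E; eapply heq_trans; [|apply heq_sym, raw_tau_heq]; apply whisker_eq, E.
Qed.
End At.

End TransformationElements.

Lemma asc_whisker_heq {C : TwoCategory} {B : PseudoCategory C} {V W : C} {x y z w}
    {k : Hom V (P3 B)} {h : Hom W V} {u : El x y} {v : El y z} {r : El z w} :
  pi1_3 ∘ k ∘ h = u -> pi2_3 ∘ k ∘ h = v -> pi3_3 ∘ k ∘ h = r ->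
  (alpha B ▷ k) ▷ h ≈ ce (fwd (el_asc u v r)).
Proof.
intros E1 E2 E3; eapply heq_trans; [|apply heq_sym, raw_asc_heq].
apply whisker_assoc_heq, P3_ext; [rewrite E1|rewrite E2|rewrite E3]; symmetry.
- apply (pi1_3_pr3 (el_composable u v) (el_composable v r)).
- apply (pi2_3_pr3 (el_composable u v) (el_composable v r)).
- apply (pi3_3_pr3 (el_composable u v) (el_composable v r)).
Qed.

Lemma asc_inv_whisker_heq {C : TwoCategory} {B : PseudoCategory C} {V W : C} {x y z w}
    {k : Hom V (P3 B)} {h : Hom W V} {u : El x y} {v : El y z} {r : El z w} :
  pi1_3 ∘ k ∘ h = u -> pi2_3 ∘ k ∘ h = v -> pi3_3 ∘ k ∘ h = r ->
  (inv (alpha B) ▷ k) ▷ h ≈ ce (inv (el_asc u v r)).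
Proof.
intros E1 E2 E3; eapply heq_trans; [|apply heq_sym, raw_asc_inv_heq].
apply whisker_assoc_heq, P3_ext; [rewrite E1|rewrite E2|rewrite E3]; symmetry.
- apply (pi1_3_pr3 (el_composable u v) (el_composable v r)).
- apply (pi2_3_pr3 (el_composable u v) (el_composable v r)).
- apply (pi3_3_pr3 (el_composable u v) (el_composable v r)).
Qed.

Lemma lun_whisker_heq {C : TwoCategory} {B : PseudoCategory C} {V W : C} {x y}
    {k : Hom V (C1 B)} {h : Hom W V} {u : El x y} :
  k ∘ h = u -> (lam B ▷ k) ▷ h ≈ ce (fwd (el_lun u)).
Proof.
intros E; eapply heq_trans; [|apply heq_sym, raw_lun_heq].
apply whisker_assoc_heq, E.
Qed.
Lemma run_whisker_heq {C : TwoCategory} {B : PseudoCategory C} {V W : C} {x y}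
    {k : Hom V (C1 B)} {h : Hom W V} {u : El x y} :
  k ∘ h = u -> (rho B ▷ k) ▷ h ≈ ce (fwd (el_run u)).
Proof.
intros E; eapply heq_trans; [|apply heq_sym, raw_run_heq].
apply whisker_assoc_heq, E.
Qed.

Lemma tens_whisker_heq {C : TwoCategory} {B : PseudoCategory C} {V W : C}
    {x y z x' y' z' : Hom W (C0 B)} {f : hom x x'} {g : hom y y'} {h : hom z z'}
    {u : El x y} {v : El y z} {u' : El x' y'} {v' : El y' z'}
    {a : DCell f g u u'} {b : DCell g h v v'} {k : Hom W V}
    {uu uu' vv vv' : Hom V (C1 B)} {q q'} {aa : hom uu uu'} {bb : hom vv vv'}
    {r : d ◁ aa ≈ c ◁ bb} :
  uu ∘ k = u -> uu' ∘ k = u' -> vv ∘ k = v -> vv' ∘ k = v' ->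
  aa ▷ k ≈ ce a -> bb ▷ k ≈ ce b -> (m ◁ pc2 q q' r) ▷ k ≈ ce (dc_tens a b).
Proof.
intros; eapply heq_trans; [apply whisker_right_assoc|].
apply comp2_heq; [constructor|apply pc2_whisker; assumption].
Qed.

Lemma vcomp_whisker_gl {C : TwoCategory} {B : PseudoCategory C} {V W : C} {x y} {u u' u'' : El (B := B) (W := W) x y}
    {g k g' g'' : Hom V (C1 B)} {h : Hom W V} {p : k = g'}
    {b : hom g' g''} {a : hom g k} {b' : @hom (GlCategory x y) u' u''}
    {a' : @hom (GlCategory x y) u u'} :
  b ▷ h ≈ ce b' -> a ▷ h ≈ ce a' -> vcomp b a p ▷ h ≈ ce (b' • a').
Proof. apply vcomp_whisker_heq. Qed.

Ltac mor_el := cbn; intros; mor.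

(** [whisk] proves that the whiskering of a composite of constraints by a generalised
    element is the corresponding composite in the bicategory of elements, by descending
    along the structure of the composite. *)
Ltac whisk :=
  lazymatch goal with
  | |- vcomp _ _ _ ▷ _ ≈ _ =>
      first [eapply vcomp_whisker_gl | eapply vcomp_whisker_heq]; whisk
  | |- (m ◁ pc2 _ _ _) ▷ _ ≈ _ =>
      eapply tens_whisker_heq; [mor_el|mor_el|mor_el|mor_el|whisk|whisk]
  | |- (fwd (alpha _) ▷ _) ▷ _ ≈ _ => apply asc_whisker_heq; mor_el
  | |- (inv (alpha _) ▷ _) ▷ _ ≈ _ => apply asc_inv_whisker_heq; mor_el
  | |- (fwd (lam _) ▷ _) ▷ _ ≈ _ => apply lun_whisker_heq; mor_el
  | |- (fwd (rho _) ▷ _) ▷ _ ≈ _ => apply run_whisker_heq; mor_el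
  | |- fwd (mu _) ▷ _ ≈ _ => apply mu_whisker_heq; mor_el
  | |- inv (mu _) ▷ _ ≈ _ => apply mu_inv_whisker_heq; mor_el
  | |- fwd (eps _) ▷ _ ≈ _ => apply heq_sym, raw_eps_heq
  | |- idh _ ▷ _ ≈ _ => apply whisker_id_whisker; mor_el
  | |- (_ ▷ _) ▷ _ ≈ _ => apply tau_whisker_heq; mor_el
  | |- _ => apply tau_whisker_heq1; mor_el
  end.

(** * The bicategory of elements *)

Section Instance.
Context {C : TwoCategory} (B : PseudoCategory C) (W : C).

(** Whisker the pentagon of [B] with the morphism into [P4 B] given by the four
    elements. *)
Lemma el_pentagon {x y z w s} (u : El (B := B) (W := W) x y) (v : El y z) (r : El z w)
    (q : El w s) :
  ce (fwd (el_asc (el_tens u v) r q)) • ce (fwd (el_asc u v (el_tens r q)))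
  = ce (dc_tens (fwd (el_asc u v r)) (idh (q : GlCategory w s)))
    • ce (fwd (el_asc u (el_tens v r) q))
    • ce (dc_tens (idh (u : GlCategory x y)) (fwd (el_asc v r q))).
Proof.
set (k := pr4 (el_composable u v) (el_composable v r) (el_composable r q)).
pose proof (comp2_heq (pentagon B) (heq_refl (idh k))) as E.
apply heq_eq; rewrite comp_assoc.
eapply heq_trans; [apply heq_sym|eapply heq_trans; [exact E|]]; subst k.
- whisk.
- whisk.
Qed.

Lemma el_triangle {x y z} (u : El (B := B) (W := W) x y) (v : El y z) :
  ce (dc_tens (fwd (el_run u)) (idh (v : GlCategory y z))) • ce (fwd (el_asc u (el_unit y) v))
  = ce (dc_tens (idh (u : GlCategory x y)) (fwd (el_lun v))).
Proof.
set (k := pr2 (el_composable u v)).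
pose proof (comp2_heq (triangle B) (heq_refl (idh k))) as E.
apply heq_eq.
eapply heq_trans; [apply heq_sym|eapply heq_trans; [exact E|]]; subst k; clear E; whisk.
Qed.

Definition el_bicat : Bicategory.
Proof.
refine (@mkBicategory (Hom W (C0 B)) (@GlCategory C B W) (@el_unit C B W) (@el_tens C B W)
  (fun x y z u u' v v' a b => dc_tens a b) _ _ (@el_asc C B W) (@el_lun C B W)
  (@el_run C B W) _ _ _ _ _).
- abstract (intros; apply dc_ext; cbn; rewrite pc2_id, comp2_id; reflexivity).
- abstract (intros; apply dc_ext;
    etransitivity; [|apply dc_tens_comp]; apply dc_tens_ext; reflexivity).
- abstract (intros; apply dc_ext; apply el_asc_nat).
- abstract (intros; apply dc_ext; etransitivity; [|apply el_lun_nat];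
    apply (f_equal (comp _)), dc_tens_ext; [symmetry; apply comp2_id|reflexivity]).
- abstract (intros; apply dc_ext; etransitivity; [|apply el_run_nat];
    apply (f_equal (comp _)), dc_tens_ext; [reflexivity|symmetry; apply comp2_id]).
- abstract (intros; apply dc_ext, el_pentagon).
- abstract (intros; apply dc_ext, el_triangle).
Defined.
End Instance.

(** * The axioms at generalised elements *)

Section TransformationLaws.
Context {C : TwoCategory} {A B : PseudoCategory C} {F G : PseudoFunctor A B}.
Context {t : Hom (C0 A) (C1 B)} {dt : d ∘ t = F0 F} {ct : c ∘ t = F0 G}.
Context {ta : iso (tau_dom ct) (tau_cod dt)}
  (d_ta : d ◁ ta ≈ idh (d ∘ F1 F)) (c_ta : c ◁ ta ≈ idh (c ∘ F1 G)).

Definition mu_law_at {W : C} {x y z : Hom W (C0 A)} (f : El x y) (g : El y z) : Prop :=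
  mu_law (K := el_bicat B W) (el_mu F f g) (el_mu G f g) (el_tau d_ta c_ta f) (el_tau d_ta c_ta g)
    (el_tau d_ta c_ta (el_tens f g)).

Lemma pn_mu_law_at : pn_mu_law d_ta c_ta ->
  forall (W : C) (x y z : Hom W (C0 A)) (f : El x y) (g : El y z), mu_law_at f g.
Proof.
intros H W x y z f g.
pose proof (comp2_heq H (heq_refl (idh (pr2 (el_composable f g))))) as E.
apply dc_ext, heq_eq; rewrite !comp_assoc.
eapply heq_trans; [apply heq_sym|eapply heq_trans; [exact E|]]; clear E H; whisk.
Qed.

Definition pi1_el : El (B := A) (c ∘ pi1_2) (d ∘ pi1_2) := mkEl eq_refl eq_refl.
Definition pi2_el : El (B := A) (d ∘ pi1_2) (d ∘ pi2_2) := mkEl (eq_sym d_pi1_2) eq_refl.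
(** The universal element of [C1 A]. *)
Definition one_el : El (B := A) c d :=
  mkEl (comp1_oner c) (comp1_oner d).

(** The projections are the universal composable pair: the pairing
    [⟨ pi1_2, pi2_2 ⟩] is the identity of [P2 A], and whiskering with it changes
    nothing. *)
Lemma pn_mu_law_universal : mu_law_at pi1_el pi2_el -> pn_mu_law d_ta c_ta.
Proof.
intros H; apply (f_equal (@ce _ _ _ _ _ _ _ _ _ _ _)), eq_heq in H; rewrite !comp_assoc in H.
assert (Eh : pr2 (el_composable pi1_el pi2_el) = one) by (apply P2_ext; cbn; mor).
eapply heq_trans; [apply heq_sym, (whisker_is_one _ Eh)|].
eapply heq_trans; [|apply (whisker_is_one _ Eh)]; clear Eh.
eapply heq_trans; [|eapply heq_trans; [exact H|apply heq_sym]]; clear H; whisk.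
Qed.

Definition eps_law_at {W : C} (x : Hom W (C0 A)) : Prop :=
  eps_law (K := el_bicat B W) (el_eps F x) (el_eps G x) (el_tau d_ta c_ta (el_unit x)).

Lemma pn_eps_law_at : pn_eps_law ta -> forall (W : C) (x : Hom W (C0 A)), eps_law_at x.
Proof.
intros H W x.
pose proof (comp2_heq H (heq_refl (idh x))) as E.
apply dc_ext, heq_eq; rewrite !comp_assoc.
eapply heq_trans; [apply heq_sym|eapply heq_trans; [exact E|]]; clear E H; whisk.
Qed.

Lemma pn_eps_law_universal : eps_law_at one -> pn_eps_law ta.
Proof.
intros H; apply (f_equal (@ce _ _ _ _ _ _ _ _ _ _ _)), eq_heq in H; rewrite !comp_assoc in H.
eapply heq_trans; [apply heq_sym, whisker_one|].
eapply heq_trans; [|apply whisker_one].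
eapply heq_trans; [|eapply heq_trans; [exact H|apply heq_sym]]; clear H; whisk.
Qed.

End TransformationLaws.

Lemma el_ext {C : TwoCategory} {B : PseudoCategory C} {W : C} {x y} (u v : El (B := B) (W := W) x y) :
  el u = el v -> u = v.
Proof.
destruct u as [u p q], v as [v p' q']; cbn; intros <-.
destruct (proof_irrelevance _ p p'), (proof_irrelevance _ q q'); reflexivity.
Qed.

Lemma gl_heq {C : TwoCategory} {B : PseudoCategory C} {W : C} {x y}
    {u v u' v' : GlCategory (B := B) (W := W) x y} {a : hom u v} {b : hom u' v'} :
  u = u' -> v = v' -> ce a ≈ ce b -> a ≈ b.
Proof. intros <- <- E; apply eq_heq, dc_ext, heq_eq, E. Qed.

(** * Identities and composites of pseudo-natural transformations *)

(** A pseudo-natural transformation can be given by cells at all generalised elements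
    that satisfy the axioms in the bicategories of elements and are the whiskerings of
    one 2-cell [ta].  The cell at the universal element is then invertible with the
    right boundary, and provides the structure. *)
Section MakePN.
Context {C : TwoCategory} {A B : PseudoCategory C} {F G : PseudoFunctor A B}.
Variables (t : Hom (C0 A) (C1 B)) (dt : d ∘ t = F0 F) (ct : c ∘ t = F0 G).
Variables (x y : Hom (C1 A) (C1 B)) (ta : hom x y).

Variable at_ : forall (W : C) (x : Hom W (C0 A)), El (B := B) (F0 G ∘ x) (F0 F ∘ x).
Variable tau_ : forall (W : C) (x y : Hom W (C0 A)) (f : El x y),
  @iso (GlCategory _ _) (el_tens (el_map G f) (at_ y)) (el_tens (at_ x) (el_map F f)).
Hypothesis at_eq : forall (W : C) (x : Hom W (C0 A)), t ∘ x = at_ x.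
Hypothesis tau_eq : forall (W : C) (x y : Hom W (C0 A)) (f : El x y),
  ta ▷ f ≈ ce (fwd (tau_ f)).
Hypothesis mu_ok : forall (W : C) (x y z : Hom W (C0 A)) (f : El x y) (g : El y z),
  mu_law (K := el_bicat B W) (el_mu F f g) (el_mu G f g) (tau_ f) (tau_ g) (tau_ (el_tens f g)).
Hypothesis eps_ok : forall (W : C) (x : Hom W (C0 A)),
  eps_law (K := el_bicat B W) (el_eps F x) (el_eps G x) (tau_ (el_unit x)).

Definition gl_iso_raw {W : C} {x y} {u v : GlCategory (B := B) (W := W) x y} (i : iso u v) :
  iso (el u) (el v) :=
  mkIso (fwd := ce (fwd i)) (inv := ce (inv i)) (f_equal (@ce _ _ _ _ _ _ _ _ _ _ _) (inv_fwd i))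
    (f_equal (@ce _ _ _ _ _ _ _ _ _ _ _) (fwd_inv i)).

Lemma make_dom : el (el_tens (el_map G (one_el (A := A))) (at_ d)) = tau_dom ct.
Proof. pose proof (at_eq d); mor_el. Qed.
Lemma make_cod : el (el_tens (at_ c) (el_map F (one_el (A := A)))) = tau_cod dt.
Proof. pose proof (at_eq c); mor_el. Qed.

Definition make_tau : iso (tau_dom ct) (tau_cod dt) :=
  iso_cast make_dom make_cod (gl_iso_raw (tau_ one_el)).

Lemma make_tau_heq : fwd make_tau ≈ ta.
Proof.
eapply heq_trans; [apply iso_cast_fwd|].
eapply heq_trans; [apply heq_sym, tau_eq|apply whisker_one].
Qed.

Lemma d_make_tau : d ◁ make_tau ≈ idh (d ∘ F1 F).
Proof.
eapply heq_trans; [apply comp2_heq; [constructor|apply iso_cast_fwd]|].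
eapply heq_trans; [apply (d_ce (fwd (tau_ one_el)))|apply idh_heq; mor].
Qed.
Lemma c_make_tau : c ◁ make_tau ≈ idh (c ∘ F1 G).
Proof.
eapply heq_trans; [apply comp2_heq; [constructor|apply iso_cast_fwd]|].
eapply heq_trans; [apply (c_ce (fwd (tau_ one_el)))|apply idh_heq; mor].
Qed.

Lemma make_at {W : C} (z : Hom W (C0 A)) : el_at dt ct z = at_ z.
Proof. apply el_ext, at_eq. Qed.

Lemma make_tau_at {W : C} {w z : Hom W (C0 A)} (f : El w z) :
  fwd (el_tau d_make_tau c_make_tau f) ≈ fwd (tau_ f).
Proof.
apply gl_heq; [rewrite make_at; reflexivity..|].
eapply heq_trans; [apply raw_tau_heq|].
eapply heq_trans; [|apply tau_eq].
apply comp2_heq; [apply make_tau_heq|constructor].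
Qed.

Definition make_pn : PN F G.
Proof.
refine (@mkPN C A B F G t dt ct make_tau d_make_tau c_make_tau _ _).
- abstract (apply pn_mu_law_universal;
    eapply (mu_law_heq (K := el_bicat B (P2 A))); [apply make_at..|
      apply make_tau_at|apply make_tau_at|apply make_tau_at|apply mu_ok]).
- abstract (apply (pn_eps_law_universal (d_ta := d_make_tau) (c_ta := c_make_tau));
    eapply (eps_law_heq (K := el_bicat B (C0 A))); [apply make_at|
      apply make_tau_at|apply eps_ok]).
Defined.
End MakePN.

Section PNs.
Context {C : TwoCategory} {A B : PseudoCategory C}.
Implicit Types F G H : PseudoFunctor A B.

Definition pn_at {F G} (T : PN F G) {W : C} (x : Hom W (C0 A)) :
  El (F0 G ∘ x) (F0 F ∘ x) := el_at (d_t T) (c_t T) x.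
Definition pn_tau {F G} (T : PN F G) {W : C} {x y : Hom W (C0 A)} (f : El x y) :
    @iso (GlCategory _ _) (el_tens (el_map G f) (pn_at T y))
      (el_tens (pn_at T x) (el_map F f)) :=
  el_tau (d_tau T) (c_tau T) f.

Lemma d_id_t F : d ∘ e ∘ F0 F = F0 F.
Proof. mor. Qed.
Lemma c_id_t F : c ∘ e ∘ F0 F = F0 F.
Proof. mor. Qed.

Lemma id_tau_whisker F {W : C} {x y : Hom W (C0 A)} (f : El x y) :
  id_tau F ▷ f ≈ ce (fwd (unitor_swap (K := el_bicat B W) (el_map F f))).
Proof.
eapply heq_trans; [apply whisker_whisker|].
eapply vcomp_whisker_gl.
- eapply heq_sym, raw_lun_inv_heq.
- apply heq_sym, (raw_run_heq (el_map F f)).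
Qed.

Definition id_pn F : PN F F.
Proof.
refine (make_pn (d_id_t F) (c_id_t F) (ta := id_tau F)
  (at_ := fun W x => el_unit (F0 F ∘ x))
  (tau_ := fun W x y f => unitor_swap (K := el_bicat B W) (el_map F f)) _ _ _ _).
- abstract (intros; apply comp1_assoc).
- abstract (intros; apply id_tau_whisker).
- abstract (intros; apply (unitor_swap_mu_law (K := el_bicat B W))).
- abstract (intros; apply (unitor_swap_eps_law (K := el_bicat B W))).
Defined.

Lemma d_vert_t {F G H} (S : PN G H) (T : PN F G) : d ∘ vert_t S T = F0 F.
Proof. unfold vert_t; mor. Qed.
Lemma c_vert_t {F G H} (S : PN G H) (T : PN F G) : c ∘ vert_t S T = F0 H.
Proof. unfold vert_t; mor. Qed.

Lemma vert_t_at {F G H} (S : PN G H) (T : PN F G) {W : C} (x : Hom W (C0 A)) :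
  vert_t S T ∘ x = el_tens (pn_at S x) (pn_at T x).
Proof. unfold vert_t; mor_el. Qed.

Lemma vert_tau_whisker {F G H} (S : PN G H) (T : PN F G) {W : C} {x y : Hom W (C0 A)}
    (f : El x y) :
  vert_tau S T ▷ f ≈ ce (fwd (vert (K := el_bicat B W) (pn_tau S f) (pn_tau T f))).
Proof.
unfold vert_tau, vert; cbn [fwd iso_comp inverse iso_tens iso_id inv]; rewrite !comp_assoc.
whisk.
Qed.

Definition vert_pn {F G H} (S : PN G H) (T : PN F G) : PN F H.
Proof.
refine (make_pn (d_vert_t S T) (c_vert_t S T) (ta := vert_tau S T)
  (at_ := fun W x => el_tens (pn_at S x) (pn_at T x))
  (tau_ := fun W x y f => vert (K := el_bicat B W) (pn_tau S f) (pn_tau T f)) _ _ _ _).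
- abstract (intros; apply vert_t_at).
- abstract (intros; apply vert_tau_whisker).
- abstract (intros; apply (vert_mu_law (K := el_bicat B W) (muG := el_mu G f g));
    apply pn_mu_law_at, pn_mu).
- abstract (intros; apply (vert_eps_law (K := el_bicat B W) (eG := el_eps G x));
    apply pn_eps_law_at, pn_eps).
Defined.

Lemma id_pn_tau F : fwd (tau (id_pn F)) ≈ id_tau F.
Proof. apply make_tau_heq; intros; apply id_tau_whisker. Qed.
Lemma vert_pn_tau {F G H} (S : PN G H) (T : PN F G) : fwd (tau (vert_pn S T)) ≈ vert_tau S T.
Proof. apply make_tau_heq; intros; apply vert_tau_whisker. Qed.

End PNs.

(** * Pseudo-modifications *)

Section Modifications.
Context {C : TwoCategory} {A B : PseudoCategory C}.
Implicit Types F G H K : PseudoFunctor A B.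

(** The axiom only has to be checked for cells of elements of [C1 A] that are
    heterogeneously equal to its constituents. *)
Lemma pm_law_intro {F G H K} {T : PN F G} {T' : PN H K} {th : NT F H} {th' : NT G K}
    {P : hom (t_ T) (t_ T')} {dP : d ◁ P ≈ th0 th} {cP : c ◁ P ≈ th0 th'}
    {x y z w x' y' z' w' : Hom (C1 A) (C0 B)}
    {p : hom x x'} {q : hom y y'} {r : hom z z'} {s : hom w w'}
    {gf : El x y} {ty : El y z} {tx : El x w} {ff : El w z}
    {gf' : El x' y'} {ty' : El y' z'} {tx' : El x' w'} {ff' : El w' z'}
    (a : DCell p q gf gf') (b : DCell q r ty ty') (a' : DCell p s tx tx') (b' : DCell s r ff ff')
    (k : hom (el (el_tens gf ty)) (el (el_tens tx ff)))
    (k' : hom (el (el_tens gf' ty')) (el (el_tens tx' ff'))) :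
  fwd (tau T) ≈ k -> fwd (tau T') ≈ k' -> th1 th' ≈ ce a -> P ▷ d ≈ ce b ->
  P ▷ c ≈ ce a' -> th1 th ≈ ce b' ->
  k' • ce (dc_tens a b) = ce (dc_tens a' b') • k -> pm_law dP cP.
Proof.
intros Hk Hk' Ha Hb Ha' Hb' E.
eapply heq_trans; [|eapply heq_trans; [exact (eq_heq E)|apply heq_sym]].
- apply vcomp_comp; [exact Hk'|apply comp2_heq; [constructor|apply pc2_heq; assumption]].
- apply vcomp_comp; [apply comp2_heq; [constructor|apply pc2_heq; assumption]|exact Hk].
Qed.

Section At.
Context {W : C}.
Implicit Types x y z : Hom W (C0 A).

Lemma bd_th1 {F G} (th : NT F G) {k : Hom (C1 A) (C0 A)} {l : Hom (C1 B) (C0 B)}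
    {x} {f : Hom W (C1 A)} :
  l ◁ th1 th ≈ th0 th ▷ k -> k ∘ f = x -> l ◁ (th1 th ▷ f) ≈ th0 th ▷ x.
Proof.
intros E <-; eapply heq_trans; [apply whisker_right, E|apply whisker_whisker].
Qed.

Definition el_th1 {F G} (th : NT F G) {x y} (f : El x y) :
    DCell (th0 th ▷ x) (th0 th ▷ y) (el_map F f) (el_map G f) :=
  @mkDC _ _ _ _ _ _ _ (th0 th ▷ x) (th0 th ▷ y) (el_map F f) (el_map G f) (th1 th ▷ f)
    (bd_th1 (c_th1 th) (c_el f)) (bd_th1 (d_th1 th) (d_el f)).

Definition el_Phi {F G H K} {T : PN F G} {T' : PN H K} {th : NT F H} {th' : NT G K}
    (P : PM T T' th th') x : DCell (th0 th' ▷ x) (th0 th ▷ x) (pn_at T x) (pn_at T' x) :=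
  @mkDC _ _ _ _ _ _ _ (th0 th' ▷ x) (th0 th ▷ x) (pn_at T x) (pn_at T' x) (Phi P ▷ x)
    (whisker_right _ (c_Phi P)) (whisker_right _ (d_Phi P)).

Lemma pm_law_at {F G H K} {T : PN F G} {T' : PN H K} {th : NT F H} {th' : NT G K}
    (P : PM T T' th th') {x y} (f : El x y) :
  ce (fwd (pn_tau T' f)) • ce (dc_tens (el_th1 th' f) (el_Phi P y))
  = ce (dc_tens (el_Phi P x) (el_th1 th f)) • ce (fwd (pn_tau T f)).
Proof.
pose proof (comp2_heq (pm_tau P) (heq_refl (idh (el f)))) as E.
apply heq_eq.
eapply heq_trans; [apply heq_sym|eapply heq_trans; [exact E|]]; clear E.
- apply vcomp_whisker_heq; [apply tau_whisker_heq1; reflexivity|].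
  apply tens_whisker_heq; [mor_el..|constructor|apply whisker_assoc_heq, d_el].
- apply vcomp_whisker_heq; [|apply tau_whisker_heq1; reflexivity].
  apply tens_whisker_heq; [mor_el..|apply whisker_assoc_heq, c_el|constructor].
Qed.

Lemma pn_at_id {F} x : pn_at (id_pn F) x = el_unit (F0 F ∘ x).
Proof. apply el_ext, comp1_assoc. Qed.
Lemma pn_at_vert {F G H} (S : PN G H) (T : PN F G) x :
  pn_at (vert_pn S T) x = el_tens (pn_at S x) (pn_at T x).
Proof. apply el_ext, vert_t_at. Qed.

Lemma pn_tau_heq {F G} (T : PN F G) {x y} (f : El x y) {u v : Hom (C1 A) (C1 B)}
    {ta : hom u v} : fwd (tau T) ≈ ta -> ce (fwd (pn_tau T f)) ≈ ta ▷ f.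
Proof.
intros E; eapply heq_trans; [apply raw_tau_heq|apply comp2_heq; [exact E|constructor]].
Qed.

Lemma pn_tau_id {F} {x y} (f : El x y) :
  fwd (pn_tau (id_pn F) f) ≈ fwd (unitor_swap (K := el_bicat B W) (el_map F f)).
Proof.
apply gl_heq; [rewrite pn_at_id; reflexivity..|].
eapply heq_trans; [apply pn_tau_heq, id_pn_tau|apply id_tau_whisker].
Qed.
Lemma pn_tau_vert {F G H} (S : PN G H) (T : PN F G) {x y} (f : El x y) :
  fwd (pn_tau (vert_pn S T) f)
  ≈ fwd (vert (K := el_bicat B W) (pn_tau S f) (pn_tau T f)).
Proof.
apply gl_heq; [rewrite pn_at_vert; reflexivity..|].
eapply heq_trans; [apply pn_tau_heq, vert_pn_tau|apply vert_tau_whisker].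
Qed.
End At.

Lemma tau_at_one {F G} (T : PN F G) : fwd (tau T) ≈ ce (fwd (pn_tau T one_el)).
Proof.
eapply heq_trans; [|apply heq_sym, pn_tau_heq; constructor].
apply heq_sym, whisker_one.
Qed.

Lemma id_pm_law {F G} (th : NT F G) :
  pm_law (T := id_pn F) (T' := id_pn G) (th := th) (th' := th) (Phi := e ◁ th0 th)
    (d_unit2 (th0 th)) (c_unit2 (th0 th)).
Proof.
eapply (pm_law_intro (a := el_th1 th one_el) (b := dc_unit (th0 th ▷ d))
  (a' := dc_unit (th0 th ▷ c)) (b' := el_th1 th one_el)).
- eapply heq_trans; [apply heq_sym, whisker_one|].
  eapply heq_trans; [|apply (id_tau_whisker F one_el)].
  apply comp2_heq; [apply id_pn_tau|constructor].
- eapply heq_trans; [apply heq_sym, whisker_one|].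
  eapply heq_trans; [|apply (id_tau_whisker G one_el)].
  apply comp2_heq; [apply id_pn_tau|constructor].
- apply heq_sym, whisker_one.
- apply comp2_assoc.
- apply comp2_assoc.
- apply heq_sym, whisker_one.
- set (u := el_map F one_el); set (v := el_map G one_el); set (a := el_th1 th one_el).
  change (ce (fwd (unitor_swap (K := el_bicat B (C1 A)) u)))
    with (ce (inv (el_lun u)) • ce (fwd (el_run u))).
  change (ce (fwd (unitor_swap (K := el_bicat B (C1 A)) v)))
    with (ce (inv (el_lun v)) • ce (fwd (el_run v))).
  pose proof (iso_flip (i := gl_iso_raw (el_lun u)) (j := gl_iso_raw (el_lun v))
    (eq_sym (el_lun_nat a))) as L.
  eapply eq_trans; [apply eq_sym, comp_assoc|].
  eapply eq_trans; [apply (f_equal (comp _)), (el_run_nat a)|].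
  eapply eq_trans; [apply comp_assoc|eapply eq_trans; [|apply eq_sym, comp_assoc]].
  apply (f_equal (fun z => comp z _)), L.
Qed.

Definition id_pm {F G} (th : NT F G) : PM (id_pn F) (id_pn G) th th := mkPM (id_pm_law th).

Lemma tens_square {W : C} {x y z x' y' z' x1 y1 z1 x2 y2 z2 : Hom W (C0 B)}
    {f : hom x x1} {g : hom y y1} {h : hom z z1} {f' : hom x1 x'} {g' : hom y1 y'}
    {h' : hom z1 z'} {k : hom x x2} {l : hom y y2} {n : hom z z2} {k' : hom x2 x'}
    {l' : hom y2 y'} {n' : hom z2 z'}
    {u : El x y} {v : El y z} {u1 : El x1 y1} {v1 : El y1 z1} {u2 : El x2 y2} {v2 : El y2 z2}
    {u' : El x' y'} {v' : El y' z'}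
    {p : DCell f g u u1} {r : DCell g h v v1} {a' : DCell f' g' u1 u'} {b' : DCell g' h' v1 v'}
    {a : DCell k l u u2} {b : DCell l n v v2} {q : DCell k' l' u2 u'} {s : DCell l' n' v2 v'} :
  ce a' • ce p = ce q • ce a -> ce b' • ce r = ce s • ce b ->
  ce (dc_tens a' b') • ce (dc_tens p r) = ce (dc_tens q s) • ce (dc_tens a b).
Proof.
intros E1 E2; rewrite <- !dc_tens_comp; apply dc_tens_ext; assumption.
Qed.

(** The composite of five cells defining [vert] is crossed one cell at a time: three
    squares are naturality squares of the associator, and the other two are the
    hypotheses tensored with an identity square. *)
Lemma vert_square {W : C} {x y z w s t x' y' z' w' s' t' : Hom W (C0 B)}
    {fx : hom x x'} {fy : hom y y'} {fz : hom z z'} {fw : hom w w'} {fs : hom s s'}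
    {ft : hom t t'}
    {sx : El x y} {sy : El w z} {tx : El y s} {ty : El z t} {hf : El x w} {gf : El y z}
    {ff : El s t}
    {sx' : El x' y'} {sy' : El w' z'} {tx' : El y' s'} {ty' : El z' t'} {hf' : El x' w'}
    {gf' : El y' z'} {ff' : El s' t'}
    {sf : @iso (GlCategory x z) (el_tens hf sy) (el_tens sx gf)}
    {sf' : @iso (GlCategory x' z') (el_tens hf' sy') (el_tens sx' gf')}
    {tf : @iso (GlCategory y t) (el_tens gf ty) (el_tens tx ff)}
    {tf' : @iso (GlCategory y' t') (el_tens gf' ty') (el_tens tx' ff')}
    {h : DCell fx fw hf hf'} {g : DCell fy fz gf gf'} {f : DCell fs ft ff ff'}
    {px : DCell fx fy sx sx'} {py : DCell fw fz sy sy'} {qx : DCell fy fs tx tx'}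
    {qy : DCell fz ft ty ty'} :
  ce (fwd sf') • ce (dc_tens h py) = ce (dc_tens px g) • ce (fwd sf) ->
  ce (fwd tf') • ce (dc_tens g qy) = ce (dc_tens qx f) • ce (fwd tf) ->
  ce (fwd (vert (K := el_bicat B W) sf' tf')) • ce (dc_tens h (dc_tens py qy))
  = ce (dc_tens (dc_tens px qx) f) • ce (fwd (vert (K := el_bicat B W) sf tf)).
Proof.
intros ES ET.
pose proof (el_asc_nat px qx f) as N3; pose proof (el_asc_nat h py qy) as N1.
pose proof (iso_flip (i := gl_iso_raw (el_asc sx gf ty)) (j := gl_iso_raw (el_asc sx' gf' ty'))
  (eq_sym (el_asc_nat px g qy))) as N2; cbn [fwd inv gl_iso_raw] in N2.
assert (ES' : ce (dc_tens (fwd sf') (idh (ty' : GlCategory z' t')))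
    • ce (dc_tens (dc_tens h py) qy)
  = ce (dc_tens (dc_tens px g) qy) • ce (dc_tens (fwd sf) (idh (ty : GlCategory z t)))).
{ apply tens_square; [exact ES|cbn; rewrite comp_idl, comp_idr; reflexivity]. }
assert (ET' : ce (dc_tens (idh (sx' : GlCategory x' y')) (fwd tf'))
    • ce (dc_tens px (dc_tens g qy))
  = ce (dc_tens px (dc_tens qx f)) • ce (dc_tens (idh (sx : GlCategory x y)) (fwd tf))).
{ apply tens_square; [cbn; rewrite comp_idl, comp_idr; reflexivity|exact ET]. }
change (ce (fwd (vert (K := el_bicat B W) sf' tf'))) with
  (ce (fwd (el_asc sx' tx' ff')) • ce (dc_tens (idh (sx' : GlCategory x' y')) (fwd tf'))
   • ce (inv (el_asc sx' gf' ty')) • ce (dc_tens (fwd sf') (idh (ty' : GlCategory z' t')))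
   • ce (fwd (el_asc hf' sy' ty'))).
change (ce (fwd (vert (K := el_bicat B W) sf tf))) with
  (ce (fwd (el_asc sx tx ff)) • ce (dc_tens (idh (sx : GlCategory x y)) (fwd tf))
   • ce (inv (el_asc sx gf ty)) • ce (dc_tens (fwd sf) (idh (ty : GlCategory z t)))
   • ce (fwd (el_asc hf sy ty))).
rewrite <- !comp_assoc, N1, (comp_cut ES').
rewrite <- !comp_assoc, (comp_cut N2), <- !comp_assoc, (comp_cut ET').
rewrite <- !comp_assoc, (comp_cut N3), <- !comp_assoc; reflexivity.
Qed.

Lemma vert_pm_law {F G H F' G' H'} {S : PN G H} {T : PN F G} {S' : PN G' H'}
    {T' : PN F' G'} {th : NT F F'} {th' : NT G G'} {th'' : NT H H'}
    (Q : PM S S' th' th'') (P : PM T T' th th') dP cP :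
  pm_law (T := vert_pn S T) (T' := vert_pn S' T') (th := th) (th' := th'')
    (Phi := vert_Phi Q P) dP cP.
Proof.
assert (EP : forall x : Hom (C1 A) (C0 A), vert_Phi Q P ▷ x ≈ ce (dc_tens (el_Phi Q x) (el_Phi P x))).
{ intros; apply tens_whisker_heq; [mor_el..|constructor|constructor]. }
eapply (pm_law_intro (a := el_th1 th'' one_el) (b := dc_tens (el_Phi Q d) (el_Phi P d))
  (a' := dc_tens (el_Phi Q c) (el_Phi P c)) (b' := el_th1 th one_el)).
- eapply heq_trans; [apply heq_sym, whisker_one|].
  eapply heq_trans; [|apply (vert_tau_whisker S T one_el)].
  apply comp2_heq; [apply vert_pn_tau|constructor].
- eapply heq_trans; [apply heq_sym, whisker_one|].
  eapply heq_trans; [|apply (vert_tau_whisker S' T' one_el)].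
  apply comp2_heq; [apply vert_pn_tau|constructor].
- apply heq_sym, whisker_one.
- apply EP.
- apply EP.
- apply heq_sym, whisker_one.
- apply (vert_square (g := el_th1 th' one_el)); apply pm_law_at.
Qed.

Lemma d_vert_Phi {F G H F' G' H'} {S : PN G H} {T : PN F G} {S' : PN G' H'}
    {T' : PN F' G'} {th : NT F F'} {th' : NT G G'} {th'' : NT H H'}
    (Q : PM S S' th' th'') (P : PM T T' th th') : d ◁ vert_Phi Q P ≈ th0 th.
Proof. eapply heq_trans; [apply d_m_pc2|apply d_Phi]. Qed.
Lemma c_vert_Phi {F G H F' G' H'} {S : PN G H} {T : PN F G} {S' : PN G' H'}
    {T' : PN F' G'} {th : NT F F'} {th' : NT G G'} {th'' : NT H H'}
    (Q : PM S S' th' th'') (P : PM T T' th th') : c ◁ vert_Phi Q P ≈ th0 th''.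
Proof. eapply heq_trans; [apply c_m_pc2|apply c_Phi]. Qed.

Definition vert_pm {F G H F' G' H'} {S : PN G H} {T : PN F G} {S' : PN G' H'}
    {T' : PN F' G'} {th : NT F F'} {th' : NT G G'} {th'' : NT H H'}
    (Q : PM S S' th' th'') (P : PM T T' th th') : PM (vert_pn S T) (vert_pn S' T') th th'' :=
  mkPM (T := vert_pn S T) (T' := vert_pn S' T')
    (vert_pm_law (d_vert_Phi Q P) (c_vert_Phi Q P)).

(** An invertible 2-cell with identity boundary that satisfies [mod_law] at the
    universal element is an invertible pseudo-modification; the law for the inverse
    follows by [mod_law_inv]. *)
Section Globular.
Context {F G : PseudoFunctor A B} {T T' : PN F G} (i : iso (t_ T) (t_ T'))
  (di : d ◁ i ≈ idh (F0 F)) (ci : c ◁ i ≈ idh (F0 G)).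

Section At.
Context {W : C} (x : Hom W (C0 A)).
Lemma c_iso_at : c ◁ iso_whr i x ≈ idh (F0 G ∘ x).
Proof. apply (whisker_bd (heq_refl (i ▷ x)) ci); reflexivity. Qed.
Lemma d_iso_at : d ◁ iso_whr i x ≈ idh (F0 F ∘ x).
Proof. apply (whisker_bd (heq_refl (i ▷ x)) di); reflexivity. Qed.
Definition iso_at : @iso (GlCategory _ _) (pn_at T x) (pn_at T' x) :=
  gl_iso (u := pn_at T x) (v := pn_at T' x) c_iso_at d_iso_at.
End At.

Hypothesis law : mod_law (K := el_bicat B (C1 A)) (pn_tau T one_el) (pn_tau T' one_el)
  (fwd (iso_at c)) (fwd (iso_at d)).

Lemma gl_fwd_law : pm_law (th := nt_id F) (th' := nt_id G) (Phi := fwd i) di ci.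
Proof.
apply (f_equal (@ce _ _ _ _ _ _ _ _ _ _ _)) in law.
eapply (pm_law_intro (a := idh (el_map G one_el : GlCategory _ _)) (b := fwd (iso_at d))
  (a' := fwd (iso_at c)) (b' := idh (el_map F one_el : GlCategory _ _)));
  [apply tau_at_one|apply tau_at_one|..|exact law];
  first [constructor | apply idh_heq, eq_sym, comp1_oner].
Qed.

Lemma gl_inv_law : pm_law (T := T') (T' := T) (th := nt_id F) (th' := nt_id G)
  (Phi := inv i) (whisker_inv di) (whisker_inv ci).
Proof.
apply (mod_law_inv (K := el_bicat B (C1 A))), (f_equal (@ce _ _ _ _ _ _ _ _ _ _ _)) in law.
eapply (pm_law_intro (a := idh (el_map G one_el : GlCategory _ _)) (b := inv (iso_at d))
  (a' := inv (iso_at c)) (b' := idh (el_map F one_el : GlCategory _ _)));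
  [apply tau_at_one|apply tau_at_one|..|exact law];
  first [constructor | apply idh_heq, eq_sym, comp1_oner].
Qed.

Definition gl_fwd : PM T T' (nt_id F) (nt_id G) := mkPM gl_fwd_law.
Definition gl_inv : PM T' T (nt_id F) (nt_id G) := mkPM gl_inv_law.
End Globular.

Section Associativity.
Context {F G H K : PseudoFunctor A B} (U : PN H K) (T : PN G H) (S : PN F G).

Lemma asc_Phi_dom : assoc_dom B ∘ pr3 (eq_trans (d_t U) (eq_sym (c_t T)))
  (eq_trans (d_t T) (eq_sym (c_t S))) = t_ (vert_pn U (vert_pn T S)).
Proof. do 2 (cbn; unfold vert_t); mor. Qed.
Lemma asc_Phi_cod : assoc_cod B ∘ pr3 (eq_trans (d_t U) (eq_sym (c_t T)))
  (eq_trans (d_t T) (eq_sym (c_t S))) = t_ (vert_pn (vert_pn U T) S).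
Proof. do 2 (cbn; unfold vert_t); mor. Qed.

Definition asc_Phi : iso (t_ (vert_pn U (vert_pn T S))) (t_ (vert_pn (vert_pn U T) S)) :=
  iso_cast asc_Phi_dom asc_Phi_cod (iso_whr (alpha B) _).

Lemma asc_Phi_heq : fwd asc_Phi ≈ assoc_Phi U T S.
Proof.
eapply heq_trans; [apply iso_cast_fwd|].
apply whisker_eq, P3_ext; mor.
Qed.

Lemma d_asc_Phi : d ◁ asc_Phi ≈ idh (F0 F).
Proof. apply (whisker_bd asc_Phi_heq (d_alpha B)); mor. Qed.
Lemma c_asc_Phi : c ◁ asc_Phi ≈ idh (F0 K).
Proof. apply (whisker_bd asc_Phi_heq (c_alpha B)); mor. Qed.

Lemma asc_iso_at {W : C} (x : Hom W (C0 A)) :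
  fwd (iso_at d_asc_Phi c_asc_Phi x) ≈ fwd (el_asc (pn_at U x) (pn_at T x) (pn_at S x)).
Proof.
apply gl_heq; [rewrite !pn_at_vert; reflexivity..|].
eapply heq_trans; [apply comp2_heq; [apply asc_Phi_heq|constructor]|].
apply asc_whisker_heq; mor_el.
Qed.

Lemma asc_pm_law : mod_law (K := el_bicat B (C1 A))
  (pn_tau (vert_pn U (vert_pn T S)) one_el) (pn_tau (vert_pn (vert_pn U T) S) one_el)
  (fwd (iso_at d_asc_Phi c_asc_Phi c)) (fwd (iso_at d_asc_Phi c_asc_Phi d)).
Proof.
eapply (mod_law_heq (K := el_bicat B (C1 A)));
  [rewrite !pn_at_vert; reflexivity..| | |apply asc_iso_at|apply asc_iso_at|].
- eapply heq_trans; [apply pn_tau_vert|].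
  eapply (vert_heq (K := el_bicat B (C1 A))); [rewrite ?pn_at_vert; reflexivity..| |].
  + constructor.
  + apply pn_tau_vert.
- eapply heq_trans; [apply pn_tau_vert|].
  eapply (vert_heq (K := el_bicat B (C1 A))); [rewrite ?pn_at_vert; reflexivity..| |].
  + apply pn_tau_vert.
  + constructor.
- apply (asc_mod_law (K := el_bicat B (C1 A))).
Qed.
End Associativity.

Section Units.
Context {F G : PseudoFunctor A B} (T : PN F G).

Lemma lun_Phi_dom : lunit_dom B ∘ t_ T = t_ (vert_pn (id_pn G) T).
Proof. do 2 (cbn; unfold vert_t); mor. Qed.
Lemma run_Phi_dom : runit_dom B ∘ t_ T = t_ (vert_pn T (id_pn F)).
Proof. do 2 (cbn; unfold vert_t); mor. Qed.

Definition lun_Phi : iso (t_ (vert_pn (id_pn G) T)) (t_ T) :=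
  iso_cast lun_Phi_dom (comp1_onel (t_ T)) (iso_whr (lam B) (t_ T)).
Definition run_Phi : iso (t_ (vert_pn T (id_pn F))) (t_ T) :=
  iso_cast run_Phi_dom (comp1_onel (t_ T)) (iso_whr (rho B) (t_ T)).

Lemma lun_Phi_heq : fwd lun_Phi ≈ lam B ▷ t_ T.
Proof. apply iso_cast_fwd. Qed.
Lemma run_Phi_heq : fwd run_Phi ≈ rho B ▷ t_ T.
Proof. apply iso_cast_fwd. Qed.

Lemma d_lun_Phi : d ◁ lun_Phi ≈ idh (F0 F).
Proof. apply (whisker_bd lun_Phi_heq (d_lam B)), d_t. Qed.
Lemma c_lun_Phi : c ◁ lun_Phi ≈ idh (F0 G).
Proof. apply (whisker_bd lun_Phi_heq (c_lam B)), c_t. Qed.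
Lemma d_run_Phi : d ◁ run_Phi ≈ idh (F0 F).
Proof. apply (whisker_bd run_Phi_heq (d_rho B)), d_t. Qed.
Lemma c_run_Phi : c ◁ run_Phi ≈ idh (F0 G).
Proof. apply (whisker_bd run_Phi_heq (c_rho B)), c_t. Qed.

Lemma lun_iso_at {W : C} (x : Hom W (C0 A)) :
  fwd (iso_at d_lun_Phi c_lun_Phi x) ≈ fwd (el_lun (pn_at T x)).
Proof.
apply gl_heq; [rewrite pn_at_vert, pn_at_id; reflexivity|reflexivity|].
eapply heq_trans; [apply comp2_heq; [apply lun_Phi_heq|constructor]|].
apply lun_whisker_heq; reflexivity.
Qed.
Lemma run_iso_at {W : C} (x : Hom W (C0 A)) :
  fwd (iso_at d_run_Phi c_run_Phi x) ≈ fwd (el_run (pn_at T x)).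
Proof.
apply gl_heq; [rewrite pn_at_vert, pn_at_id; reflexivity|reflexivity|].
eapply heq_trans; [apply comp2_heq; [apply run_Phi_heq|constructor]|].
apply run_whisker_heq; reflexivity.
Qed.

Lemma lun_pm_law : mod_law (K := el_bicat B (C1 A))
  (pn_tau (vert_pn (id_pn G) T) one_el) (pn_tau T one_el)
  (fwd (iso_at d_lun_Phi c_lun_Phi c)) (fwd (iso_at d_lun_Phi c_lun_Phi d)).
Proof.
eapply (mod_law_heq (K := el_bicat B (C1 A)));
  [rewrite ?pn_at_vert, ?pn_at_id; reflexivity..| |constructor
  |apply lun_iso_at|apply lun_iso_at|].
- eapply heq_trans; [apply pn_tau_vert|].
  eapply (vert_heq (K := el_bicat B (C1 A))); [rewrite ?pn_at_id; reflexivity..| |].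
  + apply pn_tau_id.
  + constructor.
- apply (lun_mod_law (K := el_bicat B (C1 A))).
Qed.

Lemma run_pm_law : mod_law (K := el_bicat B (C1 A))
  (pn_tau (vert_pn T (id_pn F)) one_el) (pn_tau T one_el)
  (fwd (iso_at d_run_Phi c_run_Phi c)) (fwd (iso_at d_run_Phi c_run_Phi d)).
Proof.
eapply (mod_law_heq (K := el_bicat B (C1 A)));
  [rewrite ?pn_at_vert, ?pn_at_id; reflexivity..| |constructor
  |apply run_iso_at|apply run_iso_at|].
- eapply heq_trans; [apply pn_tau_vert|].
  eapply (vert_heq (K := el_bicat B (C1 A))); [rewrite ?pn_at_id; reflexivity..| |].
  + constructor.
  + apply pn_tau_id.
- apply (run_mod_law (K := el_bicat B (C1 A))).
Qed.
End Units.

End Modifications.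

#[local] Transparent pi1_2 pi2_2 pi1_3 pi2_3 pi3_3 pi1_4 pi2_4 pi3_4 pi4_4 pr2 pr3 pr4 e m.

(** * The functors [e] and [m] *)

Section Functors.
Context {C : TwoCategory} (A B : PseudoCategory C).
Notation X0 := (PsFunctors (A := A) (B := B)).
Notation X1 := (PsTransformations (A := A) (B := B)).

Definition ps_e : Functor X0 X1.
Proof.
refine (@mkFunctor X0 X1 (fun F => mkPNObj (id_pn F))
  (fun F G th => mkPNHom (T := mkPNObj (id_pn F)) (T' := mkPNObj (id_pn G)) (id_pm th)) _ _).
- abstract (intros; apply pnhom_ext; [reflexivity..|apply comp2_id]).
- abstract (intros; apply pnhom_ext; [reflexivity..|apply whisker_comp]).
Defined.

(** In a string of transformations, the source of the first and the target of the
    second are equal without being convertible. *)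
Definition tgt_cast {F G G' : PseudoFunctor A B} (p : G' = G) (T : PN F G) : PN F G' :=
  eq_rect G (fun G => PN F G) T G' (eq_sym p).

Definition ps_m_obj (x : PsStrings2 A B) : X1 :=
  @mkPNObj C A B (src (pb_snd x)) (tgt (pb_fst x))
    (vert_pn (pn (pb_fst x)) (tgt_cast (pb_eq x) (pn (pb_snd x)))).

Definition vert_pm_eq {F G H F' G' H' : PseudoFunctor A B} {S : PN G H} {T : PN F G}
    {S' : PN G' H'} {T' : PN F' G'} {th : NT F F'} {th' th1' : NT G G'} {th'' : NT H H'}
    (Q : PM S S' th' th'') (P : PM T T' th th1') (E : th' = th1') :
    PM (vert_pn S T) (vert_pn S' T') th th'' :=
  vert_pm Q (eq_rect th1' (fun z => PM T T' th z) P th' (eq_sym E)).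

Definition ps_m_pm (x y : PsStrings2 A B) (P : hom x y) :
  PM (pn (ps_m_obj x)) (pn (ps_m_obj y)) (dom_ (pbh_snd P)) (cod_ (pbh_fst P)).
Proof.
destruct x as [[G H S] [F G1 T] p], y as [[G' H' S'] [F' G1' T'] p'].
cbn in p, p'; destruct p, p'.
exact (vert_pm_eq (pm (pbh_fst P)) (pm (pbh_snd P)) (heq_eq (pbh_eq P))).
Defined.

Definition ps_m_hom (x y : PsStrings2 A B) (P : hom x y) : hom (ps_m_obj x) (ps_m_obj y) :=
  mkPNHom (T := ps_m_obj x) (T' := ps_m_obj y) (ps_m_pm P).

(** [ps_m_t] and [ps_m_Phi] describe the tensor product of strings whatever the
    proof of composability may be. *)
Lemma ps_m_t (x : PsStrings2 A B) (u v : Hom (C0 A) (C1 B)) (q : d ∘ u = c ∘ v) :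
  t_ (pb_fst x) = u -> t_ (pb_snd x) = v -> t_ (ps_m_obj x) = m ∘ pr2 q.
Proof.
destruct x as [[G H S] [F G1 T] p]; cbn in p; destruct p; cbn; intros <- <-.
unfold vert_t; do 2 f_equal; apply proof_irrelevance.
Qed.

Lemma vert_pm_eq_Phi {F G H F' G' H' : PseudoFunctor A B} {S : PN G H} {T : PN F G}
    {S' : PN G' H'} {T' : PN F' G'} {th : NT F F'} {th' th1' : NT G G'} {th'' : NT H H'}
    (Q : PM S S' th' th'') (P : PM T T' th th1') (E : th' = th1')
    {u u' v v' : Hom (C0 A) (C1 B)} {a : hom u u'} {b : hom v v'} q q' r :
  Phi Q ≈ a -> Phi P ≈ b -> Phi (vert_pm_eq Q P E) ≈ m ◁ pc2 (a := a) (b := b) q q' r.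
Proof.
destruct E; cbn; intros Ha Hb; apply comp2_heq; [constructor|apply pc2_heq; assumption].
Qed.

Lemma ps_m_Phi (x y : PsStrings2 A B) (P : hom x y) {u u' v v' : Hom (C0 A) (C1 B)}
    {a : hom u u'} {b : hom v v'} q q' r :
  Phi (pbh_fst P) ≈ a -> Phi (pbh_snd P) ≈ b ->
  Phi (ps_m_hom P) ≈ m ◁ pc2 (a := a) (b := b) q q' r.
Proof.
destruct x as [[G H S] [F G1 T] p], y as [[G' H' S'] [F' G1' T'] p'].
cbn in p, p'; destruct p, p'; apply vert_pm_eq_Phi.
Qed.

Lemma string_composable (x : PsStrings2 A B) : d ∘ t_ (pb_fst x) = c ∘ t_ (pb_snd x).
Proof. rewrite d_t, c_t; f_equal; exact (pb_eq x). Qed.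

Lemma string_composable2 (x y : PsStrings2 A B) (P : hom x y) :
  d ◁ Phi (pbh_fst P) ≈ c ◁ Phi (pbh_snd P).
Proof.
eapply heq_trans; [apply d_Phi|]; eapply heq_trans; [|apply heq_sym, c_Phi].
pose proof (pbh_eq P) as E; cbn in E; destruct E; constructor.
Qed.

Definition ps_m : Functor (PsStrings2 A B) X1.
Proof.
refine (@mkFunctor (PsStrings2 A B) X1 ps_m_obj ps_m_hom _ _).
- abstract (intros x; apply pnhom_ext; [reflexivity..|]; apply heq_eq;
    eapply heq_trans; [apply (ps_m_Phi (P := idh x)
      (a := idh (t_ (pb_fst x))) (b := idh (t_ (pb_snd x)))
      (string_composable x) (string_composable x) (string_composable2 (idh x))); constructor|];
    rewrite pc2_id, comp2_id; apply idh_heq; symmetry; apply ps_m_t; reflexivity).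
- abstract (intros x y z Q P; apply pnhom_ext; [reflexivity..|]; apply heq_eq;
    eapply heq_trans; [apply (ps_m_Phi (P := comp Q P)
      (a := Phi (pbh_fst Q) • Phi (pbh_fst P)) (b := Phi (pbh_snd Q) • Phi (pbh_snd P))
      (string_composable x) (string_composable z) (string_composable2 (comp Q P)));
      constructor|];
    rewrite (pc2_comp (string_composable x) (string_composable y) (string_composable z)
      (string_composable2 P) (string_composable2 Q)), whisker_comp;
    apply comp_heq; apply heq_sym, ps_m_Phi; constructor).
Defined.

Definition ps_mult : Mult (PsGraph A B).
Proof.
refine (@mkMult Cat (PsGraph A B) ps_e ps_m _ _ _ _);
  abstract (apply functor_ext; intros; constructor).
Defined.

Definition ps_base : Base Cat := mkBase ps_mult.
End Functors.

(** * The constraints *)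

Section Constraints.
Context {C : TwoCategory} {A B : PseudoCategory C}.
Notation X0 := (PsFunctors (A := A) (B := B)).
Notation X1 := (PsTransformations (A := A) (B := B)).
Implicit Types F G H K L : PseudoFunctor A B.

Definition nat_iso {K L : Category} {F G : Functor K L} (i : forall x, iso (F x) (G x))
    (E : forall x y (f : hom x y), fwd (i y) • fmap F f = fmap G f • fwd (i x)) :
    @iso (FunctorCategory K L) F G.
Proof.
refine (@mkIso (FunctorCategory K L) F G (mkNatTrans E)
  (@mkNatTrans K L G F (fun x => inv (i x)) (fun x y f => iso_flip (eq_sym (E x y f)))) _ _).
- abstract (apply nattrans_ext; intros; apply inv_fwd).
- abstract (apply nattrans_ext; intros; apply fwd_inv).
Defined.

Definition ps_gl_iso {F G} {T T' : PN F G} (i : iso (t_ T) (t_ T'))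
    (di : d ◁ i ≈ idh (F0 F)) (ci : c ◁ i ≈ idh (F0 G))
    (law : mod_law (K := el_bicat B (C1 A)) (pn_tau T one_el) (pn_tau T' one_el)
      (fwd (iso_at di ci c)) (fwd (iso_at di ci d))) :
    @iso X1 (mkPNObj T) (mkPNObj T').
Proof.
refine (@mkIso X1 (mkPNObj T) (mkPNObj T')
  (mkPNHom (T := mkPNObj T) (T' := mkPNObj T') (gl_fwd law))
  (mkPNHom (T := mkPNObj T') (T' := mkPNObj T) (gl_inv law)) _ _).
- abstract (apply pnhom_ext; [exact (comp_idl (idh (F : X0)))
    |exact (comp_idl (idh (G : X0)))|apply inv_fwd]).
- abstract (apply pnhom_ext; [exact (comp_idl (idh (F : X0)))
    |exact (comp_idl (idh (G : X0)))|apply fwd_inv]).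
Defined.

Lemma is_pm_heq {T T' T1 T1' : X1} {P : hom T T'} {P1 : hom T1 T1'} {F F'} {th : NT F F'}
    {G G'} {th' : NT G G'} {t t' : Hom (C0 A) (C1 B)} {Ph : hom t t'} :
  P1 ≈ P -> is_pm P th th' Ph -> is_pm P1 th th' Ph.
Proof. intros []; exact (fun E => E). Qed.

Lemma is_pm_Phi_heq {T T' : X1} {P : hom T T'} {F F'} {th : NT F F'}
    {G G'} {th' : NT G G'} {t t' u u' : Hom (C0 A) (C1 B)} {Ph : hom t t'} {Ph' : hom u u'} :
  Ph ≈ Ph' -> is_pm P th th' Ph -> is_pm P th th' Ph'.
Proof. intros []; exact (fun E => E). Qed.

(** Naturality of the constraints and the coherence laws go through this lemma: the
    boundaries of both sides agree, and the underlying 2-cells are compared as cells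
    of elements at [C0 A]. *)
Lemma is_pm_unique {T T' T1 T1' : X1} {P : hom T T'} {P1 : hom T1 T1'} {F F'} {th : NT F F'}
    {G G'} {th' : NT G G'} {t t' u u' : Hom (C0 A) (C1 B)} {Ph : hom t t'} {Ph' : hom u u'} :
  T = T1 -> T' = T1' -> Ph ≈ Ph' -> is_pm P th th' Ph -> is_pm P1 th th' Ph' -> P ≈ P1.
Proof.
intros <- <- E [D [K L]] [D1 [K1 L1]]; apply eq_heq, pnhom_ext.
- exact (heq_eq (heq_trans D (heq_sym D1))).
- exact (heq_eq (heq_trans K (heq_sym K1))).
- apply heq_eq; exact (heq_trans L (heq_trans E (heq_sym L1))).
Qed.

Lemma is_pm_self {T T' : X1} (P : hom T T') : is_pm P (dom_ P) (cod_ P) (Phi P).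
Proof. repeat split; constructor. Qed.

Lemma is_pm_comp {T T' T'' : X1} {Q : hom T' T''} {P : hom T T'} {F F' F''} {th : NT F F'}
    {th1 : NT F' F''} {G G' G''} {th' : NT G G'} {th1' : NT G' G''}
    {t t' t'' : Hom (C0 A) (C1 B)} {Ph : hom t t'} {Ph1 : hom t' t''} :
  is_pm Q th1 th1' Ph1 -> is_pm P th th' Ph ->
  is_pm (Q • P) (nt_comp th1 th) (nt_comp th1' th') (Ph1 • Ph).
Proof.
intros [D [K L]] [D1 [K1 L1]]; repeat split.
- exact (comp_heq D D1).
- exact (comp_heq K K1).
- exact (comp_heq L L1).
Qed.

Lemma is_pm_gl_comp {T T' T'' : X1} {Q : hom T' T''} {P : hom T T'} {F G}
    {t t' t'' : Hom (C0 A) (C1 B)} {Ph : hom t t'} {Ph1 : hom t' t''} :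
  is_pm Q (nt_id F) (nt_id G) Ph1 -> is_pm P (nt_id F) (nt_id G) Ph ->
  is_pm (Q • P) (nt_id F) (nt_id G) (Ph1 • Ph).
Proof.
intros HQ HP; pose proof (is_pm_comp HQ HP) as E.
rewrite (comp_idl (idh (F : X0)) : nt_comp (nt_id F) (nt_id F) = nt_id F),
  (comp_idl (idh (G : X0)) : nt_comp (nt_id G) (nt_id G) = nt_id G) in E; exact E.
Qed.

Lemma is_pm_tens {x y : PsStrings2 A B} {P : hom x y} {F F' G G' H H'}
    {th : NT F F'} {th' : NT G G'} {th'' : NT H H'}
    {u u' v v' : Hom (C0 A) (C1 B)} {a : hom u u'} {b : hom v v'} {q q' r} :
  is_pm (pbh_fst P) th' th'' a -> is_pm (pbh_snd P) th th' b ->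
  is_pm (ps_m_hom P) th th'' (m ◁ pc2 (a := a) (b := b) q q' r).
Proof.
intros [D [K L]] [D1 [K1 L1]]; repeat split; [exact D1|exact K|].
apply ps_m_Phi; assumption.
Qed.

(** A transformation and a pseudo-modification as elements of [B] at [C0 A]. *)
Definition pn_el {F G} (T : PN F G) : El (F0 G) (F0 F) := mkEl (c_t T) (d_t T).
Definition pm_el {F G F' G'} {T : PN F G} {T' : PN F' G'} {th : NT F F'} {th' : NT G G'}
    (P : PM T T' th th') : DCell (th0 th') (th0 th) (pn_el T) (pn_el T') :=
  @mkDC _ _ _ _ _ _ _ (th0 th') (th0 th) (pn_el T) (pn_el T') (Phi P) (c_Phi P) (d_Phi P).

Notation M := (ps_base A B).

Definition ps_assoc_dom : Functor (PsStrings3 A B) X1 := assoc_dom M.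
Definition ps_assoc_cod : Functor (PsStrings3 A B) X1 := assoc_cod M.
Definition ps_lunit_dom : Functor X1 X1 := lunit_dom M.
Definition ps_runit_dom : Functor X1 X1 := runit_dom M.

(** The proofs of composability in the strings that are formed by [assoc_dom] and the
    like are not reflexivity, but equal to it. *)
Lemma ps_m_string2 {F G H} (S : PN G H) (T : PN F G) p :
  ps_m_obj (@mkPbObj X1 X1 X0 ps_d ps_c (mkPNObj S) (mkPNObj T) p) = mkPNObj (vert_pn S T).
Proof. rewrite (proof_irrelevance _ p eq_refl); reflexivity. Qed.

Lemma ps_asc_dom {F G H K} (U : PN H K) (T : PN G H) (S : PN F G) :
  mkPNObj (vert_pn U (vert_pn T S)) = ps_assoc_dom (string3 U T S) :> X1.
Proof.
symmetry; etransitivity; [|apply ps_m_string2 with (p := eq_refl)].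
apply (f_equal (@ps_m_obj C A B)), pbobj_ext; [reflexivity|apply ps_m_string2].
Qed.
Lemma ps_asc_cod {F G H K} (U : PN H K) (T : PN G H) (S : PN F G) :
  mkPNObj (vert_pn (vert_pn U T) S) = ps_assoc_cod (string3 U T S) :> X1.
Proof.
symmetry; etransitivity; [|apply ps_m_string2 with (p := eq_refl)].
apply (f_equal (@ps_m_obj C A B)), pbobj_ext; [apply ps_m_string2|reflexivity].
Qed.
Lemma ps_lun_dom {F G} (T : PN F G) :
  mkPNObj (vert_pn (id_pn G) T) = ps_lunit_dom (mkPNObj T) :> X1.
Proof. symmetry; apply ps_m_string2. Qed.
Lemma ps_run_dom {F G} (T : PN F G) :
  mkPNObj (vert_pn T (id_pn F)) = ps_runit_dom (mkPNObj T) :> X1.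
Proof. symmetry; apply ps_m_string2. Qed.

Definition ps_asc_string {F G H K} (U : PN H K) (T : PN G H) (S : PN F G) :
    @iso X1 (ps_assoc_dom (string3 U T S)) (ps_assoc_cod (string3 U T S)) :=
  iso_cast (K := X1) (ps_asc_dom U T S) (ps_asc_cod U T S) (ps_gl_iso (asc_pm_law U T S)).

Definition ps_asc_at (x : PsStrings3 A B) :
  @iso X1 (ps_assoc_dom x) (ps_assoc_cod x).
Proof.
destruct x as [[H K U] [[G H' T] [F G' S] p] q]; cbn in p, q; destruct p, q.
exact (ps_asc_string U T S).
Defined.

Definition ps_lun_at (x : X1) : @iso X1 (ps_lunit_dom x) x :=
  match x with mkPNObj T =>
    iso_cast (K := X1) (ps_lun_dom T) eq_refl (ps_gl_iso (lun_pm_law T)) end.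
Definition ps_run_at (x : X1) : @iso X1 (ps_runit_dom x) x :=
  match x with mkPNObj T =>
    iso_cast (K := X1) (ps_run_dom T) eq_refl (ps_gl_iso (run_pm_law T)) end.

Lemma ps_gl_iso_is_pm {F G} {T T' : PN F G} (i : iso (t_ T) (t_ T'))
    (di : d ◁ i ≈ idh (F0 F)) (ci : c ◁ i ≈ idh (F0 G))
    (law : mod_law (K := el_bicat B (C1 A)) (pn_tau T one_el) (pn_tau T' one_el)
      (fwd (iso_at di ci c)) (fwd (iso_at di ci d))) :
  is_pm (fwd (ps_gl_iso law)) (nt_id F) (nt_id G) (fwd i).
Proof. repeat split; constructor. Qed.

Lemma ps_asc_string_is_pm {F G H K} (U : PN H K) (T : PN G H) (S : PN F G) :
  is_pm (fwd (ps_asc_string U T S)) (nt_id F) (nt_id K) (assoc_Phi U T S).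
Proof.
eapply (is_pm_heq (iso_cast_fwd _ _ _)).
exact (is_pm_Phi_heq (asc_Phi_heq U T S) (ps_gl_iso_is_pm (asc_pm_law U T S))).
Qed.

Lemma ps_asc_is_pm (x : PsStrings3 A B) {y z w v : Hom (C0 A) (C0 B)} {u : El y z}
    {t : El z w} {s : El w v} :
  t_ (pb_fst x) = u -> t_ (pb_fst (pb_snd x)) = t -> t_ (pb_snd (pb_snd x)) = s ->
  is_pm (fwd (ps_asc_at x)) (nt_id (src (pb_snd (pb_snd x)))) (nt_id (tgt (pb_fst x)))
    (ce (fwd (el_asc u t s))).
Proof.
destruct x as [[H K U] [[G H' T] [F G' S] p] q]; cbn in p, q; destruct p, q.
intros Eu Et Es; refine (is_pm_Phi_heq _ (ps_asc_string_is_pm U T S)).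
eapply heq_trans; [apply heq_sym, whisker_one|].
apply asc_whisker_heq; rewrite comp1_oner.
- etransitivity; [apply pi1_3_pr3|exact Eu].
- etransitivity; [apply pi2_3_pr3|exact Et].
- etransitivity; [apply pi3_3_pr3|exact Es].
Qed.

Lemma ps_lun_is_pm (x : X1) : is_pm (fwd (ps_lun_at x)) (nt_id (src x)) (nt_id (tgt x))
  (ce (fwd (el_lun (pn_el (pn x))))).
Proof.
destruct x as [F G T]; cbn; eapply is_pm_heq; [apply iso_cast_fwd|].
eapply is_pm_Phi_heq; [|apply ps_gl_iso_is_pm].
eapply heq_trans; [apply lun_Phi_heq|apply heq_sym, (raw_lun_heq (pn_el T))].
Qed.
Lemma ps_run_is_pm (x : X1) : is_pm (fwd (ps_run_at x)) (nt_id (src x)) (nt_id (tgt x))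
  (ce (fwd (el_run (pn_el (pn x))))).
Proof.
destruct x as [F G T]; cbn; eapply is_pm_heq; [apply iso_cast_fwd|].
eapply is_pm_Phi_heq; [|apply ps_gl_iso_is_pm].
eapply heq_trans; [apply run_Phi_heq|apply heq_sym, (raw_run_heq (pn_el T))].
Qed.

(** A square of pseudo-modifications whose vertical sides have identity boundary
    commutes as soon as it does for the underlying 2-cells. *)
Lemma pm_square {T T1 T' T1' : X1} {P : hom T T'} {P1 : hom T1 T1'} {i : hom T T1}
    {i' : hom T' T1'} {F F' G G'} {th : NT F F'} {th' : NT G G'}
    {t t1 t' t1' : Hom (C0 A) (C1 B)} {a : hom t t'} {a1 : hom t1 t1'} {b : hom t t1}
    {b' : hom t' t1'} :
  is_pm P th th' a -> is_pm P1 th th' a1 -> is_pm i (nt_id F) (nt_id G) b ->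
  is_pm i' (nt_id F') (nt_id G') b' -> b' • a = a1 • b -> i' • P = P1 • i.
Proof.
intros HP HP1 Hi Hi' E; apply heq_eq.
eapply is_pm_unique; [reflexivity|reflexivity|apply eq_heq, E| |].
- eapply is_pm_comp; [exact Hi'|exact HP].
- rewrite (comp_idl (th : @hom X0 F F') : nt_comp (nt_id F') th = th).
  rewrite (comp_idl (th' : @hom X0 G G') : nt_comp (nt_id G') th' = th').
  pose proof (is_pm_comp HP1 Hi) as H.
  rewrite (comp_idr (th : @hom X0 F F') : nt_comp th (nt_id F) = th) in H.
  rewrite (comp_idr (th' : @hom X0 G G') : nt_comp th' (nt_id G) = th') in H.
  exact H.
Qed.

Lemma ps_lun_nat (x y : X1) (P : hom x y) :
  fwd (ps_lun_at y) • fmap ps_lunit_dom P = P • fwd (ps_lun_at x).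
Proof.
apply (pm_square (a := ce (dc_tens (dc_unit (th0 (cod_ P))) (pm_el (pm P))))
  (a1 := Phi P) (b := ce (fwd (el_lun (pn_el x)))) (b' := ce (fwd (el_lun (pn_el y))))
  (th := dom_ P) (th' := cod_ P));
  [|apply is_pm_self|apply ps_lun_is_pm|apply ps_lun_is_pm|].
- apply (is_pm_tens (th' := cod_ P)); [repeat split; constructor|apply is_pm_self].
- apply (el_lun_nat (pm_el (pm P))).
Qed.
Lemma ps_run_nat (x y : X1) (P : hom x y) :
  fwd (ps_run_at y) • fmap ps_runit_dom P = P • fwd (ps_run_at x).
Proof.
apply (pm_square (a := ce (dc_tens (pm_el (pm P)) (dc_unit (th0 (dom_ P)))))
  (a1 := Phi P) (b := ce (fwd (el_run (pn_el x)))) (b' := ce (fwd (el_run (pn_el y))))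
  (th := dom_ P) (th' := cod_ P));
  [|apply is_pm_self|apply ps_run_is_pm|apply ps_run_is_pm|].
- apply (is_pm_tens (th' := dom_ P)); [apply is_pm_self|repeat split; constructor].
- apply (el_run_nat (pm_el (pm P))).
Qed.

Lemma ps_asc_nat (x y : PsStrings3 A B) (P : hom x y) :
  fwd (ps_asc_at y) • fmap ps_assoc_dom P
  = fmap ps_assoc_cod P • fwd (ps_asc_at x).
Proof.
destruct x as [[H K U] [[G H1 T] [F G1 S] p] q]; cbn in p, q; destruct p, q.
destruct y as [[H' K' U'] [[G' H1' T'] [F' G1' S'] p] q]; cbn in p, q; destruct p, q.
destruct P as [[thH thK PU] [[thG thH1 PT] [thF thG1 PS] r] s]; cbn in r, s.
destruct (heq_eq r), (heq_eq s).
apply (pm_square (a := ce (dc_tens (pm_el PU) (dc_tens (pm_el PT) (pm_el PS))))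
  (a1 := ce (dc_tens (dc_tens (pm_el PU) (pm_el PT)) (pm_el PS)))
  (b := ce (fwd (el_asc (pn_el U) (pn_el T) (pn_el S))))
  (b' := ce (fwd (el_asc (pn_el U') (pn_el T') (pn_el S'))))
  (th := thF) (th' := thK)); [| |apply (ps_asc_is_pm (u := pn_el U) (t := pn_el T) (s := pn_el S));
    reflexivity
  |apply (ps_asc_is_pm (u := pn_el U') (t := pn_el T') (s := pn_el S')); reflexivity
  |apply (el_asc_nat (pm_el PU) (pm_el PT) (pm_el PS))].
- apply (is_pm_tens (th' := thH)); [repeat split; constructor|].
  apply (is_pm_tens (th' := thG)); repeat split; constructor.
- apply (is_pm_tens (th' := thG)); [|repeat split; constructor].
  apply (is_pm_tens (th' := thH)); repeat split; constructor.
Qed.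

Definition ps_asc : iso (assoc_dom M) (assoc_cod M) := nat_iso ps_asc_nat.
Definition ps_lun : iso (lunit_dom M) one :=
  nat_iso (F := lunit_dom M) (G := functor_id X1) ps_lun_nat.
Definition ps_run : iso (runit_dom M) one :=
  nat_iso (F := runit_dom M) (G := functor_id X1) ps_run_nat.

End Constraints.

(** * Coherence *)

Section Laws.
Context {C : TwoCategory} {A B : PseudoCategory C}.
Notation X0 := (PsFunctors (A := A) (B := B)).
Notation X1 := (PsTransformations (A := A) (B := B)).
Notation M := (ps_base A B).

Lemma ps_d_whisker {K : Category} {F G : Functor K X1} (a : NatTrans F G) (H : Functor K X0) :
  functor_comp ps_d F = H -> functor_comp ps_d G = H ->
  (forall x, @heq X0 _ _ (dom_ (a x)) _ _ (nt_id (H x))) ->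
  @comp2 Cat K X1 X0 ps_d ps_d F G (idh (ps_d : FunctorCategory X1 X0)) a
  ≈ idh (H : FunctorCategory K X0).
Proof.
intros EF EG E; apply nattrans_heq; [exact EF|exact EG|intros x].
eapply heq_trans; [apply eq_heq, (@comp_idl X0)|apply E].
Qed.

Lemma ps_c_whisker {K : Category} {F G : Functor K X1} (a : NatTrans F G) (H : Functor K X0) :
  functor_comp ps_c F = H -> functor_comp ps_c G = H ->
  (forall x, @heq X0 _ _ (cod_ (a x)) _ _ (nt_id (H x))) ->
  @comp2 Cat K X1 X0 ps_c ps_c F G (idh (ps_c : FunctorCategory X1 X0)) a
  ≈ idh (H : FunctorCategory K X0).
Proof.
intros EF EG E; apply nattrans_heq; [exact EF|exact EG|intros x].
eapply heq_trans; [apply eq_heq, (@comp_idl X0)|apply E].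
Qed.

Lemma ps_d_lun : d ◁ ps_lun ≈ idh (@d _ M).
Proof. apply ps_d_whisker; [apply (d_lunit_dom M)|apply (comp1_oner (t := Cat))|intros x].
exact (proj1 (ps_lun_is_pm x)). Qed.
Lemma ps_c_lun : c ◁ ps_lun ≈ idh (@c _ M).
Proof. apply ps_c_whisker; [apply (c_lunit_dom M)|apply (comp1_oner (t := Cat))|intros x].
exact (proj1 (proj2 (ps_lun_is_pm x))). Qed.
Lemma ps_d_run : d ◁ ps_run ≈ idh (@d _ M).
Proof. apply ps_d_whisker; [apply (d_runit_dom M)|apply (comp1_oner (t := Cat))|intros x].
exact (proj1 (ps_run_is_pm x)). Qed.
Lemma ps_c_run : c ◁ ps_run ≈ idh (@c _ M).
Proof. apply ps_c_whisker; [apply (c_runit_dom M)|apply (comp1_oner (t := Cat))|intros x].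
exact (proj1 (proj2 (ps_run_is_pm x))). Qed.

Lemma string3_el (x : PsStrings3 A B) : exists (y z w v : Hom (C0 A) (C0 B))
  (u : El y z) (t : El z w) (s : El w v),
  t_ (pb_fst x) = u /\ t_ (pb_fst (pb_snd x)) = t /\ t_ (pb_snd (pb_snd x)) = s.
Proof.
destruct x as [[H K U] [[G H' T] [F G' S] p] q]; cbn in p, q; destruct p, q.
do 4 eexists; exists (pn_el U), (pn_el T), (pn_el S); repeat split.
Qed.

Lemma ps_d_asc : d ◁ ps_asc ≈ idh (@d _ M ∘ pi3_3).
Proof.
apply ps_d_whisker; [apply (d_assoc_dom M)|apply (d_assoc_cod M)|intros x].
destruct (string3_el x) as (? & ? & ? & ? & u & t & s & Eu & Et & Es).
exact (proj1 (ps_asc_is_pm Eu Et Es)).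
Qed.
Lemma ps_c_asc : c ◁ ps_asc ≈ idh (@c _ M ∘ pi1_3).
Proof.
apply ps_c_whisker; [apply (c_assoc_dom M)|apply (c_assoc_cod M)|intros x].
destruct (string3_el x) as (? & ? & ? & ? & u & t & s & Eu & Et & Es).
exact (proj1 (proj2 (ps_asc_is_pm Eu Et Es))).
Qed.

Lemma is_pm_vcomp {K : Category} {F G G' H : Functor K X1} {b : NatTrans G' H}
    {a : NatTrans F G} {p} {x : K} {L N : PseudoFunctor A B} {t t' t'' : Hom (C0 A) (C1 B)}
    {Pa : hom t t'} {Pb : hom t' t''} :
  is_pm (b x) (nt_id L) (nt_id N) Pb -> is_pm (a x) (nt_id L) (nt_id N) Pa ->
  is_pm (component (vcomp (K := FunctorCategory K X1) b a p) x) (nt_id L) (nt_id N)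
    (Pb • Pa).
Proof. destruct p; apply is_pm_gl_comp. Qed.

Lemma is_pm_whisker {K K' : Category} {F G : Functor K' X1} {a : NatTrans F G}
    {k : Functor K K'} {x : K} {L N : PseudoFunctor A B} {t t' : Hom (C0 A) (C1 B)}
    {Pa : hom t t'} :
  is_pm (a (k x)) (nt_id L) (nt_id N) Pa ->
  is_pm (component (hcomp a (nattrans_id k)) x) (nt_id L) (nt_id N) Pa.
Proof.
apply is_pm_heq, eq_heq.
eapply eq_trans; [apply (f_equal (@comp X1 _ _ _ _)), fmap_id|apply (@comp_idr X1)].
Qed.

Lemma is_pm_id {T : X1} {t : Hom (C0 A) (C1 B)} :
  t_ (pn T) = t -> is_pm (idh T) (nt_id (src T)) (nt_id (tgt T)) (idh t).
Proof. intros <-; repeat split; constructor. Qed.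

Lemma is_pm_pair {K : Category} {F F' G G' : Functor K X1} {a : NatTrans F F'}
    {b : NatTrans G G'} {q q' r} {x : K} {L N O : PseudoFunctor A B}
    {u u' v v' : Hom (C0 A) (C1 B)} {Pa : hom u u'} {Pb : hom v v'} {o o' s} :
  is_pm (a x) (nt_id N) (nt_id O) Pa -> is_pm (b x) (nt_id L) (nt_id N) Pb ->
  is_pm (component (m (M := M) ◁ pc2 (G := M) (a := a) (b := b) q q' r) x)
   (nt_id L) (nt_id O) (m ◁ pc2 (G := B) (a := Pa) (b := Pb) o o' s).
Proof.
intros Ha Hb; eapply is_pm_heq; [apply eq_heq, (@comp_idl X1)|].
exact (is_pm_tens (P := @component K (PsStrings2 A B) _ _ (pc2 (G := M) q q' r) x) Ha Hb).
Qed.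

Lemma is_pm_asc {K : Cat} {k : Hom K (P3 M)} {x : obj K} {L N : PseudoFunctor A B}
    {y z w v : Hom (C0 A) (C0 B)} {u : El y z} {t : El z w} {s : El w v} :
  src (pb_snd (pb_snd (fobj k x))) = L -> tgt (pb_fst (fobj k x)) = N ->
  t_ (pb_fst (fobj k x)) = u -> t_ (pb_fst (pb_snd (fobj k x))) = t ->
  t_ (pb_snd (pb_snd (fobj k x))) = s ->
  is_pm (component (fwd ps_asc ▷ k) x) (nt_id L) (nt_id N) (ce (fwd (el_asc u t s))).
Proof.
intros <- <- Eu Et Es; apply is_pm_whisker; exact (ps_asc_is_pm Eu Et Es).
Qed.

Lemma ps_pentagon : pentagon_law ps_d_asc ps_c_asc.
Proof.
unfold pentagon_law.
match goal with |- @heq _ ?x ?y _ ?x' ?y' _ =>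
  assert (Es : x = x') by apply (pentagon_source (M := M));
  assert (Et : y = y') by apply (pentagon_target (M := M)) end.
apply (nattrans_heq Es Et); intros x.
apply (f_equal (@fobj _ _)) in Es, Et.
apply (f_equal (fun k => k x)) in Es, Et.
destruct x as [[K L R] [[H K' U] [[G H' T] [F G' S] p] q] r]; cbn in p, q, r.
destruct p, q, r.
pose proof (el_pentagon (pn_el R) (pn_el U) (pn_el T) (pn_el S)) as E.
rewrite comp_assoc in E.
refine (is_pm_unique Es Et (eq_heq E) (th := nt_id F) (th' := nt_id L) _ _); clear Es Et E.
- apply is_pm_vcomp.
  + apply is_pm_asc; cbn -[ps_m_obj]; first [apply ps_m_t; reflexivity | reflexivity].
  + apply is_pm_asc; cbn -[ps_m_obj]; first [apply ps_m_t; reflexivity | reflexivity].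
- apply is_pm_vcomp; [apply is_pm_vcomp|].
  + apply (is_pm_pair (N := G)).
    * apply is_pm_asc; cbn -[ps_m_obj]; first [apply ps_m_t; reflexivity | reflexivity].
    * apply (is_pm_id (T := mkPNObj S)); reflexivity.
  + apply is_pm_asc; cbn -[ps_m_obj]; first [apply ps_m_t; reflexivity | reflexivity].
  + apply (is_pm_pair (N := K)).
    * apply (is_pm_id (T := mkPNObj R)); reflexivity.
    * apply is_pm_asc; cbn -[ps_m_obj]; first [apply ps_m_t; reflexivity | reflexivity].
Qed.

Lemma is_pm_lun {K : Cat} {k : Hom K (C1 M)} {x : obj K} {F G : PseudoFunctor A B} {T : PN F G} :
  fobj k x = mkPNObj T ->
  is_pm (component (fwd ps_lun ▷ k) x) (nt_id F) (nt_id G) (ce (fwd (el_lun (pn_el T)))).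
Proof.
intros E; apply is_pm_whisker.
change (is_pm (fwd (ps_lun_at (fobj k x))) (nt_id F) (nt_id G) (ce (fwd (el_lun (pn_el T))))).
rewrite E; apply (ps_lun_is_pm (mkPNObj T)).
Qed.
Lemma is_pm_run {K : Cat} {k : Hom K (C1 M)} {x : obj K} {F G : PseudoFunctor A B} {T : PN F G} :
  fobj k x = mkPNObj T ->
  is_pm (component (fwd ps_run ▷ k) x) (nt_id F) (nt_id G) (ce (fwd (el_run (pn_el T)))).
Proof.
intros E; apply is_pm_whisker.
change (is_pm (fwd (ps_run_at (fobj k x))) (nt_id F) (nt_id G) (ce (fwd (el_run (pn_el T))))).
rewrite E; apply (ps_run_is_pm (mkPNObj T)).
Qed.

Lemma ps_triangle : triangle_law ps_asc ps_c_lun ps_d_run.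
Proof.
unfold triangle_law.
match goal with |- @heq _ ?x ?y _ ?x' ?y' _ =>
  assert (Es : x = x') by apply (triangle_source (M := M));
  assert (Et : y = y') by apply (triangle_target (M := M)) end.
apply (nattrans_heq Es Et); intros x.
apply (f_equal (@fobj _ _)) in Es, Et.
apply (f_equal (fun k => k x)) in Es, Et.
destruct x as [[G H T] [F G' S] p]; cbn in p; destruct p.
refine (is_pm_unique Es Et (eq_heq (el_triangle (pn_el T) (pn_el S)))
  (th := nt_id F) (th' := nt_id H) _ _); clear Es Et.
- apply is_pm_vcomp.
  + apply (is_pm_pair (N := G)); [apply is_pm_run; reflexivity|].
    apply (is_pm_id (T := mkPNObj S)); reflexivity.
  + apply is_pm_asc; cbn -[ps_m_obj]; reflexivity.
- apply (is_pm_pair (N := G)); [|apply is_pm_lun; reflexivity].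
  apply (is_pm_id (T := mkPNObj T)); reflexivity.
Qed.

Lemma ps_lam_e : ps_lun ▷ e (M := M) ≈ ps_run ▷ e (M := M).
Proof.
apply (nattrans_heq (units_e M) (eq_refl : one ∘ e (M := M) = one ∘ e)); intros x.
refine (is_pm_unique _ _ _ (is_pm_lun (k := e (M := M)) (x := x) eq_refl)
  (is_pm_run (k := e (M := M)) (x := x) eq_refl)).
- exact (functor_eq_obj (units_e M) x).
- reflexivity.
- eapply heq_trans; [apply (raw_lun_heq (pn_el (id_pn x)))|].
  eapply heq_trans; [|apply heq_sym, (raw_run_heq (pn_el (id_pn x)))].
  eapply heq_trans; [apply heq_sym, whisker_whisker|].
  eapply heq_trans; [|apply whisker_whisker].
  apply comp2_heq; [apply lam_e|constructor].
Qed.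

Definition ps_coherence : Coherence M :=
  @mkCoherence Cat M ps_asc ps_lun ps_run ps_d_lun ps_c_lun ps_d_run ps_c_run ps_d_asc ps_c_asc
    ps_lam_e ps_pentagon ps_triangle.
End Laws.

Theorem theorem3 (C : TwoCategory) (A B : PseudoCategory C) :
  exists (M : Mult (PsGraph A B)) (K : Coherence (mkBase M)),
    let X0 := PsFunctors (A := A) (B := B) in
    let X1 := PsTransformations (A := A) (B := B) in
    let E : Functor X0 X1 := e0 M in
    let Tens : Functor (PsStrings2 A B) X1 := m0 M in
    (forall F : PseudoFunctor A B, is_pn (E F) F F (e ∘ F0 F) (id_tau F)) /\
    (forall (F G : PseudoFunctor A B) (th : NT F G),
      is_pm (fmap E (th : @hom X0 F G)) th th (e ◁ th0 th)) /\
    (forall (F G H : PseudoFunctor A B) (S : PN G H) (T : PN F G),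
      is_pn (Tens (string2 S T)) F H (vert_t S T) (vert_tau S T)) /\
    (forall (F G H F' G' H' : PseudoFunctor A B) (S : PN G H) (T : PN F G)
        (S' : PN G' H') (T' : PN F' G') (th : NT F F') (th' : NT G G')
        (th'' : NT H H') (Psi : PM S S' th' th'') (Phi : PM T T' th th'),
      is_pm (fmap Tens (string2_hom Psi Phi)) th th'' (vert_Phi Psi Phi)) /\
    (forall (F G H L : PseudoFunctor A B) (U : PN H L) (T : PN G H) (S : PN F G),
      is_pm (component (fwd (alpha K)) (string3 U T S)) (nt_id F) (nt_id L)
        (assoc_Phi U T S)) /\
    (forall (F G : PseudoFunctor A B) (T : PN F G),
      is_pm (component (fwd (lam K)) (mkPNObj T)) (nt_id F) (nt_id G) (lam B ▷ t_ T)) /\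
    (forall (F G : PseudoFunctor A B) (T : PN F G),
      is_pm (component (fwd (rho K)) (mkPNObj T)) (nt_id F) (nt_id G) (rho B ▷ t_ T)).
Proof.
exists (ps_mult A B), ps_coherence; cbv zeta.
split; [|split; [|split; [|split; [|split; [|split]]]]]; intros.
- exact (conj eq_refl (conj eq_refl (conj eq_refl (id_pn_tau F)))).
- repeat split; constructor.
- exact (conj eq_refl (conj eq_refl (conj eq_refl (vert_pn_tau S T)))).
- split; [constructor|split; [constructor|]].
  apply (ps_m_Phi (P := string2_hom Psi Phi)); constructor.
- exact (ps_asc_string_is_pm U T S).
- exact (is_pm_Phi_heq (raw_lun_heq (pn_el T)) (ps_lun_is_pm (mkPNObj T))).
- exact (is_pm_Phi_heq (raw_run_heq (pn_el T)) (ps_run_is_pm (mkPNObj T))).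
Qed.
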